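(* For every real $d\ge 1$ there exists $q(d)<\infty$ such that for every integer $q\ge q(d)$ the following holds. Let $G$ be a random graph distributed as $G(n,d/n)$. Then there is a constant $C<\infty$ not depending on $n$ such that, with high probability (i.e. with probability tending to $1$ as $n\to\infty$), the mixing time of the Gibbs sampler of $q$-colorings of $G$ is $O(n^{C})$.
   Context: $G(n,p)$ is the Erdős–Rényi random graph on $n$ vertices in which each potential edge is present independently with probability $p$. Coloring model: for a finite graph $G=(V,E)$ and a set $\mathcal C$ of $q$ colors, the coloring distribution $P$ is the uniform distribution on proper colorings $\sigma\in\mathcal C^V$ (those with $\sigma(u)\ne\sigma(v)$ for all $(u,v)\in E$). Gibbs sampler of $q$-colorings: the discrete time Markov chain on the proper $q$-colorings of $G$ in which, from the current configuration $\sigma$, a vertex $v\in V$ is chosen uniformly at random, $\sigma'(w)=\sigma(w)$ for all $w\ne v$, and $\sigma'(v)$ is chosen uniformly from $\mathcal C\setminus\{\sigma(w): w\in N(v)\}$, where $N(v)=\{w:(v,w)\in E\}$. The mixing time $\tau_{mix}$ is the number of steps needed to guarantee that the chain, started from an arbitrary state, is within total variation distance $(2e)^{-1}$ of the stationary distribution. The constant implied in $O(n^C)$ does not depend on $n$ or on the realization of the graph. *)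

(* Defs.v *)
From mathcomp Require Import all_boot all_order all_algebra.
From mathcomp Require Import all_classical all_reals all_analysis.

Set Implicit Arguments.
Unset Strict Implicit.
Unset Printing Implicit Defensive.

Import Order.TTheory GRing.Theory Num.Theory.
Import numFieldNormedType.Exports.

Local Open Scope ring_scope.

(* A simple graph on V is given by its edge set G : {set {set V}}, a subset of
   potential_edges V. *)
Definition potential_edges (V : finType) : {set {set V}} :=
  [set e : {set V} | #|e| == 2%N].

Definition neighbors (V : finType) (G : {set {set V}}) (v : V) : {set V} :=
  [set w | [set v; w] \in G].

(* For p outside [0, 1] these weights do not define a probability; for
   p = d / n this happens only for the finitely many n < d. *)
Definition Gnp_weight (R : realType) (n : nat) (p : R)
    (G : {set {set 'I_n}}) : R :=
  \prod_(e in potential_edges 'I_n) (if e \in G then p else 1 - p).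

Definition Gnp_prob (R : realType) (n : nat) (p : R)
    (A : pred {set {set 'I_n}}) : R :=
  \sum_(G in powerset (potential_edges 'I_n) | A G) Gnp_weight p G.

Definition proper_coloring (V C : finType) (G : {set {set V}})
    (s : {ffun V -> C}) : bool :=
  [forall u, forall v in neighbors G u, s u != s v].

Definition coloring (V C : finType) (G : {set {set V}}) :=
  {s : {ffun V -> C} | proper_coloring G s}.

Definition coloring_distribution (R : realType) (V C : finType)
    (G : {set {set V}}) (s : coloring C G) : R :=
  #|{: coloring C G}|%:R^-1.

Definition available (V C : finType) (G : {set {set V}}) (s : {ffun V -> C})
    (v : V) : {set C} :=
  ~: (s @: neighbors G v).

Definition recolor (V C : finType) (s : {ffun V -> C}) (v : V) (c : C) :
    {ffun V -> C} :=
  [ffun w => if w == v then c else s w].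

(* The second inverse is never that of 0: available G (val s) v contains
   val s v. *)
Definition gibbs (R : realType) (V C : finType) (G : {set {set V}})
    (s s' : coloring C G) : R :=
  \sum_(v : V) #|V|%:R^-1 *
    \sum_(c in available G (val s) v)
      #|available G (val s) v|%:R^-1 * (val s' == recolor (val s) v c)%:R.

Fixpoint transition (R : realType) (T : finType) (K : T -> T -> R) (t : nat)
    (x y : T) : R :=
  if t is t'.+1 then \sum_(z : T) transition K t' x z * K z y
  else (x == y)%:R.

Definition tv_distance (R : realType) (T : finType) (mu nu : T -> R) : R :=
  2^-1 * \sum_(x : T) `|mu x - nu x|.

(* Equal to +oo if the chain never gets within the required distance. *)
Definition mixing_time (R : realType) (T : finType) (K : T -> T -> R)
    (pi : T -> R) : \bar R :=
  ereal_inf [set (t%:R)%:E | t in [set t : nat |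
    forall x : T,
      tv_distance (transition K t x) pi <= (2 * expR 1)^-1]]%classic.

(* Without a proper coloring there is no chain, and mixing_time would be an
   infimum over a vacuous condition; hence the first conjunct. *)
Definition gibbs_mixes_within (R : realType) (V C : finType)
    (G : {set {set V}}) (B : R) : bool :=
  (0 < #|{: coloring C G}|)%N &&
  (mixing_time (gibbs R (C := C) (G := G))
     (@coloring_distribution R V C G) <= B%:E)%E.

(* Main.v *)
(** Fix a small [a > 0] and call a vertex high if its degree exceeds
    [D = 1 / a].  Give a vertex of degree [r] the mass [r + 1] if it is high and
    [a (r + 1)] otherwise, and call a connected set bad if the product of its
    masses exceeds 1.  The blocks of a vertex set are the connected components
    of the union of its bad subsets, and its remaining single vertices.  If [q]
    is large compared with [D], then the influence of a boundary vertex on a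
    block is a sum over exploration trees, and it is small because a connected
    set containing that vertex and reaching into the block is not bad.  Hence
    heat-bath block dynamics contracts, and the variance of a function is at
    most twice the sum of its expected block variances.

    Inside a block one removes a connected set [Q] of maximal (rescaled) mass.
    All outside neighbors of [Q] are low, so comparing two colorings of [Q]
    through colorings outside that are compatible with both costs a factor
    exponential in the sum of the degrees over [Q] only.  What remains splits
    into smaller blocks, and one iterates.  By maximality, the sets removed along
    a branch of this recursion can be joined to a connected set of large average
    degree.  With high probability such a set in [G(n, d/n)] has total degree
    [O(log n)], by a first moment bound over its spanning trees, so that the
    Poincare constant of the Gibbs sampler is polynomial in [n]. *)

Require Import Defs.
From mathcomp Require Import all_boot all_order all_algebra.
From mathcomp Require Import all_classical all_reals all_analysis.
From mathcomp Require Import ring lra zify fintype finset.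

Set Implicit Arguments.
Unset Strict Implicit.
Unset Printing Implicit Defensive.

Import Order.TTheory GRing.Theory Num.Theory.
Import numFieldNormedType.Exports.
Local Open Scope ring_scope.

(** * Averages, projections and spectral gaps *)

(** The obstacle is that $G(n,d/n)$ has vertices of unbounded degree: for fixed [q] single-site
    arguments fail there, and an adverse boundary could leave such a vertex without a color. Blocks
    therefore swallow all neighbors of their high vertices ([full]), so that the boundary never
    shortens the list of a high vertex and every boundary condition, proper or not, admits a
    coloring of the block. The rescaling divides each mass by [b], where [a = b ^+ 2]. Since
    [mass / b = b * mu] with [mu = mass / a >= 1], it charges a factor [b] per vertex, and a maximal
    [Q] can pay for its own vertices and again for the set that connects it to the next one. Two
    properties of the random graph are used, with [M = O(log n)]: connected sets of average weight
    at least [A] have total weight at most [M], and any set of at most [M] vertices has a vertex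
    with at most three neighbors inside. All constants come from one integer [A] depending on [d]:
    [b = 2^(-4A)], [a = 2^(-8A) = 1/D], [beta = a/2], [eps = a^2/2], and [q] is at least [4 D^3]. *)

Lemma sumr_cst (R : pzRingType) (I : finType) (A : {pred I}) (k : R) :
  \sum_(i in A) k = #|A|%:R * k.
Proof. by rewrite sumr_const -[in LHS]mulr_natl. Qed.

Section Averages.
Variables (R : realType) (T : finType).
Implicit Types (X Y Z : {set T}) (f g : T -> R).

(** The average over the empty set is 0, by the convention for division by zero; statements that
    would fail there take a member of [X] as an argument. *)
Definition avg X f : R := (\sum_(x in X) f x) / #|X|%:R.
Definition varf X f : R := avg X (fun x => (f x - avg X f) ^+ 2).

Lemma natr_card_gt0 X x : x \in X -> 0 < #|X|%:R :> R.
Proof. by move=> xX; rewrite ltr0n; apply/card_gt0P; exists x. Qed.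

Lemma eq_avg X f g : {in X, f =1 g} -> avg X f = avg X g.
Proof. by move=> fg; rewrite /avg (eq_bigr g). Qed.

Lemma avg_ge0 X f : {in X, forall x, 0 <= f x} -> 0 <= avg X f.
Proof. by move=> f0; rewrite divr_ge0 // sumr_ge0. Qed.

Lemma varf_ge0 X f : 0 <= varf X f.
Proof. by apply: avg_ge0 => x _; rewrite sqr_ge0. Qed.

Lemma le_avg X f g : {in X, forall x, f x <= g x} -> avg X f <= avg X g.
Proof. by move=> fg; rewrite ler_wpM2r ?invr_ge0 // ler_sum. Qed.

Lemma avg_cst X (k : R) x : x \in X -> avg X (fun=> k) = k.
Proof.
move=> xX; rewrite /avg sumr_cst mulrAC mulfV ?mul1r //.
by rewrite gt_eqF // (natr_card_gt0 xX).
Qed.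

Lemma avgM X f x : x \in X -> \sum_(y in X) f y = #|X|%:R * avg X f.
Proof. by move=> xX; rewrite mulrC mulfVK // gt_eqF // (natr_card_gt0 xX). Qed.

Lemma avgD X f g : avg X (fun x => f x + g x) = avg X f + avg X g.
Proof. by rewrite /avg big_split mulrDl. Qed.

Lemma avgN X f : avg X (fun x => - f x) = - avg X f.
Proof. by rewrite /avg sumrN mulNr. Qed.

Lemma avgZ X (k : R) f : avg X (fun x => k * f x) = k * avg X f.
Proof. by rewrite /avg -mulr_sumr mulrA. Qed.

Lemma avg_sum (I : finType) (P : pred I) X (f : I -> T -> R) :
  avg X (fun x => \sum_(i | P i) f i x) = \sum_(i | P i) avg X (f i).
Proof. by rewrite /avg exchange_big mulr_suml. Qed.

Lemma avg_sqr X f : avg X f ^+ 2 <= avg X (fun x => f x ^+ 2).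
Proof.
have [->|[x xX]] := set_0Vmem X.
  by rewrite /avg !big_set0 !mul0r expr0n.
suff : 0 <= avg X (fun x => (f x - avg X f) ^+ 2).
  rewrite (_ : avg X _ = avg X (fun x => f x ^+ 2 + (- (2 * avg X f) * f x + avg X f ^+ 2))); last first.
    by apply: eq_avg => y _; ring.
  rewrite avgD avgD avgZ (avg_cst _ xX); nra.
exact: varf_ge0.
Qed.

Lemma varfE X f x : x \in X -> varf X f = avg X (fun x => f x ^+ 2) - avg X f ^+ 2.
Proof.
move=> xX; rewrite /varf.
rewrite (_ : avg X _ = avg X (fun x => f x ^+ 2 + (- (2 * avg X f) * f x + avg X f ^+ 2))); last first.
  by apply: eq_avg => y _; ring.
by rewrite avgD avgD avgZ (avg_cst _ xX); ring.
Qed.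

Lemma avg_bounds X f (l u : R) x : x \in X ->
  {in X, forall x, l <= f x <= u} -> l <= avg X f <= u.
Proof.
move=> xX fb; apply/andP; split.
  by rewrite -[l](avg_cst _ xX); apply: le_avg => y /fb/andP[].
by rewrite -[u](avg_cst _ xX); apply: le_avg => y /fb/andP[].
Qed.

Lemma avg_dist X Y f g (d : R) x y : x \in X -> y \in Y ->
  (forall x y, x \in X -> y \in Y -> `|f x - g y| <= d) ->
  `|avg X f - avg Y g| <= d.
Proof.
move=> xX yY fg.
have h z : z \in X -> f z - d <= avg Y g <= f z + d.
  move=> zX; apply: (avg_bounds yY) => t /(fg _ _ zX).
  by rewrite ler_norml; lra.
have : avg Y g - d <= avg X f <= avg Y g + d.
  by apply: (avg_bounds xX) => z /h; lra.
by rewrite ler_norml; lra.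
Qed.

(** The common part contributes no more to [avg X h] than to [avg Y h], because [X] is the larger
    set; what is left is the part of [X] outside [Y]. *)
Lemma avg_tv_le X Y h (r eps : R) x y : x \in X -> y \in Y ->
  (#|Y| <= #|X|)%N -> 0 <= r ->
  (forall u, u \in X :|: Y -> 0 <= h u <= r) ->
  #|X :\: Y|%:R <= eps * #|X|%:R ->
  avg X h - avg Y h <= eps * r.
Proof.
move=> xX yY XY r0 h0 h1.
have X0 := natr_card_gt0 xX; have Y0 := natr_card_gt0 yY.
have hY : \sum_(u in X :&: Y) h u / #|X|%:R <= avg Y h.
  rewrite -mulr_suml /avg; apply: ler_pM.
  - apply: sumr_ge0 => u; rewrite inE => /andP[uX _].
    have /h0/andP[//] : u \in X :|: Y by rewrite inE uX.
  - by rewrite invr_ge0 ltW.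
  - rewrite [leRHS](bigID (mem X)) /=.
    rewrite [X in _ <= X + _](eq_bigl (mem (X :&: Y))); last first.
      by move=> u; rewrite !inE andbC.
    rewrite lerDl; apply: sumr_ge0 => u /andP[uY _].
    have /h0/andP[//] : u \in X :|: Y by rewrite inE uY orbT.
  - by rewrite lef_pV2 ?posrE // ler_nat.
have hX : avg X h = \sum_(u in X :&: Y) h u / #|X|%:R +
                    \sum_(u in X :\: Y) h u / #|X|%:R.
  rewrite /avg -!mulr_suml -mulrDl; congr (_ / _).
  rewrite (bigID (mem Y)) /=; congr (_ + _); apply: eq_bigl => u; rewrite !inE //.
  by rewrite andbC.
have h3 : \sum_(u in X :\: Y) h u / #|X|%:R <= eps * r.
  rewrite -mulr_suml ler_pdivrMr //.
  apply: (@le_trans _ _ (\sum_(u in X :\: Y) r)).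
    apply: ler_sum => u; rewrite inE => /andP[_ uX].
    have /h0/andP[//] : u \in X :|: Y by rewrite inE uX.
  by rewrite sumr_cst mulrAC; exact: ler_wpM2r.
by rewrite hX; lra.
Qed.

(* The total variation distance between the uniform distributions on [X] and
   [Y] is the fraction of the larger set outside the other one. *)
Lemma avg_tv X Y g (r eps : R) x y : x \in X -> y \in Y ->
  (forall u v, u \in X :|: Y -> v \in X :|: Y -> `|g u - g v| <= r) ->
  #|X :\: Y|%:R <= eps * #|X|%:R -> #|Y :\: X|%:R <= eps * #|Y|%:R ->
  `|avg X g - avg Y g| <= eps * r.
Proof.
wlog XY : X Y x y / (#|Y| <= #|X|)%N.
  move=> H; case/orP: (leq_total #|Y| #|X|) => XY xX yY gr h1 h2.
    exact: (H _ _ _ _ XY xX yY).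
  rewrite distrC; apply: (H _ _ _ _ XY yY xX) => //.
  by move=> u v; rewrite setUC; apply: gr.
move=> xX yY gr h1 _.
have xXY : x \in X :|: Y by rewrite inE xX.
(* Subtracting the minimum makes [g] nonnegative with range at most [r]; the reflected function
   [l + r - g] gives the opposite inequality. *)
set l := \big[Num.min/g x]_(u in X :|: Y) g u.
have lP u : u \in X :|: Y -> l <= g u by move=> uX; apply: bigmin_le_cond.
have [v vXY lv] : exists2 v, v \in X :|: Y & l = g v.
  rewrite /l; elim/big_ind: _.
  - by exists x.
  - move=> a b [u uX ->] [v vX ->]; rewrite minEle.
    by case: ifP => _; [exists u|exists v].
  - by move=> u uX; exists u.
have hr u : u \in X :|: Y -> 0 <= g u - l <= r.
  move=> uXY; rewrite subr_ge0 lP //= lv.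
  by apply: le_trans (gr _ _ uXY vXY); rewrite ler_norm.
have r0 : 0 <= r by have /andP[h3 h4] := hr _ vXY; apply: le_trans h4.
have k1 := @avg_tv_le X Y (fun u => g u - l) r eps x y xX yY XY r0 hr h1.
have hr' u : u \in X :|: Y -> 0 <= l + r - g u <= r by move=> /hr; lra.
have k2 := @avg_tv_le X Y (fun u => l + r - g u) r eps x y xX yY XY r0 hr' h1.
move: k1 k2; rewrite !avgD !avgN !(avg_cst _ xX) !(avg_cst _ yY).
by rewrite ler_norml; lra.
Qed.

End Averages.

Section Projections.
Variables (R : realType) (T : finType) (X : {set T}).
Implicit Types (f g : T -> R) (cl : T -> {set T}).

(** A partition of [X], given by the map from a point to its class; [proj] is then conditional
    expectation. *)
Definition classes cl := forall x, x \in X ->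
  x \in cl x /\ forall y, y \in cl x -> y \in X /\ cl y = cl x.

Definition proj cl f x : R := avg (cl x) f.

Lemma proj_cl cl f x y : classes cl -> x \in X -> y \in cl x ->
  proj cl f y = proj cl f x.
Proof. by move=> clX xX yx; rewrite /proj; have [_ /(_ _ yx)[_ ->]] := clX _ xX. Qed.

Lemma sum_proj cl f : classes cl ->
  \sum_(x in X) proj cl f x = \sum_(x in X) f x.
Proof.
move=> clX; rewrite /proj /avg.
under eq_bigr do rewrite mulr_suml.
rewrite (exchange_big_dep (mem X)) /=; last first.
  by move=> x y xX yx; have [_ /(_ _ yx)[]] := clX _ xX.
apply: eq_bigr => y yX.
have [yy ycl] := clX _ yX.
rewrite (eq_bigl (mem (cl y))); last first.
  move=> x; apply/andP/idP => [[xX yx]|xy].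
    have [xx /(_ _ yx)[_ e]] := clX _ xX.
    by rewrite /in_mem /= e.
  by have [xX e] := ycl _ xy; split; rewrite ?e.
rewrite (eq_bigr (fun=> f y / #|cl y|%:R)); last first.
  by move=> x xy; have [_ ->] := ycl _ xy.
rewrite sumr_cst mulrC mulfVK //.
by rewrite gt_eqF // (natr_card_gt0 _ yy).
Qed.

(** [proj cl g] is constant on classes, so averaging [f * proj cl g] over a class only replaces [f]
    by its projection. This is the self-adjointness of conditional expectation. *)
Lemma sum_projM cl f g : classes cl ->
  \sum_(x in X) f x * proj cl g x = \sum_(x in X) proj cl f x * proj cl g x.
Proof.
move=> clX; rewrite -(sum_proj (fun x => f x * proj cl g x) clX).
apply: eq_bigr => x xX; rewrite mulrC -avgZ.
by apply: eq_avg => y yx; rewrite (proj_cl _ clX xX yx) mulrC.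
Qed.

Lemma sum_varf cl f : classes cl ->
  \sum_(x in X) varf (cl x) f =
  \sum_(x in X) f x ^+ 2 - \sum_(x in X) proj cl f x * f x.
Proof.
move=> clX.
under [X in _ = _ - X]eq_bigr do rewrite mulrC.
rewrite sum_projM // -(sum_proj (fun x => f x ^+ 2) clX) -sumrB.
apply: eq_bigr => x xX; have [xx _] := clX _ xX.
by rewrite (varfE _ xx) -expr2.
Qed.

Lemma sum_varf_sqr cl f : classes cl ->
  \sum_(x in X) varf (cl x) f = \sum_(x in X) (f x - proj cl f x) ^+ 2.
Proof.
move=> clX; rewrite -(sum_proj (fun x => (f x - proj cl f x) ^+ 2) clX).
apply: eq_bigr => x xX; apply: eq_avg => y yx.
by rewrite (proj_cl _ clX xX yx).
Qed.

Lemma avg_proj cl f : classes cl -> avg X (proj cl f) = avg X f.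
Proof. by move=> clX; rewrite /avg sum_proj. Qed.

(** Law of total variance. *)
Lemma varf_decomp cl f : classes cl ->
  varf X f = avg X (fun x => varf (cl x) f) + varf X (proj cl f).
Proof.
move=> clX; have [X0|[x xX]] := set_0Vmem X.
  by rewrite /varf /avg X0 !big_set0 !mul0r addr0.
rewrite !(varfE _ xX) avg_proj // addrA; congr (_ - _).
rewrite /avg -mulrDl; congr (_ / _); rewrite sum_varf //.
under [X in _ = _ - X + _]eq_bigr do rewrite mulrC.
by rewrite sum_projM //; under [X in _ = _ + X]eq_bigr do rewrite expr2; ring.
Qed.

End Projections.

Section Gap.
Variables (R : realType) (T I : finType) (X : {set T}).
Variable cl : I -> T -> {set T}.
Hypothesis clX : forall i, classes X (cl i).
Hypothesis I0 : (0 < #|I|)%N.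
Implicit Types (f g : T -> R).

(** One step of heat-bath dynamics acting on functions: a uniformly chosen partition, then a uniform
    point of the current class. *)
Definition mix f x : R := #|I|%:R^-1 * \sum_i proj (cl i) f x.

Local Notation "<< f , g >>" := (\sum_(x in X) f x * g x).

Lemma sum_mix f : \sum_(x in X) mix f x = \sum_(x in X) f x.
Proof.
rewrite /mix -mulr_sumr exchange_big /=.
under eq_bigr do rewrite sum_proj //.
by rewrite sumr_cst mulKf // pnatr_eq0 -lt0n.
Qed.

Lemma avg_mix f : avg X (mix f) = avg X f.
Proof. by rewrite /avg sum_mix. Qed.

Lemma mix_sa f g : << f, mix g >> = << mix f, g >>.
Proof.
rewrite /mix.
under eq_bigr do rewrite mulrCA mulr_sumr.
under [RHS]eq_bigr do rewrite -mulrA mulr_suml.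
rewrite -!mulr_sumr; congr (_ * _).
rewrite exchange_big [RHS]exchange_big /=; apply: eq_bigr => i _.
rewrite (sum_projM f g (clX i)); symmetry; under eq_bigr do rewrite mulrC.
by rewrite (sum_projM g f (clX i)); apply: eq_bigr => x _; rewrite mulrC.
Qed.

Lemma dirichlet_mix f :
  #|I|%:R^-1 * \sum_i \sum_(x in X) varf (cl i x) f = << f, f >> - << mix f, f >>.
Proof.
under eq_bigr do rewrite sum_varf //.
rewrite sumrB mulrBr sumr_cst mulKf ?pnatr_eq0 -?lt0n //.
congr (_ - _).
rewrite exchange_big mulr_sumr; apply: eq_bigr => x _.
by rewrite /mix -mulrA mulr_suml.
Qed.

(** An average of orthogonal projections lies between 0 and 1, here by Jensen over the index. Decay
    of variance can thus be read off the Dirichlet form without a separate bound on negative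
    eigenvalues. *)
Lemma mix_sqr_le f : << mix f, mix f >> <= << mix f, f >>.
Proof.
have -> : << mix f, f >> = #|I|%:R^-1 * \sum_i \sum_(x in X) proj (cl i) f x ^+ 2.
  rewrite exchange_big mulr_sumr.
  rewrite /mix.
  under eq_bigr do rewrite -mulrA mulr_suml.
  rewrite -!mulr_sumr; congr (_ * _).
  rewrite exchange_big [RHS]exchange_big /=; apply: eq_bigr => i _.
  under eq_bigr do rewrite mulrC.
  by rewrite sum_projM.
rewrite exchange_big mulr_sumr; apply: ler_sum => x _.
rewrite /mix.
have [i _] : exists i : I, i \in I by apply/card_gt0P.
have := @avg_sqr R I setT (fun i => proj (cl i) f x).
rewrite /avg cardsT.
have e (F : I -> R) : \sum_(j in [set: I]) F j = \sum_j F j.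
  by apply: eq_bigl => j; rewrite inE.
by rewrite !e -expr2 mulrC [leRHS]mulrC.
Qed.

Lemma sum_CS f g : << f, g >> ^+ 2 <= << f, f >> * << g, g >>.
Proof.
have ff : 0 <= << f, f >> by apply: sumr_ge0 => x _; rewrite -expr2 sqr_ge0.
have gg : 0 <= << g, g >> by apply: sumr_ge0 => x _; rewrite -expr2 sqr_ge0.
have H a b : 0 <= a ^+ 2 * << f, f >> + 2 * a * b * << f, g >> + b ^+ 2 * << g, g >>.
  have : 0 <= \sum_(x in X) (a * f x + b * g x) ^+ 2.
    by apply: sumr_ge0 => x _; rewrite sqr_ge0.
  congr (_ <= _); rewrite !mulr_sumr -!big_split; apply: eq_bigr => x _ /=; ring.
move: ff; rewrite le_eqVlt => /orP[/eqP ff|ff].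
  (* When [<< f, f >> = 0], these coefficients turn the form into
     [- << f, g >> ^+ 2 * (<< g, g >> + 2)], which is nonnegative only if [<< f, g >> = 0]. *)
  have := H (- (<< g, g >> + 1)) << f, g >>.
  rewrite -ff mulr0 add0r mul0r => h.
  have : 0 <= << f, g >> ^+ 2 * (- << g, g >> - 2).
    by apply: le_trans h _; rewrite le_eqVlt; apply/orP; left; apply/eqP; ring.
  by move: (sqr_ge0 << f, g >>) gg; nra.
have := H (- << f, g >>) << f, f >>.
have -> : (- << f, g >>) ^+ 2 * << f, f >> + 2 * - << f, g >> * << f, f >> * << f, g >> +
   << f, f >> ^+ 2 * << g, g >> = << f, f >> * (<< f, f >> * << g, g >> - << f, g >> ^+ 2).
  by ring.
by rewrite pmulr_rge0 // subr_ge0.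
Qed.

Lemma bernoulli (h : R) n : 0 <= h -> 1 + n%:R * h <= (1 + h) ^+ n.
Proof.
move=> h0; elim: n => [|n IH]; first by rewrite expr0; lra.
rewrite exprS -natr1.
have n0 : 0 <= n%:R :> R by [].
have : (1 + h) * (1 + n%:R * h) <= (1 + h) * (1 + h) ^+ n by apply: ler_wpM2l => //; lra.
by apply: le_trans; nra.
Qed.

(* [b t = |P^t f|^2] is log-convex as [P] is self-adjoint, so that [b 1 / b 0] is at most
   the exponential rate of decay of [b]. *)
Lemma gap_of_contraction (rho : R) f : 0 < rho ->
  avg X f = 0 ->
  (exists K, forall t x, x \in X -> `|iter t mix f x| <= K * rho ^+ t) ->
  << mix f, f >> <= rho * << f, f >>.
Proof.
move=> rho0 mf [K Kf].
pose b t := << iter t mix f, iter t mix f >>.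
have b0 t : 0 <= b t by apply: sumr_ge0 => x _; rewrite -expr2 sqr_ge0.
have bconv t : b t.+1 ^+ 2 <= b t * b t.+2.
  rewrite /b /= [X in X ^+ 2 <= _](_ : _ = << iter t mix f, mix (iter t.+1 mix f) >>).
    exact: sum_CS.
  by rewrite mix_sa.
have bK t : b t <= #|X|%:R * K ^+ 2 * (rho ^+ 2) ^+ t.
  rewrite /b -mulrA -sumr_cst; apply: ler_sum => x xX.
  rewrite -exprM mulnC exprM -exprMn -expr2 -real_normK ?num_real //.
  by rewrite ler_pXn2r // ?nnegrE // (le_trans _ (Kf t x xX)).
have [b00|b0p] := eqVneq (b 0%N) 0.
  have f0 x : x \in X -> f x = 0.
    move=> xX; apply/eqP; rewrite -sqrf_eq0 expr2.
    move/eqP: b00; rewrite /b /= psumr_eq0 => [|y _]; last by rewrite -expr2 sqr_ge0.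
    by move/allP => /(_ x (mem_index_enum _)) /implyP; apply.
  rewrite [X in _ <= _ * X](_ : _ = 0) //.
  by rewrite mulr0 big1 // => x xX; rewrite f0 // mulr0.
have {b0p} b0p : 0 < b 0%N by rewrite lt_def b0p b0.
have b1 : b 1%N <= rho ^+ 2 * b 0%N.
  rewrite leNgt; apply/negP => h.
  have b1p : 0 < b 1%N by apply: le_lt_trans h; rewrite mulr_ge0 ?sqr_ge0.
  pose r := b 1%N / b 0%N.
  have rb : b 1%N = r * b 0%N by rewrite mulfVK // gt_eqF.
  have r0 : rho ^+ 2 < r by rewrite ltr_pdivlMr.
  have rr : 0 < r by rewrite divr_gt0.
  have step t : 0 < b t /\ r * b t <= b t.+1.
    elim: t => [|t [bt IH]]; first by rewrite rb.
    have bt1 : 0 < b t.+1 by apply: lt_le_trans IH; rewrite mulr_gt0.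
    split => //; have := bconv t => hc.
    rewrite -(ler_pM2l bt); apply: le_trans hc; rewrite mulrCA mulrA expr2.
    by rewrite ler_pM2r.
  have low t : r ^+ t * b 0%N <= b t.
    elim: t => [|t IH]; first by rewrite mul1r.
    have [_ s] := step t; apply: le_trans s; rewrite exprS -mulrA.
    by rewrite ler_pM2l.
  (* The ratio [r / rho ^+ 2 = 1 + s] exceeds 1, so its powers outgrow the bound that [bK] imposes
     on them. *)
  pose s := r / rho ^+ 2 - 1.
  have rho2 : 0 < rho ^+ 2 by rewrite exprn_gt0.
  have s0 : 0 < s by rewrite subr_gt0 ltr_pdivlMr // mul1r.
  pose B := #|X|%:R * K ^+ 2 / b 0%N.
  have bd t : 1 + t%:R * s <= B.
    apply: (le_trans (bernoulli t (ltW s0))).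
    rewrite /B ler_pdivlMr // /s addrC subrK expr_div_n.
    rewrite mulrAC ler_pdivrMr ?exprn_gt0 //.
    exact: le_trans (low t) (bK t).
  have := bd (Num.truncn (B / s)).+1.
  have : B / s < (Num.truncn (B / s)).+1%:R by exact: truncnS_gt.
  rewrite ltr_pdivrMr //; lra.
have := sum_CS (mix f) f.
rewrite -[<< mix f, mix f >>]/(b 1%N) -[<< f, f >>]/(b 0%N) => h.
apply: (@le_trans _ _ `|<< mix f, f >>|); first exact: ler_norm.
rewrite -(@ler_pXn2r _ 2%N) // ?nnegrE //; last by rewrite mulr_ge0 // ltW.
rewrite real_normK ?num_real //; apply: (le_trans h).
by rewrite exprMn [b 0%N ^+ 2]expr2 mulrA ler_wpM2r.
Qed.

(** Only the exponential rate enters, so the constant [K] may depend on [f] and on [X]. *)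
Lemma variance_of_contraction (rho : R) f : 0 < rho ->
  (exists K, forall t x, x \in X -> `|iter t mix f x - avg X f| <= K * rho ^+ t) ->
  (1 - rho) * varf X f <= #|I|%:R^-1 * \sum_i avg X (fun x => varf (cl i x) f).
Proof.
move=> rho0 [K Kf].
have [X0|[x0 x0X]] := set_0Vmem X.
  rewrite /varf /avg X0 !big_set0 !mul0r mulr0 mulr_ge0 ?invr_ge0 //.
  by rewrite sumr_ge0 // => i _; rewrite big_set0 mul0r.
pose g x := f x - avg X f.
have gE t x : x \in X -> iter t mix g x = iter t mix f x - avg X f.
  elim: t x => [//|t IH] x xX /=.
  rewrite {1}/mix (eq_bigr (fun i => proj (cl i) (iter t mix f) x - avg X f)).
    rewrite sumrB sumr_cst mulrBr mulKf //.
    by rewrite pnatr_eq0 -lt0n.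
  move=> i _; rewrite /proj; have [xx cx] := clX i xX.
  rewrite (@eq_avg _ _ _ _ (fun y => iter t mix f y - avg X f)).
    by rewrite avgD avgN (avg_cst _ xx).
  by move=> y /cx[yX _]; rewrite IH.
have g0 : avg X g = 0 by rewrite /g avgD avgN (avg_cst _ x0X) subrr.
have h := @gap_of_contraction rho g rho0 g0.
have {}h : << mix g, g >> <= rho * << g, g >>.
  by apply: h; exists K => t x xX; rewrite gE //; apply: Kf.
have e : varf X f = << g, g >> / #|X|%:R.
  by rewrite /varf /avg; congr (_ / _); apply: eq_bigr => x _; rewrite expr2.
have X0 : 0 < #|X|%:R :> R by rewrite (natr_card_gt0 _ x0X).
rewrite e.
have -> : \sum_i avg X (fun x => varf (cl i x) f) =
  (\sum_i \sum_(x in X) varf (cl i x) g) / #|X|%:R.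
  rewrite mulr_suml; apply: eq_bigr => i _; congr (_ / _).
  apply: eq_bigr => x xX; have [xx _] := clX i xX.
  rewrite /varf; have -> : avg (cl i x) g = avg (cl i x) f - avg X f.
    by rewrite avgD avgN (avg_cst _ xx).
  by apply: eq_avg => y _; rewrite /g; congr (_ ^+ 2); ring.
rewrite !mulrA ler_pM2r ?invr_gt0 // dirichlet_mix.
by move: h; lra.
Qed.

End Gap.

(** * List colorings *)

Section Colorings.
Variables (V C : finType) (e : rel V).
Hypotheses (e_sym : symmetric e) (e_irr : irreflexive e).
Implicit Types (S A B : {set V}) (L : V -> {set C}) (s t h : {ffun V -> C}).

Definition nbr x : {set V} := [set y | e x y].

(** Only edges inside [S] are constraints; the boundary acts through the lists. Colorings are total
    and equal [h] off [S], so that problems on different sets share one type. *)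
Definition Om S L h : {set {ffun V -> C}} :=
  [set s : {ffun V -> C} | [forall x, if x \in S then s x \in L x else s x == h x] &&
    [forall x in S, forall y in S, e x y ==> (s x != s y)]].

Lemma OmP S L h s : reflect
  [/\ forall x, x \notin S -> s x = h x, forall x, x \in S -> s x \in L x &
      forall x y, x \in S -> y \in S -> e x y -> s x != s y]
  (s \in Om S L h).
Proof.
rewrite inE; apply: (iffP andP) => [[/forallP h1 /forall_inP h2]|[h1 h2 h3]].
  split.
  - by move=> x /negbTE xS; have := h1 x; rewrite xS => /eqP.
  - by move=> x xS; have := h1 x; rewrite xS.
  - by move=> x y xS yS exy; have /forall_inP/(_ _ yS) := h2 _ xS; rewrite exy.
split; first by apply/forallP => x; case: ifPn => [/h2|/h1 ->].
by apply/forall_inP => x xS; apply/forall_inP => y yS; apply/implyP; apply: h3.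
Qed.

Lemma recolorE s x c y : recolor s x c y = if y == x then c else s y.
Proof. by rewrite ffunE. Qed.

Lemma recolor_same s x c : recolor s x c x = c.
Proof. by rewrite ffunE eqxx. Qed.

Lemma recolor_other s x c y : y != x -> recolor s x c y = s y.
Proof. by rewrite ffunE => /negbTE ->. Qed.

Lemma recolor_id s x : recolor s x (s x) = s.
Proof. by apply/ffunP => y; rewrite ffunE; case: eqP => [->|]. Qed.

Lemma recolorK s x c d : recolor (recolor s x c) x d = recolor s x d.
Proof. by apply/ffunP => y; rewrite !ffunE; case: eqP. Qed.

(** The lists left once [w] has received color [k]: conditioning on one color gives a list-coloring
    problem again. *)
Definition prune L w k x : {set C} := if e w x then L x :\ k else L x.

Lemma prune_sub L w k x : prune L w k x \subset L x.
Proof. by rewrite /prune; case: ifP => // _; apply: subD1set. Qed.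

Lemma Om_reveal S L h w s : w \in S -> s \in Om S L h ->
  s \in Om (S :\ w) (prune L w (s w)) (recolor h w (s w)).
Proof.
move=> wS /OmP[h1 h2 h3]; apply/OmP; split.
- move=> x; rewrite !inE negb_and negbK recolorE.
  by case: eqVneq => [->|xw] //= /h1.
- move=> x; rewrite !inE => /andP[xw xS]; rewrite /prune; case: ifP => [ewx|_].
    by rewrite !inE h2 // andbT eq_sym h3.
  exact: h2.
- by move=> x y; rewrite !inE => /andP[_ xS] /andP[_ yS]; apply: h3.
Qed.

Lemma Om_unreveal S L h w k s : w \in S -> k \in L w ->
  s \in Om (S :\ w) (prune L w k) (recolor h w k) ->
  s \in Om S L h /\ s w = k.
Proof.
move=> wS kL /OmP[h1 h2 h3].
have sw : s w = k by rewrite h1 ?recolor_same // !inE eqxx.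
have hw x : x \in S -> e w x -> s x != k.
  move=> xS ewx; have xw : x != w by apply: contraTneq ewx => ->; rewrite e_irr.
  by have := h2 x; rewrite !inE xw xS /prune ewx !inE => /(_ isT)/andP[].
split => //; apply/OmP; split.
- move=> x xS; have xw : x != w by apply: contraNneq xS => ->.
  by rewrite h1 ?recolor_other // !inE negb_and xS orbT.
- move=> x xS; have [->|xw] := eqVneq x w; first by rewrite sw.
  by apply: (subsetP (prune_sub L w k x)); apply: h2; rewrite !inE xw.
- move=> x y xS yS exy.
  have [xw|xw] := eqVneq x w; first by rewrite xw sw eq_sym hw // -xw.
  have [yw|yw] := eqVneq y w; first by rewrite yw sw hw // -yw e_sym.
  by apply: h3; rewrite ?inE ?xw ?yw.
Qed.

Lemma recolor_Om S L h h' x k s : x \in S -> k \in L x ->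
  (forall y, y \notin S -> h' y = h y) ->
  (forall y, y \in S -> e x y -> s y != k) ->
  s \in Om (S :\ x) L h' -> recolor s x k \in Om S L h.
Proof.
move=> xS kL hh sk /OmP[h1 h2 h3]; apply/OmP; split.
- move=> y yS; have yx : y != x by apply: contraNneq yS => ->.
  by rewrite recolor_other // h1 ?hh // !inE negb_and yS orbT.
- move=> y yS; rewrite recolorE; case: eqVneq => [->//|yx].
  by rewrite h2 // !inE yx.
- move=> y z yS zS eyz; rewrite !recolorE.
  case: (eqVneq y x) => [yx|yx]; case: (eqVneq z x) => [zx|zx].
  + by move: eyz; rewrite yx zx e_irr.
  + by rewrite eq_sym sk // -yx.
  + by rewrite sk // -zx e_sym.
  + by rewrite h3 // !inE ?yx ?zx.
Qed.

Lemma Om_sub1 S L h x s : s \in Om S L h -> s \in Om (S :\ x) L s.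
Proof.
move=> /OmP[h1 h2 h3]; apply/OmP; split => //.
- by move=> y; rewrite !inE => /andP[_ /h2].
- by move=> y z; rewrite !inE => /andP[_ yS] /andP[_ zS]; apply: h3.
Qed.

Lemma recolor_Om_in S L h x k s : x \in S -> k \in L x ->
  (forall y, y \in S -> e x y -> s y != k) ->
  s \in Om S L h -> recolor s x k \in Om S L h.
Proof.
move=> xS kL sk sO; apply: (recolor_Om xS kL _ sk (Om_sub1 x sO)).
by case/OmP: sO.
Qed.

Definition unused S L s x : {set C} := L x :\: (s @: (nbr x :&: S)).

Lemma unusedP S L s x k : reflect
  (k \in L x /\ forall y, y \in S -> e x y -> s y != k) (k \in unused S L s x).
Proof.
rewrite !inE; apply: (iffP andP) => [[h1 h2]|[h1 h2]]; split => //.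
  move=> y yS exy; apply: contraNneq h1 => <-.
  by apply: imset_f; rewrite !inE exy.
by apply/imsetP => -[y]; rewrite !inE => /andP[exy yS] ke; have := h2 _ yS exy; rewrite ke eqxx.
Qed.

Lemma card_unused S L s x : (#|L x| <= #|unused S L s x| + #|nbr x :&: S|)%N.
Proof.
rewrite /free -(cardsID (s @: (nbr x :&: S)) (L x)) addnC leq_add2l.
apply: leq_trans (leq_imset_card s _).
by apply: subset_leq_card; rewrite subsetIr.
Qed.

Lemma recolor_inj s x : injective (recolor s x).
Proof. by move=> c d h; rewrite -(recolor_same s x c) h recolor_same. Qed.

(** A coloring with color [k] at [x] has at least [m] recolorings at [x], and each coloring is a
    recolored form of at most one of them. So a given color at [x] has probability at most
    [1 / m]. *)
Lemma fiber_bound S L h x k m : x \in S ->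
  (m + #|nbr x :&: S| <= #|L x|)%N ->
  (m * #|[set s in Om S L h | s x == k]| <= #|Om S L h|)%N.
Proof.
move=> xS tL.
rewrite -[leqRHS]sum1_card mulnC -sum_nat_const.
pose r (s u : {ffun V -> C}) := u == recolor s x (u x).
apply: (@leq_trans (\sum_(s in [set s in Om S L h | s x == k])
                     \sum_(u in Om S L h | r s u) 1)%N).
  apply: leq_sum => s; rewrite inE => /andP[sO _].
  rewrite sum1_card.
  apply: (@leq_trans #|recolor s x @: unused S L s x|).
    rewrite card_imset; last exact: recolor_inj.
    by have := card_unused S L s x; lia.
  apply: subset_leq_card; apply/subsetP => _ /imsetP[c /unusedP[cL sc] ->].
  by apply/andP; split; [apply: recolor_Om_in|rewrite /r recolor_same].
rewrite (exchange_big_dep (mem (Om S L h))) /=; last by move=> ? ? _ /andP[].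
apply: leq_sum => u uO; rewrite sum1_card.
apply: leq_trans (_ : #|[set recolor u x k]| <= 1)%N; last by rewrite cards1.
apply: subset_leq_card; apply/subsetP => s.
move=> /andP[]; rewrite !inE => /andP[_ /eqP sx] /andP[_ /eqP us].
by rewrite us recolorK -sx recolor_id.
Qed.

(** Greedy coloring: the vertex with the long list is colored last. *)
Lemma degenerate_Om S L h :
  (forall A, A \subset S -> A != set0 ->
     exists2 x, x \in A & (#|nbr x :&: A| < #|L x|)%N) ->
  exists s, s \in Om S L h.
Proof.
have [n] := ubnP #|S|; elim: n S => // n IH S Sn deg.
have [->|S0] := eqVneq S set0.
  by exists h; apply/OmP; split => // x; rewrite inE.
have [x xS dx] := deg S (subxx _) S0.
have [] := IH (S :\ x).
- by move: Sn; rewrite (cardsD1 x S) xS; lia.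
- by move=> A AS; apply: deg; apply: subset_trans AS (subD1set _ _).
move=> s sO; have : (0 < #|unused S L s x|)%N by have := card_unused S L s x; lia.
by case/card_gt0P => k /unusedP[kL sk]; exists (recolor s x k); apply: recolor_Om sO.
Qed.

Definition overlay S h s : {ffun V -> C} := [ffun x => if x \in S then s x else h x].

Lemma overE S h s x : overlay S h s x = if x \in S then s x else h x.
Proof. by rewrite ffunE. Qed.

Lemma over_Om S L h h' s : s \in Om S L h -> overlay S h' s \in Om S L h'.
Proof.
move=> /OmP[h1 h2 h3]; apply/OmP; split.
- by move=> x /negbTE xS; rewrite overE xS.
- by move=> x xS; rewrite overE xS h2.
- by move=> x y xS yS; rewrite !overE xS yS; apply: h3.
Qed.

Lemma over_id S L h h' s : s \in Om S L h -> overlay S h (overlay S h' s) = s.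
Proof.
by move=> /OmP[h1 _ _]; apply/ffunP => x; rewrite !overE; case: (boolP (x \in S)) => // xS; rewrite h1.
Qed.

Lemma over_inj S L h h' : {in Om S L h &, injective (overlay S h')}.
Proof. by move=> s t sO tO st; rewrite -(over_id h' sO) st (over_id h' tO). Qed.

Lemma Om_over S L h h' : Om S L h' = overlay S h' @: Om S L h.
Proof.
apply/setP => s; apply/idP/imsetP => [sO|[t tO ->]]; last exact: over_Om tO.
by exists (overlay S h s); rewrite ?(over_Om _ sO) // (over_id _ sO).
Qed.

Lemma card_Om_over S L h h' : #|Om S L h'| = #|Om S L h|.
Proof. by rewrite (Om_over _ _ h h') card_in_imset //; apply: over_inj. Qed.

Lemma avg_over (R : realType) S L h h' (f : {ffun V -> C} -> R) :
  avg (Om S L h') f = avg (Om S L h) (fun s => f (overlay S h' s)).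
Proof.
rewrite /avg (card_Om_over S L h h'); congr (_ / _).
by rewrite (Om_over _ _ h h') big_imset //; apply: over_inj.
Qed.

Definition bdry A h x : {set C} := [set k | [forall y, e x y && (y \notin A) ==> (h y != k)]].

Lemma bdryP A h x k : reflect (forall y, e x y -> y \notin A -> h y != k) (k \in bdry A h x).
Proof.
rewrite inE; apply: (iffP forallP) => [H y exy yA|H y].
  by have := H y; rewrite exy yA.
by apply/implyP => /andP[exy yA]; apply: H.
Qed.

(** The states of a heat-bath update of [A] given [h], where [h] may be improper away from [A]. *)
Definition OmB A h := Om A (bdry A h) h.

Lemma OmBP A h s : reflect
  ((forall x, x \notin A -> s x = h x) /\
    forall x y, x \in A -> e x y -> s x != s y) (s \in OmB A h).
Proof.
apply: (iffP (OmP _ _ _ _)) => [[h1 h2 h3]|[h1 h2]].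
  split => // x y xA exy; have [yA|yA] := boolP (y \in A); first exact: h3.
  by have /bdryP/(_ _ exy yA) := h2 _ xA; rewrite eq_sym (h1 y).
split => //.
  by move=> x xA; apply/bdryP => y exy yA; rewrite -h1 // eq_sym h2.
by move=> x y xA _; apply: h2.
Qed.

Lemma OmB_base A h s : s \in OmB A h -> OmB A s = OmB A h.
Proof.
move=> /OmBP[h1 h2]; apply/setP => t.
by apply/OmBP/OmBP => -[h3 h4]; split => // x xA; rewrite h3 // h1.
Qed.

Lemma OmB_refl A B h s : A \subset B -> s \in OmB B h -> s \in OmB A s.
Proof.
by move=> AB /OmBP[_ h2]; apply/OmBP; split => // x y /(subsetP AB); apply: h2.
Qed.

Lemma OmB_sub A B h s : A \subset B -> s \in OmB B h -> OmB A s \subset OmB B h.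
Proof.
move=> AB /OmBP[h1 h2]; apply/subsetP => t /OmBP[h3 h4]; apply/OmBP; split.
  by move=> x xB; rewrite h3 ?h1 //; apply: contra xB; apply: (subsetP AB).
move=> x y xB exy; have [xA|xA] := boolP (x \in A); first exact: h4.
have [yA|yA] := boolP (y \in A); first by rewrite eq_sym h4 // e_sym.
by rewrite (h3 _ xA) (h3 _ yA); apply: h2.
Qed.

Lemma OmB_classes A B h : A \subset B -> classes (OmB B h) (OmB A).
Proof.
move=> AB s sB; split; first exact: OmB_refl AB sB.
by move=> t tA; split; [apply: subsetP tA; apply: OmB_sub sB|apply: OmB_base].
Qed.

End Colorings.

(** * Connected sets *)

Section Connected.
Variables (V : finType) (e : rel V).
Hypotheses (e_sym : symmetric e).
Implicit Types (A Y Z : {set V}).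

(** Connectedness is stated by cuts rather than paths, because what the proofs need is an edge
    leaving a proper subset. *)
Definition conn Y : bool := (Y != set0) &&
  [forall A : {set V}, [&& A \subset Y, A != set0 & A != Y] ==>
     [exists x in A, exists y in Y :\: A, e x y]].

Lemma connP Y : reflect
  (Y != set0 /\ forall A, A \subset Y -> A != set0 -> A != Y ->
     exists x y, [/\ x \in A, y \in Y, y \notin A & e x y])
  (conn Y).
Proof.
apply: (iffP andP) => -[Y0 h]; split => //.
  move=> A AY A0 A1; move/forallP/(_ A): h; rewrite AY A0 A1 /=.
  move=> /exists_inP[x xA /exists_inP[y]]; rewrite inE => /andP[yA yY] exy.
  by exists x, y.
apply/forallP => A; apply/implyP => /and3P[AY A0 A1].
have [x [y [xA yY yA exy]]] := h A AY A0 A1.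
by apply/exists_inP; exists x => //; apply/exists_inP; exists y; rewrite // inE yA.
Qed.

Lemma conn_neq0 Y : conn Y -> Y != set0.
Proof. by case/connP. Qed.

Lemma conn1 x : conn [set x].
Proof.
apply/connP; split; first by apply/set0Pn; exists x; rewrite inE.
move=> A; rewrite subset1 => /orP[/eqP->|/eqP->]; by rewrite eqxx.
Qed.

Lemma connU Y Z x z : conn Y -> conn Z -> x \in Y -> z \in Z ->
  (x == z) || e x z -> conn (Y :|: Z).
Proof.
move=> /connP[Y0 cY] /connP[Z0 cZ] xY zZ xz.
apply/connP; split; first by apply/set0Pn; exists x; rewrite inE xY.
move=> A AYZ A0 A1.
have loc (W : {set V}) : W \subset Y :|: Z ->
    (forall A, A \subset W -> A != set0 -> A != W ->
     exists x y, [/\ x \in A, y \in W, y \notin A & e x y]) ->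
    A :&: W != set0 -> A :&: W != W ->
    exists x y, [/\ x \in A, y \in Y :|: Z, y \notin A & e x y].
  move=> WYZ cW AW0 AW1.
  have [u [v [uA vW vA euv]]] := cW _ (subsetIr _ _) AW0 AW1.
  exists u, v; split => //; first by move: uA; rewrite inE => /andP[].
    exact: subsetP WYZ _ vW.
  by apply: contra vA => vA; rewrite inE vA.
have [AY0|AY0] := eqVneq (A :&: Y) set0; last first.
  have [AY1|AY1] := eqVneq (A :&: Y) Y; last exact: loc (subsetUl _ _) cY AY0 AY1.
  have xA : x \in A by move: xY; rewrite -AY1 inE => /andP[].
  have [AZ0|AZ0] := eqVneq (A :&: Z) set0; last first.
    have [AZ1|AZ1] := eqVneq (A :&: Z) Z; last exact: loc (subsetUr _ _) cZ AZ0 AZ1.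
    case/negP: A1; rewrite eqEsubset AYZ /= -AY1 -AZ1 subUset.
    by rewrite !subsetIl.
  have zA : z \notin A by apply/negP => zA; have := in_set0 z; rewrite -AZ0 inE zA zZ.
  exists x, z; split => //; first by rewrite inE zZ orbT.
  by case/orP: xz => // /eqP xz; rewrite xz (negbTE zA) in xA.
have xA : x \notin A by apply/negP => xA; have := in_set0 x; rewrite -AY0 inE xA xY.
have [AZ0|AZ0] := eqVneq (A :&: Z) set0.
  case/negP: A0; rewrite -subset0; apply/subsetP => u uA.
  have := subsetP AYZ u uA; rewrite inE => /orP[uY|uZ].
    by rewrite -AY0 inE uA.
  by rewrite -AZ0 inE uA.
have [AZ1|AZ1] := eqVneq (A :&: Z) Z; last exact: loc (subsetUr _ _) cZ AZ0 AZ1.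
have zA : z \in A by move: zZ; rewrite -AZ1 inE => /andP[].
exists z, x; split => //; first by rewrite inE xY.
by case/orP: xz => [/eqP xz|]; rewrite ?xz ?zA // e_sym in xA *.
Qed.

End Connected.

(** * Influence of a change of lists *)

Section Influence.
Variables (R : realType) (V C : finType) (e : rel V).
Hypotheses (e_sym : symmetric e) (e_irr : irreflexive e).
Variables (D : nat) (a beta eps : R).
Hypotheses (DC : (D < #|C|)%N) (a0 : 0 < a) (beta0 : 0 <= beta) (beta1 : beta <= 1)
  (eps_le : eps <= a * beta) (epsD : D%:R <= eps * (#|C| - D)%:R).
Implicit Types (S A B Y : {set V}) (L : V -> {set C}) (s h : {ffun V -> C}).

Local Notation nbr := (nbr e).
Local Notation Om := (Om e).

Definition wt x : nat := #|nbr x|.+1.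
Definition low x : bool := (wt x <= D)%N.
Definition mass x : R := if low x then a * (wt x)%:R else (wt x)%:R.

Lemma wt_gt0 x : 0 < (wt x)%:R :> R.
Proof. by rewrite ltr0n. Qed.

Lemma mass_gt0 x : 0 < mass x.
Proof. by rewrite /mass; case: ifP => _; rewrite ?mulr_gt0 ?wt_gt0. Qed.

(** Low vertices keep [#|C| - D] colors to spare. For high vertices nothing is asked; [influence]
    assumes that colorings exist. *)
Definition adeq S L := forall x, x \in S -> low x ->
  (#|~: L x| + #|nbr x :&: S| <= D)%N.

(** Revealing a neighbor forbids at most one more color and removes one vertex from the neighborhood
    in [S], so the sum does not grow. *)
Lemma adeq_prune S L w k : w \in S -> adeq S L -> adeq (S :\ w) (prune e L w k).
Proof.
move=> wS ad x; rewrite !inE => /andP[xw xS] lx.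
apply: leq_trans (ad x xS lx).
rewrite setIDA.
rewrite (cardsD1 w (nbr x :&: S)) !inE wS andbT e_sym.
rewrite /prune; case: ifP => [ewx|_]; last by rewrite add0n.
have : (#|~: (L x :\ k)| <= #|~: L x| + 1)%N.
  rewrite setDE setCI setCK; apply: leq_trans (leq_card_setU _ _) _.
  by rewrite cards1.
by clear; lia.
Qed.

Lemma adeq_free S L x : x \in S -> low x -> adeq S L ->
  (#|C| - D + #|nbr x :&: S| <= #|L x|)%N.
Proof.
move=> xS lx /(_ x xS lx); have := cardsC (L x); move: DC; clear; lia.
Qed.

Lemma Om_eq S L L' h : {in S, L =1 L'} -> Om S L h = Om S L' h.
Proof.
move=> LL; apply/setP => s; apply/OmP/OmP => -[h1 h2 h3]; split => // x xS.
  by rewrite -LL // h2.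
by rewrite LL // h2.
Qed.

Definition reveal S L h w s := Om (S :\ w) (prune e L w (s w)) (recolor h w (s w)).

Lemma reveal_classes S L h w : w \in S -> classes (Om S L h) (reveal S L h w).
Proof.
move=> wS s sO; split; first exact: Om_reveal.
move=> u uO; have sL : s w \in L w by case/OmP: sO => _ /(_ _ wS).
have [? us] := Om_unreveal e_sym e_irr wS sL uO.
by split => //; rewrite /reveal us.
Qed.

Lemma avg_reveal S L h w (f : {ffun V -> C} -> R) : w \in S ->
  avg (Om S L h) f = avg (Om S L h) (fun s => avg (reveal S L h w s) f).
Proof. by move=> wS; exact/esym/(avg_proj f (@reveal_classes S L h w wS)). Qed.

Definition ham s s' := #|[set x | s x != s' x]|.
(** By duality, a bound on differences of averages for all such [f] bounds a transport distance in
    the Hamming metric; no coupling has to be constructed. *)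
Definition lip (f : {ffun V -> C} -> R) := forall s s', `|f s - f s'| <= (ham s s')%:R.

Definition hamC S h h' := #|[set x in ~: S | h x != h' x]|.

Lemma avg_base S L h h' f : lip f -> (exists s, s \in Om S L h) ->
  `|avg (Om S L h) f - avg (Om S L h') f| <= (hamC S h h')%:R.
Proof.
move=> lf [s0 s0O]; rewrite (@avg_over V C e R S L h h' f).
rewrite -(avgN _ (fun s => f (overlay S h' s))) -avgD.
have : - (hamC S h h')%:R <=
    avg (Om S L h) (fun s => f s - f (overlay S h' s)) <= (hamC S h h')%:R.
  apply: (avg_bounds s0O) => s sO; rewrite -ler_norml.
  apply: (le_trans (lf _ _)); rewrite ler_nat.
  apply: subset_leq_card; apply/subsetP => x; rewrite !inE overE.
  case: ifPn => [xS|xS]; first by rewrite eqxx.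
  by case/OmP: sO => ->.
by rewrite -ler_norml.
Qed.

(** The colorings lost are those giving [w] a color outside [L' w]; there are at most [D] such
    colors, each of probability at most [1 / (#|C| - D)]. *)
Lemma swap_card S L L' h w : w \in S -> low w -> adeq S L -> adeq S L' ->
  {in S :\ w, L =1 L'} ->
  #|Om S L h :\: Om S L' h|%:R <= eps * #|Om S L h|%:R.
Proof.
move=> wS lw ad ad' LL.
set X := Om S L h.
pose F k := [set s in X | s w == k].
have h1 : (#|X :\: Om S L' h| <= \sum_(k in ~: L' w) #|F k|)%N.
  rewrite -sum1_card (partition_big (fun s => s w) (mem (~: L' w))) /=.
    apply: leq_sum => k kL; rewrite sum1_card; apply: subset_leq_card.
    by apply/subsetP => s; rewrite unfold_in !inE => /andP[/andP[_ ->]].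
  move=> s; rewrite inE => /andP[sO' sX]; rewrite inE; apply: contra sO' => sL.
  move: sX => /OmP[h1 h2 h3]; apply/OmP; split => // x xS.
  have [->//|xw] := eqVneq x w.
  by rewrite -LL ?h2 // !inE xw.
have h2 k : ((#|C| - D) * #|F k| <= #|X|)%N.
  by apply: fiber_bound => //; apply: adeq_free.
have h3 : ((#|C| - D) * #|X :\: Om S L' h| <= D * #|X|)%N.
  apply: (@leq_trans (\sum_(k in ~: L' w) #|X|)).
    apply: leq_trans (leq_mul (leqnn _) h1) _.
    by rewrite big_distrr /=; apply: leq_sum => k _; apply: h2.
  rewrite sum_nat_const leq_mul2r; apply/orP; right.
  by apply: leq_trans (ad' w wS lw); apply: leq_addr.
have q0 : 0 < (#|C| - D)%:R :> R by rewrite ltr0n subn_gt0.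
rewrite -(ler_pM2l q0) mulrA.
apply: (@le_trans _ _ (D%:R * #|X|%:R)); first by rewrite -!natrM ler_nat.
by rewrite ler_wpM2r // mulrC.
Qed.

(** Bound on the disagreements caused by a changed list at [y]: they spread with certainty at a high
    vertex and are damped by [beta] at a low one. *)
Definition gain (t : V -> R) y : R := if low y then beta * t y else t y.

Definition dominates S (t : V -> R) y :=
  forall Y, conn e Y -> Y \subset S -> y \in Y -> \prod_(x in Y) mass x <= t y.

Lemma dominates_mass S t y : y \in S -> dominates S t y -> mass y <= t y.
Proof.
move=> yS /(_ [set y]); rewrite big_set1; apply; rewrite ?conn1 ?sub1set //.
by rewrite inE.
Qed.

(** Adding [w] to a connected set through its neighbor [y] gives a connected set through [w] and
    multiplies the product by [mass w]. *)
Lemma dominates_nbr S t w y : w \in S -> e w y ->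
  dominates S t w -> dominates (S :\ w) (fun=> t w / mass w) y.
Proof.
move=> wS ewy dw Y cY YS yY; rewrite ler_pdivlMr ?mass_gt0 // mulrC.
have wY : w \notin Y by apply: contraTN isT => /(subsetP YS); rewrite !inE eqxx.
rewrite -(big_setU1 _ wY) /=; apply: dw.
- apply: (connU e_sym (conn1 e w) cY (set11 w) yY); by rewrite ewy orbT.
- by rewrite subUset sub1set wS (subset_trans YS) // subD1set.
- by rewrite !inE eqxx.
Qed.

Lemma gain_le t y : 0 <= t y -> gain t y <= t y.
Proof. by move=> t0; rewrite /gain; case: ifP => // _; rewrite ler_piMl. Qed.

(* High vertices of [Delta] are revealed first, at the cost of a disagreement
   with probability 1.  When only low ones are left, their lists are changed one
   at a time, which never destroys feasibility, and each change survives with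
   probability at most [eps].  The products of masses over connected sets
   dominate the number of branches of this exploration. *)
Lemma influence S L L' h h' (Delta : {set V}) (t : V -> R) f :
  lip f -> Delta \subset S -> adeq S L -> adeq S L' ->
  {in S :\: Delta, L =1 L'} ->
  (exists s, s \in Om S L h) -> (exists s, s \in Om S L' h') ->
  (forall y, y \in Delta -> dominates S t y) ->
  `|avg (Om S L h) f - avg (Om S L' h') f| <=
     (hamC S h h')%:R + \sum_(y in Delta) gain t y.
Proof.
move=> lf; have [n] := ubnP #|S|.
elim: n S L L' h h' Delta t => // n IHn S L L' h h' Delta t Sn DS ad ad' LL.
have t_ge0 w : w \in S -> dominates S t w -> 0 <= t w.
  by move=> wS dw; apply: le_trans (ltW (mass_gt0 w)) _; apply: dominates_mass dw.
have t_ge1 w : w \in S -> dominates S t w -> 1 <= t w / mass w.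
  move=> wS dw; rewrite ler_pdivlMr ?mass_gt0 // mul1r; exact: dominates_mass dw.
have [/exists_inP[k kD hk]|] := boolP [exists k in Delta, ~~ low k].
  move=> [s0 s0O] [s1 s1O] dom.
  have kS : k \in S := subsetP DS _ kD.
  rewrite (@avg_reveal S L h k f kS) (@avg_reveal S L' h' k f kS).
  apply: (avg_dist s0O s1O) => u v uO vO.
  set S' := S :\ k.
  (* Each neighbor of [k] inherits the budget [t k / mass k]. There are [wt k - 1] of them, and one
     more share pays for the disagreement at [k] itself. *)
  pose t' y := if e k y then t k / mass k else t y.
  have -> : (hamC S h h')%:R + \sum_(y in Delta) gain t y =
      (hamC S h h')%:R + gain t k + \sum_(y in Delta :\ k) gain t y.
    by rewrite (big_setD1 k kD) /= addrA.
  pose Delta' := (Delta :\ k) :|: (nbr k :&: S').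
  have := IHn S' (prune e L k (u k)) (prune e L' k (v k)) (recolor h k (u k))
    (recolor h' k (v k)) Delta' t'.
  have kk : t k / mass k * (wt k)%:R = t k.
    by rewrite /mass (negbTE hk) mulfVK // gt_eqF // wt_gt0.
  have tk1 := t_ge1 k kS (dom k kD).
  move=> H; apply: le_trans (H _ _ _ _ _ _ _ _) _ => {H}.
  - by move: Sn; rewrite /S' (cardsD1 k S) kS add1n ltnS.
  - by rewrite subUset subsetIr andbT setSD.
  - exact: adeq_prune.
  - exact: adeq_prune.
  - move=> x; rewrite !inE => /andP[h1 /andP[xk xS]]; move: h1.
    rewrite xk xS !andbT negb_or => /andP[xD /negbTE ekx].
    by rewrite /prune ekx; apply: LL; rewrite inE xD xS.
  - by exists u; apply: Om_reveal.
  - by exists v; apply: Om_reveal.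
  - move=> y yD'; have [eky|eky] := boolP (e k y).
      move=> Y cY YS yY; rewrite /t' eky.
      exact: (dominates_nbr kS eky (dom k kD)) cY YS yY.
    have yD : y \in Delta by move: yD'; rewrite !inE (negbTE eky) orbF => /andP[].
    move=> Y cY YS yY; rewrite /t' (negbTE eky); apply: (dom y yD) => //.
    by apply: subset_trans YS (subD1set _ _).
  have hh : (hamC S' (recolor h k (u k)) (recolor h' k (v k)) <= hamC S h h' + 1)%N.
    apply: (@leq_trans #|[set x in ~: S | h x != h' x] :|: [set k]|).
      apply: subset_leq_card; apply/subsetP => x; rewrite !inE !recolorE.
      by case: eqVneq => [->|]; rewrite ?orbT //= !orbF.
    by apply: leq_trans (leq_card_setU _ _) _; rewrite cards1.
  have sum_le : \sum_(y in Delta') gain t' y <=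
      \sum_(y in Delta :\ k) gain t y + #|nbr k|%:R * (t k / mass k).
    rewrite (bigID (e k)) /= addrC; apply: lerD.
      rewrite [leRHS](bigID (e k)) /= -[leLHS]add0r; apply: lerD.
        apply: sumr_ge0 => y /andP[yD _].
        have yD' : y \in Delta by move: yD; rewrite !inE => /andP[].
        have : 0 <= t y by apply: t_ge0 (dom y yD'); apply: subsetP DS _ _.
        by move=> ty; rewrite /gain; case: ifP => // _; rewrite mulr_ge0.
      rewrite le_eqVlt; apply/orP; left; apply/eqP; apply: eq_big => y.
        by rewrite !inE; case: (e k y); rewrite ?andbF ?andbT //= orbF.
      by move=> /andP[_ /negbTE eky]; rewrite /gain /t' eky.
    rewrite -sumr_cst; apply: (@le_trans _ _ (\sum_(y in Delta' | e k y) (t k / mass k))).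
      apply: ler_sum => y /andP[_ eky].
      have -> : t k / mass k = t' y by rewrite /t' eky.
      by apply: gain_le; rewrite /t' eky; lra.
    rewrite [leRHS](bigID (mem Delta')) /= -[leLHS]addr0; apply: lerD.
      by rewrite le_eqVlt; apply/orP; left; apply/eqP; apply: eq_bigl => y; rewrite !inE andbC.
    by apply: sumr_ge0 => y _; lra.
  have hh' : (hamC S' (recolor h k (u k)) (recolor h' k (v k)))%:R <= (hamC S h h')%:R + 1 :> R.
    by rewrite natr1 ler_nat -addn1.
  have : gain t k = 1 * (t k / mass k) + #|nbr k|%:R * (t k / mass k).
    by rewrite -mulrDl addrC natr1 mulrC /gain (negbTE hk) kk.
  lra.
rewrite negb_exists_in => /forall_inP alow.
have {alow} alow y : y \in Delta -> low y by move/alow; rewrite negbK.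
have [m] := ubnP #|Delta|; elim: m Delta L h DS ad LL alow => // m IHm.
move=> Delta L h DS ad LL alow Dm ne ne' dom.
have [D0|[w wD]] := set_0Vmem Delta.
  rewrite D0 big_set0 addr0 -(@Om_eq S L L' h'); first exact: avg_base.
  by move=> x xS; apply: LL; rewrite D0 setD0.
have wS : w \in S := subsetP DS _ wD.
have lw := alow w wD.
(* Intermediate lists that have changed at [w] only; as [w] is low, it can be recolored and a
   coloring still exists. *)
pose L2 x := if x == w then L' x else L x.
have L2E : {in S :\ w, L =1 L2} by move=> x; rewrite !inE /L2 => /andP[/negbTE ->].
have ad2 : adeq S L2 by move=> x xS; rewrite /L2; case: eqP => _; [apply: ad'|apply: ad].
have [s2 s2O] : exists s, s \in Om S L2 h.
  have [s sO] := ne.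
  have : (0 < #|unused e S L2 s w|)%N.
    have := card_unused e S L2 s w; have := @adeq_free S L2 w wS lw ad2.
    by move: DC; clear; lia.
  case/card_gt0P => c /unusedP[cL sc]; exists (recolor s w c).
  apply: (@recolor_Om _ _ _ e_sym e_irr S L2 h s w c s wS cL _ sc).
    by case/OmP: sO.
  rewrite -(@Om_eq (S :\ w) L) //.
  exact: Om_sub1 sO.
have one : `|avg (Om S L h) f - avg (Om S L2 h) f| <= gain t w.
  have [s1 s1O] := ne.
  rewrite (@avg_reveal S L h w f wS) (@avg_reveal S L2 h w f wS).
  have rE s : reveal S L2 h w s = reveal S L h w s.
    apply: Om_eq => x xS; rewrite /prune; case: ifP => _; by rewrite (L2E x xS).
  under [avg (Om S L2 h) _]eq_avg do rewrite rE.
  (* [t w / a = wt w * (t w / mass w)] bounds the effect of changing the color of [w]; the two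
     distributions are within [eps] in total variation, and [eps / a <= beta]. *)
  apply: (@le_trans _ _ (eps * (t w / a))); last first.
    have ea : eps / a <= beta by rewrite ler_pdivrMr // mulrC.
    by rewrite /gain lw [t w / a]mulrC mulrA ler_wpM2r // (t_ge0 _ wS (dom _ wD)).
  have rW u : u \in Om S L h :|: Om S L2 h -> u \in reveal S L h w u.
    rewrite inE => /orP[uO|uO]; first exact: Om_reveal.
    by rewrite -rE; apply: Om_reveal.
  apply: (avg_tv s1O s2O); last 2 first.
  - exact: swap_card lw ad ad2 _.
  - by apply: swap_card lw ad2 ad _ => // x xS; rewrite (L2E x xS).
  move=> u v uO vO.
  pose Delta' := nbr w :&: (S :\ w).
  have := IHn (S :\ w) (prune e L w (u w)) (prune e L w (v w)) (recolor h w (u w))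
    (recolor h w (v w)) Delta' (fun=> t w / mass w).
  have tw1 := t_ge1 w wS (dom w wD).
  move=> H; apply: le_trans (H _ _ _ _ _ _ _ _) _ => {H}.
  - by move: Sn; rewrite (cardsD1 w S) wS add1n ltnS.
  - exact: subsetIr.
  - exact: adeq_prune.
  - exact: adeq_prune.
  - move=> x; rewrite !inE => /andP[h1 h2]; move: h1; rewrite h2 andbT.
    by move=> /negbTE ewx; rewrite /prune ewx.
  - by exists u; apply: rW.
  - by exists v; apply: rW.
  - move=> y; rewrite !inE => /andP[ewy _]; exact: dominates_nbr ewy (dom w wD).
  have hh : (hamC (S :\ w) (recolor h w (u w)) (recolor h w (v w)) <= 1)%N.
    rewrite -(cards1 w); apply: subset_leq_card; apply/subsetP => x.
    by rewrite !inE !recolorE; case: eqVneq => [->|]; rewrite // eqxx andbF.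
  have -> : t w / a = 1 * (t w / mass w) + #|nbr w|%:R * (t w / mass w).
    rewrite -mulrDl addrC natr1 /mass lw -[#|nbr w|.+1]/(wt w).
    have w0 : (wt w)%:R != 0 :> R by rewrite gt_eqF // wt_gt0.
    by field; rewrite w0 gt_eqF.
  apply: lerD.
    by rewrite mul1r; apply: le_trans tw1; rewrite (ler_nat R _ 1).
  rewrite -sumr_cst; apply: (@le_trans _ _ (\sum_(y in Delta') (t w / mass w))).
    by apply: ler_sum => y _; apply: gain_le; lra.
  rewrite [leRHS](bigID (mem Delta')) /= -[leLHS]addr0; apply: lerD.
    rewrite le_eqVlt; apply/orP; left; apply/eqP; apply: eq_bigl => y.
    by rewrite !inE; case: (e w y); rewrite ?andbF.
  by apply: sumr_ge0 => y _; lra.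
have rest : `|avg (Om S L2 h) f - avg (Om S L' h') f| <=
    (hamC S h h')%:R + \sum_(y in Delta :\ w) gain t y.
  apply: IHm => //.
  - by apply: subset_trans DS; apply: subD1set.
  - move=> x; rewrite !inE negb_and negbK => /andP[/orP[/eqP->|xD] xS].
      by rewrite /L2 eqxx.
    rewrite /L2; case: eqP => // _; apply: LL; by rewrite inE xD.
  - by move=> y; rewrite !inE => /andP[_ /alow].
  - by move: Dm; rewrite (cardsD1 w Delta) wD add1n ltnS.
  - by exists s2.
  - by move=> y; rewrite !inE => /andP[_ /dom].
rewrite (big_setD1 w wD) /=.
have := ler_normD (avg (Om S L h) f - avg (Om S L2 h) f) (avg (Om S L2 h) f - avg (Om S L' h') f).
rewrite addrA subrK; lra.
Qed.

End Influence.

(** * Blocks *)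

Lemma sum_classes (M : nmodType) (V : finType) (S : {set V}) (blk : V -> {set V})
  (F : V -> M) : classes S blk ->
  \sum_(B in blk @: S) \sum_(v in B) F v = \sum_(v in S) F v.
Proof.
move=> blkS; rewrite [RHS](partition_big blk (mem (blk @: S))) /=; last first.
  by move=> v vS; apply: imset_f.
apply: eq_bigr => _ /imsetP[x xS ->]; apply: eq_bigl => v.
have [xx bx] := blkS x xS.
apply/idP/andP => [/bx[vS ->]//|[vS /eqP <-]].
by have [] := blkS v vS.
Qed.

Section Blocks.
Variables (R : realType) (V : finType) (e : rel V).
Hypotheses (e_sym : symmetric e).
Variables (D : nat) (a : R).
Hypotheses (a0 : 0 < a) (a1 : a <= 1) (aD : 1 <= a * D%:R).
Implicit Types (S A B Y : {set V}).

Local Notation nbr := (nbr e).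
Local Notation mass := (mass e D a).
Local Notation low := (low e D).

Definition bad Y : bool := conn e Y && (1 < \prod_(x in Y) mass x).

Definition badv S : {set V} := [set y | [exists Y : {set V}, [&& bad Y, Y \subset S & y \in Y]]].

Lemma badvP S y : reflect (exists Y, [/\ bad Y, Y \subset S & y \in Y]) (y \in badv S).
Proof.
rewrite inE; apply: (iffP existsP) => -[Y].
  by case/and3P => h1 h2 h3; exists Y.
by case=> h1 h2 h3; exists Y; apply/and3P.
Qed.

Definition bade S : rel V := [rel x y | [&& x \in badv S, y \in badv S & e x y]].

(** A vertex that lies in no bad subset of [S] is alone in its block. *)
Definition block S x : {set V} := [set y | connect (bade S) x y].

Lemma bade_sym S : symmetric (bade S).
Proof. by move=> x y; rewrite /bade /= e_sym andbCA. Qed.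

Lemma badv_sub S : badv S \subset S.
Proof. by apply/subsetP => y /badvP[Y [_ YS yY]]; apply: subsetP YS _ yY. Qed.

Lemma block_refl S x : x \in block S x.
Proof. by rewrite inE connect0. Qed.

Lemma block_eq S x y : y \in block S x -> block S y = block S x.
Proof.
rewrite inE => xy; apply/setP => z; rewrite !inE.
by rewrite (same_connect (sym_connect_sym (@bade_sym S)) xy).
Qed.

Lemma block_ind S x (P : V -> Prop) : P x ->
  (forall y z, y \in block S x -> P y -> bade S y z -> P z) ->
  forall y, y \in block S x -> P y.
Proof.
move=> Px Pstep y; rewrite inE => /connectP[p pp ->].
have [n] := ubnP (size p); elim: n p pp => // n IH p; elim/last_ind: p => // p z _.
rewrite rcons_path last_rcons size_rcons => /andP[pp lz] sp.
apply: Pstep lz; last exact: IH.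
by rewrite inE; apply/connectP; exists p.
Qed.

Lemma block_cases S x y : y \in block S x -> y = x \/ (y \in badv S /\ x \in badv S).
Proof.
move: y; apply: block_ind; first by left.
move=> y z _ [->|[yU xU]] /and3P[h1 h2 h3]; by right.
Qed.

Lemma block_sub S x : x \in S -> block S x \subset S.
Proof.
move=> xS; apply/subsetP => y /block_cases[->//|[yU _]].
exact: subsetP (badv_sub S) _ yU.
Qed.

Lemma block_classes S : classes S (block S).
Proof.
move=> x xS; split; first exact: block_refl.
by move=> y yx; split; [apply: subsetP yx; apply: block_sub|apply: block_eq].
Qed.

Lemma block_step S x y z : y \in block S x -> bade S y z -> z \in block S x.
Proof. by rewrite !inE => h1 h2; apply: connect_trans h1 (connect1 h2). Qed.

Lemma bad_badv S Y : bad Y -> Y \subset S -> Y \subset badv S.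
Proof. by move=> bY YS; apply/subsetP => y yY; apply/badvP; exists Y. Qed.

Lemma bad_block S Y x : bad Y -> Y \subset S -> x \in Y -> Y \subset block S x.
Proof.
move=> bY YS xY; have YU := bad_badv bY YS.
have /andP[/connP[_ cY] _] := bY.
pose A := Y :&: block S x.
have [<-|AY] := eqVneq A Y; first exact: subsetIr.
have A0 : A != set0 by apply/set0Pn; exists x; rewrite inE xY block_refl.
have [u [v [uA vY vA euv]]] := cY A (subsetIl _ _) A0 AY.
case/negP: vA; rewrite inE vY /=; apply: (@block_step S x u v).
  by move: uA; rewrite inE => /andP[].
by rewrite /bade /= (subsetP YU v) // (subsetP YU u) //; move: uA; rewrite inE => /andP[].
Qed.

Lemma block_conn S x : conn e (block S x).
Proof.
apply/connP; split; first by apply/set0Pn; exists x; apply: block_refl.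
move=> A AB A0 A1.
have H u v : connect (bade S) u v -> u \in A -> v \notin A -> v \in block S x ->
    exists x0 y, [/\ x0 \in A, y \in block S x, y \notin A & e x0 y].
  move=> /connectP[p pp ->]; elim: p u pp => [|w p IH] u /=.
    by move=> _ ->.
  move=> /andP[uw pp] uA lA lB; have [wA|wA] := boolP (w \in A); first exact: IH pp wA lA lB.
  exists u, w; split => //; last by case/and3P: uw.
  by apply: block_step uw; apply: subsetP AB _ uA.
have [u uA] := set0Pn _ A0.
have [v vB vA] : exists2 v, v \in block S x & v \notin A.
  apply/exists_inP; apply: contraNT A1; rewrite negb_exists_in => /forall_inP h.
  by rewrite eqEsubset AB; apply/subsetP => v /h; rewrite negbK.
apply: (H u v) => //.
have := subsetP AB _ uA; move: vB; rewrite !inE => xv xu.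
by rewrite -(same_connect (sym_connect_sym (@bade_sym S)) xu).
Qed.

(** In a full set the boundary touches low vertices only, so high ones have complete lists. *)
Definition full S := forall x, x \in S -> ~~ low x -> nbr x \subset S.

Lemma mass_ge x : a <= mass x.
Proof.
rewrite /mass; case: ifP => h.
  by rewrite -[leLHS]mulr1 ler_pM2l // (ler_nat R 1).
by apply: (le_trans a1); rewrite (ler_nat R 1).
Qed.

(** A high vertex has mass above [D], hence above [1 / a], and no mass is below [a]. So every edge
    at a high vertex is bad, which is what makes blocks full. *)
Lemma mass_high x y : ~~ low x -> 1 < mass x * mass y.
Proof.
move=> hx; rewrite /mass (negbTE hx) -/(mass y).
apply: (@lt_le_trans _ _ ((wt e x)%:R * a)); last first.
  by rewrite ler_pM2l ?wt_gt0 // mass_ge.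
apply: le_lt_trans aD _; rewrite mulrC ltr_pM2r // ltr_nat.
by move: hx; rewrite /low -ltnNge.
Qed.

Lemma bad_high x y : x != y -> e x y -> ~~ low x -> bad [set x; y].
Proof.
move=> xy exy hx; apply/andP; split.
  apply: (connU e_sym (conn1 e x) (conn1 e y) (set11 x) (set11 y)).
  by rewrite exy orbT.
rewrite big_setU1 ?inE //= big_set1; exact: mass_high.
Qed.

Lemma full_block S x : irreflexive e -> full S -> x \in S -> full (block S x).
Proof.
move=> e_irr fS xS y yB hy; have yS := subsetP (block_sub xS) _ yB.
apply/subsetP => z; rewrite inE => eyz.
have zS : z \in S by apply: subsetP (fS y yS hy) _ _; rewrite inE.
have yz : y != z by apply: contraTneq eyz => ->; rewrite e_irr.
have bb := bad_high yz eyz hy.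
rewrite -(block_eq yB); apply: subsetP (bad_block bb _ _) _ _.
- by rewrite subUset !sub1set yS zS.
- by rewrite !inE eqxx.
- by rewrite !inE eqxx orbT.
Qed.

End Blocks.

(** * Block dynamics *)

Section BlockDynamics.
Variables (R : realType) (V C : finType) (e : rel V).
Hypotheses (e_sym : symmetric e) (e_irr : irreflexive e).
Variables (D : nat) (a beta eps : R).
Hypotheses (DC : (2 * D + 2 <= #|C|)%N) (a0 : 0 < a) (a1 : a <= 1) (aD : 1 <= a * D%:R)
  (beta0 : 0 <= beta) (beta_le : 2 * beta <= a)
  (eps_le : eps <= a * beta) (epsD : D%:R <= eps * (#|C| - D)%:R).
Local Notation nbr := (nbr e).
Local Notation Om := (Om e).
Local Notation mass := (mass e D a).
Local Notation low := (low e D).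
Local Notation full := (full e D).
Local Notation block := (block e D a).
Local Notation OmB := (OmB e).
Implicit Types (S A B Y : {set V}) (L : V -> {set C}) (s h : {ffun V -> C})
  (f : {ffun V -> C} -> R).

Hypothesis sparse : forall K : {set V}, K != set0 -> (forall x, x \in K -> ~~ low x) ->
  exists2 x, x \in K & (#|nbr x :&: K| + 2 <= #|C|)%N.

Lemma card_bdry A h x : (#|~: bdry e A h x| <= #|nbr x :\: A|)%N.
Proof.
apply: leq_trans (leq_imset_card h _); apply: subset_leq_card; apply/subsetP => k.
rewrite !inE negb_forall => /existsP[y]; rewrite negb_imply negbK => /andP[h1 /eqP <-].
by apply: imset_f; rewrite !inE andbC.
Qed.

Lemma adeq_bdry A h : adeq e D A (bdry e A h).
Proof.
move=> x xA lx; apply: leq_trans (ltnW lx).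
rewrite -(cardsID A (nbr x)) addnC leq_add2l; exact: card_bdry.
Qed.

(** A low vertex of [A'] has at least [#|C| - D] colors; without low vertices all lists are complete
    and [sparse] applies. A surplus of 1 is enough for a coloring to exist, while 2 makes recoloring
    paths possible. *)
Lemma degenerate_full A h A' : full A -> A' \subset A -> A' != set0 ->
  exists2 x, x \in A' & (#|nbr x :&: A'| + 2 <= #|bdry e A h x|)%N.
Proof.
move=> fA AA A0; have [/exists_inP[x xA lx]|] := boolP [exists x in A', low x].
  exists x => //; have h1 := card_bdry A h x; have h2 := cardsC (bdry e A h x).
  have h3 : (#|nbr x| <= D)%N by apply: ltnW.
  have h4 : (#|nbr x :\: A| <= #|nbr x|)%N by rewrite subset_leq_card // subsetDl.
  have h5 : (#|nbr x :&: A'| <= #|nbr x|)%N by rewrite subset_leq_card // subsetIl.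
  by move: DC h1 h2 h3 h4 h5; clear; lia.
rewrite negb_exists_in => /forall_inP hA.
have [x xA dx] := sparse A0 hA; exists x => //.
suff -> : bdry e A h x = setT by rewrite cardsT.
apply/setP => k; rewrite in_setT; apply/bdryP => y exy /negP[].
apply: subsetP (fA x (subsetP AA _ xA) (hA x xA)) _ _; by rewrite inE.
Qed.

(** Because [h] is arbitrary, block averages make sense along paths through improper
    configurations. *)
Lemma OmB_nonempty A h : full A -> exists s, s \in OmB A h.
Proof.
move=> fA; apply: (degenerate_Om e_sym e_irr) => A' AA A0.
have [x xA dx] := degenerate_full h fA AA A0; exists x => //.
by move: dx; clear; lia.
Qed.

Lemma OmB_ext A h h' : (forall x, x \notin A -> h x = h' x) -> OmB A h = OmB A h'.
Proof.
move=> hh; apply/setP => s; apply/OmBP/OmBP => -[h1 h2]; split => // x xA.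
  by rewrite h1 // hh.
by rewrite h1 // -hh.
Qed.

Definition agree S s s' := forall x, x \notin S -> s x = s' x.

(** The dual form of path coupling: one vertex changes at a time, and intermediate configurations
    need not be proper. *)
Lemma lip_path S (k : R) f s s' :
  (forall s u c, agree S s s' -> u \in S -> `|f s - f (recolor s u c)| <= k) ->
  agree S s s' -> `|f s - f s'| <= k * (ham s s')%:R.
Proof.
move=> step; have [n] := ubnP (ham s s'); elim: n s => // n IH s Hn ss.
have [H0|[u]] := set_0Vmem [set x | s x != s' x].
  have -> : s = s'.
    apply/ffunP => x; apply/eqP; have := in_set0 x; rewrite -H0 inE.
    by move/negbT; rewrite negbK.
  by rewrite subrr normr0 /ham; rewrite (_ : [set _ | _] = set0) ?cards0 ?mulr0 //; apply/setP => x; rewrite !inE eqxx.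
rewrite inE => su.
have uS : u \in S by apply: contraNT su => uS; rewrite ss.
pose s2 := recolor s u (s' u).
have Hs2 : ham s s' = (ham s2 s').+1.
  rewrite /ham (cardsD1 u) inE su add1n; congr (_.+1); apply: eq_card => x.
  rewrite !inE recolorE; case: eqVneq => [->|] //=; by rewrite eqxx.
have ss2 : agree S s2 s'.
  by move=> x xS; rewrite recolor_other ?ss //; apply: contraNneq xS => ->.
have h1 := step s u (s' u) ss uS.
have h2 := IH s2 _ ss2; rewrite -ltnS -Hs2 in h2; have {}h2 := h2 Hn.
have := ler_normD (f s - f s2) (f s2 - f s'); rewrite addrA subrK.
by rewrite Hs2 -natr1 mulrDr mulr1; move: h1 h2; rewrite -/s2; lra.
Qed.

Lemma ham_overlay S h s s' : (ham (overlay S h s) (overlay S h s') <= ham s s')%N.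
Proof.
apply: subset_leq_card; apply/subsetP => x; rewrite !inE !overE.
by case: ifP => //; rewrite eqxx.
Qed.

Definition lipS S h (k : R) f := forall s s', agree S s h -> agree S s' h ->
  `|f s - f s'| <= k * (ham s s')%:R.

Lemma mass_wt u : a * (wt e u)%:R <= mass u.
Proof. by rewrite /mass; case: ifP => // _; rewrite ler_piMl. Qed.

Lemma block_same S x f s u c : u \in block S x ->
  avg (OmB (block S x) s) f = avg (OmB (block S x) (recolor s u c)) f.
Proof.
move=> uB; rewrite (OmB_ext (h' := recolor s u c)) // => y yB.
by rewrite recolor_other //; apply: contraNneq yB => ->.
Qed.

(** A connected set in the block through a neighbor of [u] has mass product at most [1 / mass u];
    otherwise adding [u] would give a bad set and put [u] into the block. For the same reason the
    neighbors of [u] in the block are low. *)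
Lemma block_contract S h k f x s u c : full S -> x \in S -> lipS S h k f -> 0 < k ->
  agree S s h -> u \in S -> u \notin block S x ->
  `|avg (OmB (block S x) s) f - avg (OmB (block S x) (recolor s u c)) f| <=
    k * (1 + #|nbr u :&: block S x|%:R * (beta / mass u)).
Proof.
move=> fS xS lf k0 sh uS uB; set B := block S x; set s' := recolor s u c.
have BS : B \subset S by apply: block_sub.
have fB : full B by apply: full_block.
have sh' : agree S s' h.
  by move=> y yS; rewrite recolor_other ?sh //; apply: contraNneq yS => ->.
(* [influence] needs a function that is 1-Lipschitz on all configurations; the overlay confines the
   argument to those agreeing with [h] off [S]. *)
pose f' r := f (overlay S h r) / k.
have lf' : lip f'.
  move=> r r'; rewrite /f' -mulrBl normrM [`|k^-1|]gtr0_norm ?invr_gt0 //.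
  rewrite ler_pdivrMr // mulrC; apply: le_trans (lf _ _ _ _) _.
  - by move=> y /negbTE yS; rewrite overE yS.
  - by move=> y /negbTE yS; rewrite overE yS.
  - by rewrite ler_pM2l // ler_nat ham_overlay.
have ff' r : agree S r h -> avg (OmB B r) f = k * avg (OmB B r) f'.
  move=> rh; rewrite -avgZ; apply: eq_avg => r' /OmBP[r'1 _].
  rewrite /f' mulrCA divff ?gt_eqF // mulr1; congr f; apply/ffunP => y.
  rewrite overE; case: ifPn => // yS; rewrite r'1 ?rh //.
  by apply: contra yS; apply: (subsetP BS).
rewrite !ff' // -mulrBr normrM gtr0_norm // ler_pM2l //.
have uy y : y \in B -> u != y by move=> yB; apply: contraNneq uB => ->.
have Bbad Y y : conn e Y -> Y \subset B -> y \in Y -> e u y ->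
    \prod_(z in Y) mass z <= 1 / mass u.
  move=> cY YB yY euy; rewrite ler_pdivlMr ?mass_gt0 // mulrC leNgt; apply/negP => hb.
  have uY : u \notin Y by apply: contra uB; apply: (subsetP YB).
  have bY : bad e D a (u |: Y).
    apply/andP; split; last by rewrite big_setU1.
    by apply: (connU e_sym (conn1 e u) cY (set11 u) yY); rewrite euy orbT.
  have YS : u |: Y \subset S by rewrite subUset sub1set uS (subset_trans YB).
  have yB := subsetP YB y yY.
  case/negP: uB; rewrite -/B /B -(block_eq e_sym yB).
  have yuY : y \in u |: Y by rewrite !inE yY orbT.
  by apply: (subsetP (bad_block bY YS yuY)); rewrite !inE eqxx.
have lowB y : y \in B -> e u y -> low y.
  move=> yB euy; apply: contraT => hy; case/negP: uB.
  have yS := subsetP BS y yB.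
  have eyu : e y u by rewrite e_sym.
  have bb : bad e D a [set y; u].
    by apply: (bad_high e_sym a0 a1 aD _ eyu hy); rewrite eq_sym uy.
  rewrite -/B /B -(block_eq e_sym yB).
  apply: (subsetP (bad_block bb _ _)); rewrite ?inE ?eqxx ?orbT //.
  by rewrite subUset !sub1set yS uS.
have := @influence R V C e e_sym e_irr D a beta eps _ a0 beta0 _ eps_le epsD
  B (bdry e B s) (bdry e B s') s s' (nbr u :&: B) (fun=> 1 / mass u) f' lf' (subsetIr _ _)
  (@adeq_bdry B s) (@adeq_bdry B s') _ (OmB_nonempty s fB) (OmB_nonempty s' fB).
move=> H; apply: le_trans (H _ _ _ _) _ => {H}.
- by move: DC; clear; lia.
- by move: beta_le a1; lra.
- move=> y; rewrite !inE negb_and => /andP[h1 yB]; apply/setP => j.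
  move: h1; rewrite yB orbF => euy.
  apply/bdryP/bdryP => H z eyz zB; have := H z eyz zB.
    by rewrite recolor_other //; apply: contraNneq euy => <-; rewrite e_sym.
  by rewrite recolor_other //; apply: contraNneq euy => <-; rewrite e_sym.
- move=> y; rewrite !inE => /andP[euy yB] Y cY YB yY; exact: Bbad cY YB yY euy.
apply: lerD.
  rewrite (ler_nat R _ 1) -(cards1 u); apply: subset_leq_card; apply/subsetP => y.
  by rewrite !inE /s' recolorE; case: (eqVneq y u) => // _; rewrite eqxx andbF.
rewrite -sumr_cst; apply: ler_sum => y; rewrite inE => /andP[]; rewrite inE => euy yB.
by rewrite /gain (lowB y yB euy) div1r.
Qed.


Definition blocks S := block S @: S.

Lemma sum_card_nbr S u : (\sum_(B in blocks S) #|nbr u :&: B| <= #|nbr u|)%N.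
Proof.
have -> : (\sum_(B in blocks S) #|nbr u :&: B| =
           \sum_(B in blocks S) \sum_(v in B) (v \in nbr u))%N.
  apply: eq_bigr => B _; rewrite -sum1_card big_mkcond [RHS]big_mkcond.
  by apply: eq_bigr => v _; rewrite inE andbC; case: (v \in B); case: (v \in nbr u).
rewrite (sum_classes _ (@block_classes R V e e_sym D a S)) -sum1_card big_mkcond [leqRHS]big_mkcond.
by apply: leq_sum => v _; case: (v \in S); case: (v \in nbr u).
Qed.

(** This is what [2 * beta <= a] is for: the disagreements that [u] spreads over all blocks together
    amount to at most one half. *)
Lemma nbr_mass u : #|nbr u|%:R * (beta / mass u) <= 2^-1.
Proof.
rewrite mulrA ler_pdivrMr ?mass_gt0 //.
have h1 := mass_wt u.
have h3 : (wt e u)%:R = #|nbr u|%:R + 1 :> R by rewrite natr1.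
have h4 : #|nbr u|%:R * (2 * beta) <= #|nbr u|%:R * a by rewrite ler_wpM2l.
by rewrite h3 in h1; move: h1 h4 a0; lra.
Qed.

Local Notation I S := {B : {set V} | B \in blocks S}.
Definition cl S (i : I S) : {ffun V -> C} -> {set {ffun V -> C}} := OmB (val i : {set V}).

Lemma sum_blocks S (M : nmodType) (F : {set V} -> M) :
  \sum_(i : I S) F (val i) = \sum_(B in blocks S) F B.
Proof. by rewrite [RHS]big_sub. Qed.

Lemma card_blocks S : #|{: I S}| = #|blocks S|.
Proof. by rewrite card_sig; apply: eq_card. Qed.

(** Among [N] blocks, updating the one that contains [u] erases a change at [u]; the others keep it
    and add at most 1/2 in total. The sum is at most [N - 1/2]. *)
Lemma mix_lip S h k f : full S -> S != set0 -> lipS S h k f -> 0 < k ->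
  lipS S h (k * (1 - (2 * #|blocks S|%:R)^-1)) (mix (@cl S) f).
Proof.
move=> fS S0 lf k0 s s' sh s'h.
have N0 : 0 < #|blocks S|%:R :> R.
  by case/set0Pn: S0 => x xS; apply: (@natr_card_gt0 _ _ _ (block S x)); apply: imset_f.
apply: (@lip_path S) => [r u c rs' uS|x xS]; last by rewrite sh ?s'h.
have rh : agree S r h by move=> x xS; rewrite rs' ?s'h.
rewrite /mix -mulrBr normrM gtr0_norm ?invr_gt0 card_blocks //.
rewrite ler_pdivrMl // -sumrB /cl.
rewrite (@sum_blocks S _ (fun B => proj (OmB B) f r - proj (OmB B) f (recolor r u c))).
apply: le_trans (ler_norm_sum _ _ _) _.
have uB : block S u \in blocks S by apply: imset_f.
apply: (@le_trans _ _ (\sum_(B in blocks S)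
   (k * (1 + #|nbr u :&: B|%:R * (beta / mass u)) - (if B == block S u then k else 0)))).
  apply: ler_sum => _ /imsetP[x xS ->].
  case: ifPn => [/eqP e1|e1].
    have ux : u \in block S x by rewrite e1 block_refl.
    rewrite /proj (@block_same S x f r u c ux) subrr normr0.
    rewrite mulrDr mulr1 addrAC subrr add0r; apply: mulr_ge0; first exact: ltW.
    by rewrite mulr_ge0 // divr_ge0 // ltW // mass_gt0.
  rewrite subr0; apply: (@block_contract S h) => //.
  by apply: contra e1 => /(block_eq e_sym) <-.
have ku : \sum_(B in blocks S) (if B == block S u then k else 0) = k.
  by rewrite (bigD1 (block S u)) //= eqxx big1 ?addr0 // => B /andP[_ /negbTE ->].
rewrite sumrB ku -mulr_sumr big_split /= -mulr_suml sumr_cst mulr1.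
have h1 : \sum_(B in blocks S) #|nbr u :&: B|%:R * (beta / mass u) <= 2^-1.
  apply: le_trans (nbr_mass u); rewrite -mulr_suml ler_wpM2r //.
    by rewrite divr_ge0 // ltW // mass_gt0.
  by rewrite -natr_sum ler_nat sum_card_nbr.
rewrite -mulr_suml in h1.
have -> : #|blocks S|%:R * (k * (1 - (2 * #|blocks S|%:R)^-1)) = k * (#|blocks S|%:R - 2^-1).
  by field; rewrite gt_eqF.
rewrite -(ler_pM2l k0) in h1; move: h1; lra.
Qed.

Lemma lip_any S h f : exists2 k, 0 < k & lipS S h k f.
Proof.
exists (1 + 2 * \sum_s `|f s|).
  by rewrite ltr_pwDl // mulr_ge0 // sumr_ge0.
move=> s s' _ _; have [->|ss] := eqVneq s s'.
  by rewrite subrr normr0 mulr_ge0 // addr_ge0 // mulr_ge0 // sumr_ge0.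
have h1 : 1 <= (ham s s')%:R :> R.
  rewrite (ler_nat R 1) card_gt0; apply: contraNneq ss => H0; apply/eqP/ffunP => x.
  by apply/eqP; have := in_set0 x; rewrite -H0 inE => /negbT; rewrite negbK.
have fb r : `|f r| <= \sum_s `|f s| by rewrite (bigD1 r) //= lerDl sumr_ge0.
apply: (@le_trans _ _ ((1 + 2 * \sum_s `|f s|) * 1)).
  by rewrite mulr1; apply: le_trans (ler_normB _ _) _; have := fb s; have := fb s'; lra.
by rewrite ler_wpM2l // addr_ge0 // mulr_ge0 // sumr_ge0.
Qed.

(** Uniform in the boundary coloring, because the recursion conditions on arbitrary surroundings. *)
Definition poincare A (K : R) := forall h f,
  varf (OmB A h) f <= K * \sum_(v in A) avg (OmB A h) (fun s => varf (OmB [set v] s) f).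

Lemma poincare0 (K : R) : poincare set0 K.
Proof.
move=> h f; rewrite big_set0 mulr0.
have -> : OmB set0 h = [set h].
  apply/setP => s; rewrite in_set1; apply/OmBP/eqP => [[h1 _]|->].
    by apply/ffunP => x; rewrite h1 // inE.
  by split => // x y; rewrite inE.
by rewrite /varf /avg !big_set1 cards1 !divr1 subrr expr0n.
Qed.

Lemma poincare1 x (K : R) : 1 <= K -> poincare [set x] K.
Proof.
move=> K1 h f; rewrite big_set1.
have [->|[s sO]] := set_0Vmem (OmB [set x] h).
  by rewrite /varf /avg !big_set0 !mul0r mulr0.
have -> : avg (OmB [set x] h) (fun s => varf (OmB [set x] s) f) = varf (OmB [set x] h) f.
  rewrite -[RHS](avg_cst _ sO); apply: eq_avg => r rO; by rewrite (OmB_base rO).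
by rewrite ler_peMl // varf_ge0.
Qed.

(** The gap [1 / (2 N)] of the dynamics with [N] blocks cancels the [1 / N] in [mix], leaving a
    factor 2 independent of [N]. *)
Lemma poincare_blocks S K : full S -> 0 <= K ->
  (forall x, x \in S -> poincare (block S x) K) -> poincare S (2 * K).
Proof.
move=> fS K0 HB; have [->|S0] := eqVneq S set0; first exact: poincare0.
move=> h f; set X := OmB S h.
have [x0 x0O] := OmB_nonempty h fS.
have N0 : (0 < #|blocks S|)%N.
  by case/set0Pn: S0 => x xS; apply/card_gt0P; exists (block S x); apply: imset_f.
have N1 : 0 < #|blocks S|%:R :> R by rewrite ltr0n.
have clX (i : I S) : classes X (cl i).
  apply: OmB_classes => //; case: i => B /= /imsetP[x xS ->]; exact: block_sub.
have I0 : (0 < #|{: I S}|)%N by rewrite card_blocks.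
pose rho : R := 1 - (2 * #|blocks S|%:R)^-1.
have rho0 : 0 < rho.
  rewrite subr_gt0 invf_lt1 ?mulr_gt0 //.
  have : 1 <= #|blocks S|%:R :> R by rewrite (ler_nat R 1).
  lra.
have [k k0 lk] := lip_any S h f.
have lt t : lipS S h (k * rho ^+ t) (iter t (mix (@cl S)) f).
  elim: t => [|t IH]; first by rewrite mulr1.
  by rewrite exprSr mulrA; apply: mix_lip => //; rewrite mulr_gt0 // exprn_gt0.
have av t : avg X (iter t (mix (@cl S)) f) = avg X f.
  elim: t => [//|t IH] /=; by rewrite avg_mix.
have conv : exists K, forall t x, x \in X ->
    `|iter t (mix (@cl S)) f x - avg X f| <= K * rho ^+ t.
  exists (k * #|V|%:R) => t x xX; rewrite -(av t).
  rewrite -{1}(avg_cst (iter t (mix (@cl S)) f x) xX).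
  apply: (avg_dist xX xX) => y z yX zX.
  have ag y' : y' \in X -> agree S y' h by case/OmBP.
  apply: le_trans (lt t x z (ag _ xX) (ag _ zX)) _.
  rewrite [leLHS]mulrAC; apply: ler_wpM2r; first by rewrite exprn_ge0 // ltW.
  by rewrite ler_pM2l // ler_nat; apply: max_card.
have := @variance_of_contraction R _ _ X (@cl S) clX I0 rho f rho0 conv.
rewrite card_blocks /rho opprB addrC subrK invfM -mulrA => H.
have {}H : varf X f <= 2 * \sum_(i : I S) avg X (fun x => varf (cl i x) f).
  move: H; rewrite mulrCA ler_pM2l ?invr_gt0 // => H.
  by rewrite -ler_pdivrMl.
apply: le_trans H _; rewrite -mulrA ler_pM2l //.
rewrite /cl (@sum_blocks S _ (fun B => avg X (fun x => varf (OmB B x) f))).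
rewrite -(sum_classes _ (@block_classes R V e e_sym D a S)) mulr_sumr.
apply: ler_sum => _ /imsetP[x xS ->].
have cB : classes X (OmB (block S x)) by apply: OmB_classes => //; apply: block_sub.
apply: (@le_trans _ _ (avg X (fun y => K * \sum_(v in block S x)
   avg (OmB (block S x) y) (fun s => varf (OmB [set v] s) f)))).
  by apply: le_avg => y _; apply: HB.
rewrite avgZ avg_sum ler_wpM2l // ler_sum // => v _.
by rewrite (avg_proj (fun s => varf (OmB [set v] s) f) cB).
Qed.

End BlockDynamics.

(** * Removing a set from a block *)

Section Recoloring.
Variables (V C : finType) (e : rel V).
Hypotheses (e_sym : symmetric e) (e_irr : irreflexive e).
Local Notation nbr := (nbr e).
Local Notation Om := (Om e).
Implicit Types (S A B Y : {set V}) (L : V -> {set C}) (s t h : {ffun V -> C}).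

Definition recolors S L h : rel {ffun V -> C} :=
  [rel s t | [&& s \in Om S L h, t \in Om S L h & [exists x in S, t == recolor s x (t x)]]].

Lemma recolor_connected S L h :
  (forall A, A \subset S -> A != set0 ->
     exists2 x, x \in A & (#|nbr x :&: A| + 2 <= #|L x|)%N) ->
  {in Om S L h &, forall s t, connect (recolors S L h) s t}.
Proof.
have [n] := ubnP #|S|; elim: n S => // n IH S Sn deg s t sO tO.
have [S0|S0] := eqVneq S set0.
  suff -> : s = t by [].
  move: sO tO; rewrite S0 => /OmP[h1 _ _] /OmP[h2 _ _].
  by apply/ffunP => x; rewrite h1 ?h2 // inE.
have [x xS dx] := deg S (subxx _) S0.
pose p u := recolor u x (h x).
have pO u : u \in Om S L h -> p u \in Om (S :\ x) L h.
  move=> /OmP[h1 h2 h3]; apply/OmP; split.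
  - move=> y; rewrite !inE negb_and negbK /p recolorE.
    by case: (eqVneq y x) => [->|yx] //=; apply: h1.
  - by move=> y; rewrite !inE => /andP[yx yS]; rewrite recolor_other ?h2.
  - move=> y z; rewrite !inE => /andP[yx yS] /andP[zx zS].
    by rewrite !recolor_other //; apply: h3.
have lift u v : u \in Om S L h -> recolors (S :\ x) L h (p u) v ->
    exists2 u', u' \in Om S L h & p u' = v /\ connect (recolors S L h) u u'.
  move=> uO /and3P[_ vO /exists_inP[y]]; rewrite !inE => /andP[yx yS] /eqP vE.
  set c := v y in vE.
  have cL : c \in L y by case/OmP: vO => _ /(_ y) + _; apply; rewrite !inE yx.
  have vc z : z \in S -> z != x -> e y z -> u z != c.
    move=> zS zx eyz; have zy : z != y by apply: contraTneq eyz => ->; rewrite e_irr.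
    have -> : u z = v z by rewrite vE recolor_other // recolor_other.
    by case/OmP: vO => _ _ h3; rewrite eq_sym h3 // !inE ?yx ?zx.
  have pc u' : p (recolor u' y c) = recolor (p u') y c.
    apply/ffunP => z; rewrite !recolorE; case: (eqVneq z x) => [->|//].
    by rewrite eq_sym (negbTE yx).
  have good u' : u' \in Om S L h -> (forall z, z \in S -> e y z -> u' z != c) ->
      recolors S L h u' (recolor u' y c).
    move=> u'O h1; rewrite /recolors /= u'O recolor_Om_in //=.
    by apply/exists_inP; exists y => //; rewrite recolor_same.
  have [|bad] := boolP (e y x && (u x == c)); last first.
    have g : recolors S L h u (recolor u y c).
      apply: good => // z zS eyz; have [zx|zx] := eqVneq z x; last exact: vc.
      by move: bad; rewrite -zx eyz.
    exists (recolor u y c); first by case/and3P: g.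
    by rewrite pc vE; split => //; apply: connect1.
  move=> /andP[eyx /eqP uxc].
  have : (0 < #|unused e S L u x :\ c|)%N.
    have := card_unused e S L u x; rewrite (cardsD1 c (unused e S L u x)).
    by move: dx; clear; case: (c \in _) => /=; lia.
  case/card_gt0P => d; rewrite in_setD1 => /andP[dc /unusedP[dL ud]].
  pose u1 := recolor u x d.
  have u1O : u1 \in Om S L h by apply: recolor_Om_in.
  have g1 : recolors S L h u u1.
    rewrite /recolors /= uO u1O /=; apply/exists_inP; exists x => //.
    by rewrite recolor_same.
  have g2 : recolors S L h u1 (recolor u1 y c).
    apply: good => // z zS eyz; have [->|zx] := eqVneq z x.
      by rewrite recolor_same.
    by rewrite recolor_other //; apply: vc.
  exists (recolor u1 y c); first by case/and3P: g2.
  split; last exact: connect_trans (connect1 g1) (connect1 g2).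
  by rewrite pc vE; congr recolor; rewrite /p recolorK.
have [] : exists2 u', u' \in Om S L h & p u' = p t /\ connect (recolors S L h) s u'.
  have /connectP[q pq ->] : connect (recolors (S :\ x) L h) (p s) (p t).
    apply: IH; rewrite ?pO //; first by move: Sn; rewrite (cardsD1 x S) xS add1n ltnS.
    by move=> A AS; apply: deg; apply: subset_trans AS (subD1set _ _).
  elim: q s sO pq => [|v q IHq] u uO /=; first by exists u.
  move=> /andP[uv pq]; have [u' u'O [pu' uu']] := lift u v uO uv.
  rewrite -pu' in pq *; have [w wO [pw u'w]] := IHq u' u'O pq.
  by exists w => //; split => //; apply: connect_trans uu' u'w.
move=> u' u'O [put su']; apply: connect_trans su' (connect1 _).
rewrite /recolors /= u'O tO /=; apply/exists_inP; exists x => //.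
apply/eqP/ffunP => y; rewrite recolorE; case: (eqVneq y x) => [->//|yx].
by have /ffunP/(_ y) := put; rewrite /p !recolor_other.
Qed.

Lemma card_Om_le S L h : (#|Om S L h| <= #|C| ^ #|S|)%N.
Proof.
have [n] := ubnP #|S|; elim: n S L h => // n IH S L h Sn.
have [->|[w wS]] := set_0Vmem S.
  rewrite cards0 expn0 -(cards1 h); apply: subset_leq_card; apply/subsetP => s /OmP[h1 _ _].
  by rewrite inE; apply/eqP/ffunP => x; rewrite h1 // inE.
rewrite (cardsD1 w S) wS add1n expnS -sum1_card.
rewrite (partition_big (fun s : {ffun V -> C} => s w) predT) //= -sum_nat_const.
apply: leq_sum => k _; apply: leq_trans (IH (S :\ w) (prune e L w k) (recolor h w k) _).
  rewrite sum1_card; apply: subset_leq_card; apply/subsetP => s.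
  rewrite unfold_in => /andP[sO /eqP <-]; exact: Om_reveal.
by move: Sn; rewrite (cardsD1 w S) wS add1n ltnS.
Qed.

(** Colors are deleted one at a time. By [fiber_bound] with [m = 2] each of them has probability at
    most 1/2, so a deletion at most halves the number of colorings. *)
Lemma shrink_card S L0 L1 h :
  (forall x, x \in S -> L1 x \subset L0 x) ->
  (forall x, x \in S -> L0 x != L1 x -> (#|nbr x :&: S| + 2 <= #|L1 x|)%N) ->
  (#|Om S L0 h| <= 2 ^ (\sum_(x in S) #|L0 x :\: L1 x|) * #|Om S L1 h|)%N.
Proof.
have [n] := ubnP (\sum_(x in S) #|L0 x :\: L1 x|)%N.
elim: n L0 => // n IH L0 Hn sub big.
have [/exists_inP[y yS /set0Pn[k]]|] := boolP [exists y in S, L0 y :\: L1 y != set0]; last first.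
  rewrite negb_exists_in => /forall_inP H.
  rewrite (@Om_eq V C e S L0 L1 h) ?leq_pmull ?expn_gt0 // => x xS.
  apply/eqP; rewrite eqEsubset sub // andbT.
  by have := H x xS; rewrite negbK setD_eq0.
rewrite inE => /andP[kL1 kL0].
pose L2 x := if x == y then L0 x :\ k else L0 x.
have sub2 x : x \in S -> L1 x \subset L2 x.
  move=> xS; rewrite /L2; case: eqP => [->|_]; last exact: sub.
  by rewrite subsetD1 sub // kL1.
have S2 : (\sum_(x in S) #|L0 x :\: L1 x| = (\sum_(x in S) #|L2 x :\: L1 x|).+1)%N.
  rewrite (bigD1 y) //= [in RHS](bigD1 y) //= -addSn; congr (_ + _)%N.
    rewrite /L2 eqxx (cardsD1 k) inE kL0 kL1 add1n; congr (_.+1).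
    by apply: eq_card => z; rewrite !inE andbCA.
  by apply: eq_bigr => x /andP[_ /negbTE xy]; rewrite /L2 xy.
have h2 : (#|Om S L0 h| <= 2 * #|Om S L2 h|)%N.
  have := @fiber_bound V C e e_sym e_irr S L0 h y k 2 yS.
  have L01 : L0 y != L1 y by apply: contraNneq kL1 => <-.
  have b1 := big y yS L01; have b2 := subset_leq_card (sub y yS).
  have b3 : (2 + #|nbr y :&: S| <= #|L0 y|)%N by rewrite addnC (leq_trans b1).
  move=> /(_ b3) fib.
  have dec : (#|Om S L0 h| <= #|[set s in Om S L0 h | s y == k]| + #|Om S L2 h|)%N.
    apply: leq_trans (leq_card_setU _ _); apply: subset_leq_card; apply/subsetP => s sO.
    rewrite in_setU in_set sO /=; case: eqP => //= /eqP sk.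
    case/OmP: sO => o1 o2 o3; apply/OmP; split => // x xS.
    by rewrite /L2; case: eqP => [->|_]; rewrite ?in_setD1 ?sk ?o2.
  by move: fib dec; clear; lia.
rewrite S2 expnS -mulnA; apply: leq_trans h2 _; rewrite leq_mul2l /=.
apply: IH => //; first by move: Hn; rewrite S2 ltnS.
move=> x xS L21; apply: big => //; apply: contraNneq L21 => L01.
rewrite /L2; case: (eqVneq x y) => [xy|_]; last by rewrite L01.
by move: kL1; rewrite -xy -L01 xy kL0.
Qed.

End Recoloring.

(** * Comparing the colorings of the removed set *)

Section Removal.
Variables (R : realType) (V C : finType) (e : rel V).
Hypotheses (e_sym : symmetric e) (e_irr : irreflexive e).
Variables (D : nat).
Hypotheses (DC : (2 * D + 2 <= #|C|)%N).
Local Notation nbr := (nbr e).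
Local Notation Om := (Om e).
Local Notation low := (low e D).
Local Notation full := (full e D).
Local Notation OmB := (OmB e).
Implicit Types (B Y : {set V}) (L : V -> {set C}) (s g : {ffun V -> C})
  (f : {ffun V -> C} -> R).

Hypothesis sparse : forall K : {set V}, K != set0 -> (forall x, x \in K -> ~~ low x) ->
  exists2 x, x \in K & (#|nbr x :&: K| + 2 <= #|C|)%N.

Variables (A Q : {set V}).
Hypotheses (fA : full A) (QA : Q \subset A)
  (lowQ : forall x y, x \in Q -> y \in A :\: Q -> e x y -> low y).
Variables (h : {ffun V -> C}) (f : {ffun V -> C} -> R).

Local Notation S := (A :\: Q).
Local Notation L0 := (bdry e A h).
Local Notation X := (OmB A h).
Local Notation G := (Om Q L0 h).
Local Notation LG g := (bdry e S g).

(** Neighbors inside [Q] are counted too, so that adding [#|Q|] gives exactly the weight [wts Q]. *)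
Definition outdeg := (\sum_(x in Q) #|nbr x|)%N.

Lemma restrict_off g x : g \in G -> x \notin Q -> g x = h x.
Proof. by case/OmP => + _ _; apply. Qed.

Lemma fiber_listE g y k : g \in G -> y \in S ->
  (k \in LG g y) = (k \in L0 y) && [forall z in nbr y :&: Q, g z != k].
Proof.
move=> gG yS; apply/bdryP/andP.
  move=> H; split.
    apply/bdryP => z eyz zA; have zQ : z \notin Q by apply: contra zA; apply: (subsetP QA).
    by rewrite -(restrict_off gG zQ) H // inE negb_and zA orbT.
  apply/forall_inP => z; rewrite !inE => /andP[eyz zQ]; apply: H => //.
  by rewrite inE zQ.
move=> [/bdryP h1 /forall_inP h2] z eyz; rewrite inE negb_and negbK => zS.
have [zQ|zQ] := boolP (z \in Q); first by apply: h2; rewrite !inE eyz zQ.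
by rewrite (restrict_off gG zQ) h1 //; move: zS; rewrite (negbTE zQ).
Qed.

Lemma card_fiber_list g y : g \in G -> y \in S -> (#|L0 y :\: LG g y| <= #|nbr y :&: Q|)%N.
Proof.
move=> gG yS; apply: leq_trans (leq_imset_card g _); apply: subset_leq_card.
apply/subsetP => k; rewrite inE fiber_listE // => /andP[+ kL]; rewrite kL /=.
rewrite negb_forall_in => /exists_inP[z zQ /negPn/eqP <-]; exact: imset_f.
Qed.

Definition common_lists (g g' : {ffun V -> C}) y := LG g y :&: LG g' y.

Lemma card_restrictions : (#|G| <= #|C| ^ #|Q|)%N.
Proof. exact: card_Om_le. Qed.

(* Neighbors of [Q] in [A :\: Q] are low, hence keep at least two colors more than
   needed, and a color is ruled out with probability at least 1/2. *)
Lemma card_common g g' : g \in G -> g' \in G ->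
  (#|Om S L0 h| <= 4 ^ outdeg * #|Om S (common_lists g g') h|)%N.
Proof.
move=> gG g'G.
have cL2 y : y \in S -> (#|L0 y :\: common_lists g g' y| <= 2 * #|nbr y :&: Q|)%N.
  move=> yS; rewrite /common_lists setDIr; apply: leq_trans (leq_card_setU _ _) _.
  by have := card_fiber_list gG yS; have := card_fiber_list g'G yS; clear; lia.
have sub y : y \in S -> common_lists g g' y \subset L0 y.
  by move=> yS; apply/subsetP => k; rewrite inE fiber_listE // => /andP[/andP[]].
apply: leq_trans (@shrink_card V C e e_sym e_irr S L0 (common_lists g g') h sub _) _.
  move=> y yS neq.
  have : L0 y :\: common_lists g g' y != set0.
    apply: contraNneq neq => /eqP; rewrite setD_eq0 => H.
    by rewrite eqEsubset H sub.
  move=> ne; have q0 : (0 < #|nbr y :&: Q|)%N.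
    by have := cL2 y yS; move: ne; rewrite -card_gt0; clear; lia.
  case/card_gt0P: (q0) => x; rewrite !inE => /andP[eyx xQ].
  have ly : low y by apply: (lowQ xQ yS); rewrite e_sym.
  have h1 : (#|nbr y| <= D)%N by apply: ltnW.
  have h2 := card_bdry e A h y; have h3 := cardsC (L0 y).
  have h4 := cL2 y yS.
  have h5 : (#|L0 y| = #|common_lists g g' y| + #|L0 y :\: common_lists g g' y|)%N.
    by rewrite -(cardsID (common_lists g g' y) (L0 y)) (setIidPr (sub y yS)).
  have h6 : (#|nbr y| = #|nbr y :&: S| + #|nbr y :&: Q| + #|nbr y :\: A|)%N.
    rewrite -(cardsID A (nbr y)); congr (_ + _)%N.
    rewrite -(cardsID Q (nbr y :&: A)) addnC; congr (_ + _)%N.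
      by apply: eq_card => z; rewrite !inE; case: (e y z); case: (z \in A); case: (z \in Q).
    apply: eq_card => z; rewrite !inE; have := subsetP QA z.
    by case: (e y z); case: (z \in A); case: (z \in Q) => // /(_ isT).
  by move: DC h1 h2 h3 h4 h5 h6; clear; lia.
rewrite leq_mul2r; apply/orP; right.
(* Each neighbor in [Q] rules out at most two colors, one for [g] and one for [g'], hence two
   halvings. *)
rewrite (_ : 4 = 2 ^ 2)%N // -expnM leq_exp2l //.
apply: (@leq_trans (\sum_(y in S) 2 * #|nbr y :&: Q|)%N).
  by apply: leq_sum => y yS; apply: cL2.
rewrite -big_distrr leq_mul2l /=; rewrite /outdeg.
have cE (B : {set V}) y : #|nbr y :&: B| = (\sum_(x in B) e y x)%N.
  rewrite -sum1_card big_mkcond [RHS]big_mkcond; apply: eq_bigr => x _.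
  by rewrite !inE andbC; case: (x \in B); case: (e y x).
rewrite (eq_bigr (fun y => (\sum_(x in Q) e y x)%N)) => [|y _]; last exact: cE.
rewrite exchange_big; apply: leq_sum => x xQ.
apply: (@leq_trans (\sum_(y in S) e x y)%N).
  by apply: leq_sum => y _; rewrite e_sym.
by rewrite -cE subset_leq_card // subsetIl.
Qed.

Lemma card_fiber g : g \in G -> (#|OmB S g| <= #|Om S L0 h|)%N.
Proof.
move=> gG; rewrite /OmB (card_Om_over _ _ _ h); apply: subset_leq_card.
apply/subsetP => s /OmP[h1 h2 h3]; apply/OmP; split => // x xS.
by have := h2 x xS; rewrite fiber_listE // => /andP[].
Qed.

Lemma restrict_in s : s \in X -> overlay Q h s \in G.
Proof.
move=> sX; have /OmBP[h1 h2] := sX; apply/OmP; split.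
- by move=> x /negbTE xQ; rewrite overE xQ.
- move=> x xQ; rewrite overE xQ; have xA := subsetP QA x xQ.
  by apply/bdryP => y exy yA; rewrite -h1 // eq_sym h2.
- move=> x y xQ yQ exy; rewrite !overE xQ yQ h2 //; exact: subsetP QA x xQ.
Qed.

Lemma mem_fiber s : s \in X -> s \in OmB S (overlay Q h s).
Proof.
move=> sX; have /OmBP[h1 h2] := sX; apply/OmBP; split.
  move=> x; rewrite inE negb_and negbK overE => /orP[->//|xA].
  by case: ifP => // _; rewrite h1.
by move=> x y; rewrite inE => /andP[_ xA]; apply: h2.
Qed.

Lemma fiber_sub g : g \in G -> OmB S g \subset X.
Proof.
move=> gG; apply/subsetP => s /OmBP[h1 h2].
have /OmP[g1 g2 g3] := gG.
have hA x : x \notin A -> s x = h x.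
  move=> xA; rewrite h1 ?g1 //; last by rewrite inE negb_and xA orbT.
  by apply: contra xA; apply: (subsetP QA).
have hQ x : x \in Q -> s x = g x by move=> xQ; rewrite h1 // inE xQ.
apply/OmBP; split => // x y xA exy.
have [xQ|xQ] := boolP (x \in Q); last by apply: h2 => //; rewrite inE xQ.
have [yA|yA] := boolP (y \in A).
  have [yQ|yQ] := boolP (y \in Q); first by rewrite !hQ // g3.
  by rewrite eq_sym h2 ?inE ?yQ // e_sym.
by rewrite hQ // (hA y) // eq_sym; have /bdryP := g2 x xQ; apply.
Qed.

Lemma card_le_fibers : (#|X| <= #|G| * #|Om S L0 h|)%N.
Proof.
rewrite -sum1_card (partition_big (overlay Q h) (mem G)) /=; last exact: restrict_in.
rewrite -sum_nat_const; apply: leq_sum => g gG.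
apply: leq_trans (card_fiber gG); rewrite sum1_card; apply: subset_leq_card.
by apply/subsetP => s; rewrite unfold_in => /andP[sX /eqP <-]; apply: mem_fiber.
Qed.

Definition fiber_mean (g : {ffun V -> C}) := avg (OmB S g) f.

Local Notation E1 := (\sum_(s in X) varf (OmB S s) f).
Local Notation E2 x := (\sum_(s in X) varf (OmB [set x] s) f).

(** The overlays of [Z] are distinct points of a single class in [X], the fiber over [g], whose
    squared deviations are part of [E1]. *)
Lemma sum_fiber (Z : {set {ffun V -> C}}) g : g \in G ->
  {in Z &, injective (overlay S g)} ->
  (forall s, s \in Z -> overlay S g s \in OmB S g) ->
  \sum_(s in Z) (f (overlay S g s) - fiber_mean g) ^+ 2 <= E1.
Proof.
move=> gG inj ZO.
have fX := fiber_sub gG.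
rewrite (sum_varf_sqr f (@OmB_classes V C e e_sym S A h (subsetDl _ _))).
rewrite -(big_imset (fun s => (f s - fiber_mean g) ^+ 2) inj) /=.
have sub : overlay S g @: Z \subset OmB S g.
  by apply/subsetP => _ /imsetP[s sZ ->]; apply: ZO.
rewrite [leRHS](bigID (mem (overlay S g @: Z))) /= -[leLHS]addr0; apply: lerD.
  rewrite le_eqVlt; apply/orP; left; apply/eqP.
  apply: eq_big => s.
    by apply/idP/andP => [sZ|[]//]; split => //; apply: (subsetP fX); apply: (subsetP sub).
  by move=> sZ; rewrite /fiber_mean /proj (OmB_base (subsetP sub _ sZ)).
by apply: sumr_ge0 => s _; rewrite sqr_ge0.
Qed.

Lemma two_point (Y : {set {ffun V -> C}}) s t : s \in Y -> t \in Y ->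
  (f s - f t) ^+ 2 <= 2 * #|Y|%:R * varf Y f.
Proof.
move=> sY tY; rewrite /varf -mulrA -(avgM _ sY).
have [->|st] := eqVneq s t.
  by rewrite subrr expr0n mulr_ge0 // sumr_ge0 // => r _; rewrite sqr_ge0.
rewrite (bigD1 s) //= (bigD1 t) ?tY 1?eq_sym //=.
set m := avg Y f; set r := \sum_(i | _) _.
have r0 : 0 <= r by apply: sumr_ge0 => i _; rewrite sqr_ge0.
suff : (f s - f t) ^+ 2 <= 2 * ((f s - m) ^+ 2 + (f t - m) ^+ 2) by lra.
rewrite -subr_ge0 (_ : _ - _ = (f s + f t - 2 * m) ^+ 2); last by ring.
exact: sqr_ge0.
Qed.

Lemma card_site x s : (#|OmB [set x] s| <= #|C|)%N.
Proof. by have := card_Om_le e [set x] (bdry e [set x] s) s; rewrite cards1 expn1. Qed.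

Lemma fiber_avg (Z : {set {ffun V -> C}}) g : g \in G -> (exists s, s \in Z) ->
  {in Z &, injective (overlay S g)} ->
  (forall s, s \in Z -> overlay S g s \in OmB S g) ->
  #|Z|%:R * (fiber_mean g - avg Z (fun s => f (overlay S g s))) ^+ 2 <= E1.
Proof.
move=> gG [s0 s0Z] inj ZO; apply: le_trans (sum_fiber gG inj ZO).
rewrite (avgM _ s0Z) ler_pM2l ?(natr_card_gt0 _ s0Z) //.
apply: le_trans (avg_sqr _ _).
by rewrite avgD avgN (avg_cst _ s0Z) -sqrrN opprB.
Qed.

(** The fiber means are compared through averages over the colorings [Z] allowed by both [g] and
    [g']: two differences stay inside a fiber, and the third changes the site [x] only. Restricting
    to [Z] costs the factor [#|X| / #|Z|]. *)
Lemma adjacent_step g x c : g \in G -> x \in Q -> recolor g x c \in G ->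
  #|X|%:R * (fiber_mean g - fiber_mean (recolor g x c)) ^+ 2 <=
    3 * (#|C| ^ #|Q| * 4 ^ outdeg)%:R * (2 * E1 + 2 * #|C|%:R * E2 x).
Proof.
set g' := recolor g x c => gG xQ g'G.
pose Z := Om S (common_lists g g') h.
have Ybig := card_common gG g'G.
have fS : full S.
  move=> y; rewrite inE => /andP[yQ yA] hy; apply/subsetP => z; rewrite inE => eyz.
  have zA : z \in A by apply: (subsetP (fA yA hy)); rewrite inE.
  rewrite inE zA andbT; apply: contra hy => zQ; apply: (lowQ zQ); last by rewrite e_sym.
  by rewrite inE yQ.
have [s0 s0O] := OmB_nonempty e_sym e_irr DC sparse g fS.
have Y0 : (0 < #|Om S L0 h|)%N.
  by apply: leq_trans (card_fiber gG); apply/card_gt0P; exists s0.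
have Z0 : (0 < #|Z|)%N.
  rewrite lt0n; apply: contraTneq Y0 => Z0; rewrite -leqNgt.
  by move: Ybig; rewrite -/Z Z0 muln0.
have [s1 s1Z] : exists s, s \in Z by apply/card_gt0P.
have inj u : {in Z &, injective (overlay S u)} by apply: over_inj.
have sub1 y : y \in S -> common_lists g g' y \subset LG g y by move=> _; apply: subsetIl.
have sub2 y : y \in S -> common_lists g g' y \subset LG g' y by move=> _; apply: subsetIr.
have mono L L' (u : {ffun V -> C}) : (forall y, y \in S -> L y \subset L' y) -> Om S L u \subset Om S L' u.
  move=> LL; apply/subsetP => s /OmP[h1 h2 h3]; apply/OmP; split => // y yS.
  by apply: (subsetP (LL y yS)); apply: h2.
have Zg s : s \in Z -> overlay S g s \in OmB S g.
  by move=> sZ; apply: (subsetP (mono _ _ _ sub1)); apply: over_Om sZ.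
have Zg' s : s \in Z -> overlay S g' s \in OmB S g'.
  by move=> sZ; apply: (subsetP (mono _ _ _ sub2)); apply: over_Om sZ.
have a1 := fiber_avg gG (ex_intro _ s1 s1Z) (inj g) Zg.
have a2 := fiber_avg g'G (ex_intro _ s1 s1Z) (inj g') Zg'.
have a3 : #|Z|%:R * (avg Z (fun s => f (overlay S g s)) - avg Z (fun s => f (overlay S g' s))) ^+ 2
    <= 2 * #|C|%:R * E2 x.
  rewrite -avgN -avgD.
  apply: (@le_trans _ _ (\sum_(s in Z) (f (overlay S g s) - f (overlay S g' s)) ^+ 2)).
    by rewrite (avgM _ s1Z) ler_pM2l ?ltr0n //; apply: avg_sqr.
  apply: (@le_trans _ _ (\sum_(s in Z) 2 * #|C|%:R * varf (OmB [set x] (overlay S g s)) f)).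
    apply: ler_sum => s sZ.
    have xA := subsetP QA x xQ.
    have sX := subsetP (fiber_sub gG) _ (Zg s sZ).
    have s'X := subsetP (fiber_sub g'G) _ (Zg' s sZ).
    have xsub : [set x] \subset A by rewrite sub1set.
    have in1 := OmB_refl xsub sX.
    have in2 : overlay S g' s \in OmB [set x] (overlay S g s).
      have /OmBP[_ h2] := OmB_refl xsub s'X.
      apply/OmBP; split => // y; rewrite inE => yx; rewrite !overE.
      by case: ifP => // _; rewrite /g' recolor_other.
    apply: le_trans (two_point in1 in2) _.
    rewrite ler_wpM2r ?varf_ge0 // ler_pM2l // ler_nat; exact: card_site.
  rewrite -mulr_sumr ler_wpM2l ?mulr_ge0 //.
  rewrite -(big_imset (fun s => varf (OmB [set x] s) f) (inj g)) /=.
  have sub : overlay S g @: Z \subset X.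
    by apply/subsetP => _ /imsetP[s sZ ->]; apply: (subsetP (fiber_sub gG)); apply: Zg.
  rewrite [leRHS](bigID (mem (overlay S g @: Z))) /= -[leLHS]addr0; apply: lerD.
    rewrite le_eqVlt; apply/orP; left; apply/eqP; apply: eq_bigl => s.
    by apply/idP/andP => [sZ|[]//]; split => //; apply: (subsetP sub).
  by apply: sumr_ge0 => s _; rewrite varf_ge0.
set u := avg Z _ in a1 a3; set v := avg Z _ in a2 a3.
have sq : (fiber_mean g - fiber_mean g') ^+ 2 <= 3 * ((fiber_mean g - u) ^+ 2 + (fiber_mean g' - v) ^+ 2 + (u - v) ^+ 2).
  have := sqr_ge0 ((fiber_mean g - u) + (fiber_mean g' - v)); have := sqr_ge0 ((fiber_mean g - u) - (u - v)).
  by have := sqr_ge0 ((fiber_mean g' - v) + (u - v)); nra.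
have XZ : #|X|%:R <= (#|C| ^ #|Q| * 4 ^ outdeg)%:R * #|Z|%:R :> R.
  rewrite -natrM ler_nat -mulnA; apply: leq_trans card_le_fibers _.
  by apply: leq_mul => //; apply: card_restrictions.
apply: (@le_trans _ _ ((#|C| ^ #|Q| * 4 ^ outdeg)%:R * (#|Z|%:R * (fiber_mean g - fiber_mean g') ^+ 2))).
  by rewrite mulrA ler_wpM2r // sqr_ge0.
rewrite -[leRHS]mulrA [leRHS]mulrCA ler_wpM2l //.
apply: (@le_trans _ _ (#|Z|%:R * (3 * ((fiber_mean g - u) ^+ 2 + (fiber_mean g' - v) ^+ 2 + (u - v) ^+ 2)))).
  by rewrite ler_wpM2l.
by move: a1 a2 a3; lra.
Qed.

Lemma site_var_le x : x \in Q -> E2 x <= \sum_(y in Q) E2 y.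
Proof.
move=> xQ; rewrite (bigD1 x) //= lerDl sumr_ge0 // => y _.
by rewrite sumr_ge0 // => s _; rewrite varf_ge0.
Qed.

Definition jump_bound : R := 3 * (#|C| ^ #|Q| * 4 ^ outdeg)%:R * (2 * E1 + 2 * #|C|%:R * \sum_(y in Q) E2 y).

Lemma jump_bound_ge0 : 0 <= jump_bound.
Proof.
have e0 : 0 <= E1 by apply: sumr_ge0 => s _; apply: varf_ge0.
have e1 : 0 <= \sum_(y in Q) E2 y.
  by apply: sumr_ge0 => y _; apply: sumr_ge0 => s _; apply: varf_ge0.
have c0 : 0 <= #|C|%:R :> R by [].
rewrite /jump_bound; apply: mulr_ge0; first exact: mulr_ge0.
by apply: addr_ge0; apply: mulr_ge0 => //; apply: mulr_ge0.
Qed.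

(** A repetition-free path of single-vertex recolorings from [g] to [g'] has at most [#|G|] steps;
    squaring its length gives the factor [#|G| ^ 2]. *)
Lemma fiber_mean_far g g' : g \in G -> g' \in G ->
  #|X|%:R * (fiber_mean g - fiber_mean g') ^+ 2 <= #|G|%:R ^+ 2 * jump_bound.
Proof.
move=> gG g'G.
have [X0|X0] := posnP #|X|.
  by rewrite X0 mul0r mulr_ge0 ?sqr_ge0 // jump_bound_ge0.
have Xp : 0 < #|X|%:R :> R by rewrite ltr0n.
pose d := Num.sqrt (jump_bound / #|X|%:R).
have d2 : d ^+ 2 = jump_bound / #|X|%:R by rewrite sqr_sqrtr // divr_ge0 ?jump_bound_ge0.
have step s t : recolors e Q L0 h s t -> `|fiber_mean s - fiber_mean t| <= d.
  move=> /and3P[sG tG /exists_inP[x xQ /eqP tE]].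
  rewrite -(@ler_pXn2r _ 2) ?nnegrE ?sqrtr_ge0 // d2 real_normK ?num_real //.
  rewrite ler_pdivlMr // mulrC tE.
  apply: le_trans (adjacent_step sG xQ _) _; first by rewrite -tE.
  rewrite /jump_bound ler_wpM2l ?mulr_ge0 // lerD2l ler_wpM2l ?mulr_ge0 //; exact: site_var_le.
have deg (A' : {set V}) : A' \subset Q -> A' != set0 ->
    exists2 x, x \in A' & (#|nbr x :&: A'| + 2 <= #|L0 x|)%N.
  by move=> AQ; apply: (degenerate_full DC sparse h fA); apply: subset_trans AQ QA.
have /connectP[p0 pp0] := recolor_connected e_sym e_irr deg gG g'G.
case/shortenP: pp0 => p pp up _ g'E.
have pG : {subset p <= G}.
  elim: p g {gG g'E up} pp => //= t p IH s /andP[st pp] r; rewrite inE => /orP[/eqP->|].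
    by case/and3P: st.
  exact: IH pp r.
have sp : (size p <= #|G|)%N.
  have := max_card (mem p); move: up => /= /andP[_ up].
  rewrite -(card_uniqP up) => _; exact/subset_leq_card/subsetP.
have walk : `|fiber_mean g - fiber_mean g'| <= (size p)%:R * d.
  rewrite g'E; elim: p g {gG g'E up pG sp} pp => [|t p IH] s /=.
    by rewrite subrr normr0 mul0r.
  move=> /andP[st pp]; have h1 := step s t st; have h2 := IH t pp.
  have := ler_normD (fiber_mean s - fiber_mean t) (fiber_mean t - fiber_mean (last t p)); rewrite addrA subrK -natr1 mulrDl mul1r.
  by move: h1 h2; lra.
rewrite mulrC -ler_pdivlMr // -mulrA -d2 -exprMn -real_normK ?num_real //.
rewrite ler_pXn2r ?nnegrE // ?mulr_ge0 ?sqrtr_ge0 //.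
apply: le_trans walk _; rewrite ler_wpM2r ?sqrtr_ge0 // ler_nat //.
Qed.

Lemma removal_var : #|X|%:R * varf X (proj (OmB S) f) <= #|G|%:R ^+ 2 * jump_bound.
Proof.
have [->|[s0 s0X]] := set_0Vmem X; first by rewrite cards0 mul0r mulr_ge0 ?sqr_ge0 // jump_bound_ge0.
have Xp := natr_card_gt0 R s0X.
have PF s : s \in X -> proj (OmB S) f s = fiber_mean (overlay Q h s).
  by move=> sX; rewrite /proj /fiber_mean (OmB_base (mem_fiber sX)).
rewrite mulrC -ler_pdivlMr //.
rewrite /varf -[leRHS](avg_cst _ s0X); apply: le_avg => s sX.
apply: (@le_trans _ _ (avg X (fun t => (proj (OmB S) f s - proj (OmB S) f t) ^+ 2))).
  apply: le_trans (avg_sqr _ _); rewrite avgD avgN (avg_cst _ s0X) //.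
rewrite -[leRHS](avg_cst _ s0X); apply: le_avg => t tX.
by rewrite ler_pdivlMr // mulrC !PF // fiber_mean_far // restrict_in.
Qed.

End Removal.

(** * The Poincare inequality after removing a set *)

Section RemovalBound.
Variables (R : realType) (V C : finType) (e : rel V).
Hypotheses (e_sym : symmetric e) (e_irr : irreflexive e).
Variable D : nat.
Hypothesis DC : (2 * D + 2 <= #|C|)%N.
Local Notation nbr := (nbr e).
Local Notation low := (low e D).
Local Notation full := (full e D).
Local Notation OmB := (OmB e).
Implicit Types (S A B Y Q : {set V}) (s h : {ffun V -> C})
  (f : {ffun V -> C} -> R).

Hypothesis sparse : forall K : {set V}, K != set0 -> (forall x, x \in K -> ~~ low x) ->
  exists2 x, x \in K & (#|nbr x :&: K| + 2 <= #|C|)%N.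

Definition wts Y := (\sum_(x in Y) wt e x)%N.
(** Here [28 = 7 * 4]: 7 comes from [1 + 6 z <= 7 z], 4 from [4 ^ outdeg], and the power of [#|C|]
    from [3 * #|Q| + 1 <= 4 * #|Q|]. *)
Definition cost := (28 * #|C| ^ 4)%N.

Lemma wtsE Q : wts Q = (#|Q| + outdeg e Q)%N.
Proof. by rewrite /wts /wt /outdeg -sum1_card -big_split; apply: eq_bigr => x _. Qed.

Lemma C_gt0 : (0 < #|C|)%N.
Proof. by move: DC; clear; lia. Qed.

Lemma cost_bound Q : Q != set0 ->
  (1 + 6 * (#|C| ^ (3 * #|Q| + 1) * 4 ^ outdeg e Q) <= cost ^ wts Q)%N.
Proof.
move=> Q0; have Q1 : (0 < #|Q|)%N by rewrite card_gt0.
have Qw : (#|Q| <= wts Q)%N by rewrite wtsE leq_addr.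
have w1 := leq_trans Q1 Qw.
have ow : (outdeg e Q <= wts Q)%N by rewrite wtsE leq_addl.
have c0 := C_gt0.
have h1 : (#|C| ^ (3 * #|Q| + 1) <= #|C| ^ (4 * wts Q))%N.
  by apply: leq_pexp2l => //; move: Q1 Qw; clear; lia.
have h2 : (4 ^ outdeg e Q <= 4 ^ wts Q)%N by apply: leq_pexp2l.
have h3 : (7 <= 7 ^ wts Q)%N by rewrite -[leqLHS]expn1 leq_pexp2l.
have h4 : (cost ^ wts Q = 7 ^ wts Q * (#|C| ^ (4 * wts Q) * 4 ^ wts Q))%N.
  rewrite expnM -!expnMn /cost; congr (_ ^ _)%N; move: (#|C| ^ 4)%N => z; clear; lia.
rewrite h4; apply: (@leq_trans (7 * (#|C| ^ (3 * #|Q| + 1) * 4 ^ outdeg e Q))).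
  have : (0 < #|C| ^ (3 * #|Q| + 1) * 4 ^ outdeg e Q)%N by rewrite muln_gt0 !expn_gt0 c0.
  by move: (_ * _)%N => z; clear; lia.
by apply: leq_mul => //; apply: leq_mul.
Qed.

(** Total variance is split over the coloring of [Q]: the hypothesis on [A :\: Q] handles the
    variance inside fibers, [removal_var] that of the fiber means. *)
Lemma poincare_remove A Q (K : R) : full A -> Q \subset A -> Q != set0 ->
  (forall x y, x \in Q -> y \in A :\: Q -> e x y -> low y) ->
  1 <= K -> @poincare R V C e (A :\: Q) K -> @poincare R V C e A ((cost ^ wts Q)%:R * K).
Proof.
move=> fA QA Q0 lowQ K1 HS h f; set X := OmB A h.
have [X0|[s0 s0X]] := set_0Vmem X.
  by rewrite /varf /avg X0 big_set0 mul0r mulr_ge0 ?mulr_ge0 ?(le_trans _ K1) // sumr_ge0 // => v _; rewrite big_set0 mul0r.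
have Xp := natr_card_gt0 R s0X.
have clS := @OmB_classes V C e e_sym (A :\: Q) A h (subsetDl _ _).
pose T v := avg X (fun s => varf (OmB [set v] s) f).
have T0 v : 0 <= T v by apply: avg_ge0 => s _; apply: varf_ge0.
pose TS := \sum_(v in A :\: Q) T v; pose TQ := \sum_(v in Q) T v.
have TS0 : 0 <= TS by apply: sumr_ge0.
have TQ0 : 0 <= TQ by apply: sumr_ge0.
have TA : \sum_(v in A) T v = TS + TQ.
  rewrite addrC (bigID (mem Q)) /=; congr (_ + _); apply: eq_bigl => v; rewrite ?inE.
    by apply/andP/idP => [[]//|vQ]; split => //; apply: (subsetP QA).
  by rewrite andbC.
have E1 : avg X (fun s => varf (OmB (A :\: Q) s) f) <= K * TS.
  apply: (@le_trans _ _ (avg X (fun s => K * \sum_(v in A :\: Q)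
     avg (OmB (A :\: Q) s) (fun r => varf (OmB [set v] r) f)))).
    by apply: le_avg => s _; apply: HS.
  rewrite avgZ avg_sum ler_wpM2l ?(le_trans _ K1) // ler_sum // => v _.
  by rewrite (avg_proj (fun r => varf (OmB [set v] r) f) clS).
have := removal_var e_sym e_irr DC sparse fA QA lowQ h f.
rewrite (varf_decomp f clS) -/X TA.
set G := #|Om _ _ _ _|; set v2 := varf X _ => Hv.
have GC : (G <= #|C| ^ #|Q|)%N by apply: card_restrictions.
have {Hv} Hv : v2 <= G%:R ^+ 2 * (3 * (#|C| ^ #|Q| * 4 ^ outdeg e Q)%:R * (2 * (K * TS) + 2 * #|C|%:R * TQ)).
  rewrite -(ler_pM2l Xp); apply: le_trans Hv _.
  rewrite /jump_bound [leRHS]mulrCA ler_wpM2l ?sqr_ge0 // [leRHS]mulrCA ler_wpM2l ?mulr_ge0 //.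
  rewrite mulrDr lerD //.
    rewrite [leRHS]mulrCA ler_pM2l // (avgM _ s0X) ler_pM2l //.
  rewrite [leRHS]mulrCA ler_wpM2l ?mulr_ge0 // /TQ mulr_sumr.
  by apply: ler_sum => v _; rewrite (avgM _ s0X).
have c1 : 1 <= #|C|%:R :> R by rewrite (ler_nat R 1) C_gt0.
have N1 : (1 + 6 * (#|C| ^ (3 * #|Q| + 1) * 4 ^ outdeg e Q))%:R <= (cost ^ wts Q)%:R :> R.
  by rewrite ler_nat cost_bound.
apply: (@le_trans _ _ ((1 + 6 * (#|C| ^ (3 * #|Q| + 1) * 4 ^ outdeg e Q))%:R * K * (TS + TQ))); last first.
  by rewrite ler_wpM2r ?addr_ge0 // ler_wpM2r // (le_trans _ K1).
have Gq : G%:R ^+ 2 <= (#|C| ^ #|Q|)%:R ^+ 2 :> R.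
  by rewrite ler_pXn2r ?nnegrE // ler_nat.
have w0 : 0 <= 2 * (K * TS) + 2 * #|C|%:R * TQ.
  have : 0 <= K * TS by rewrite mulr_ge0 // (le_trans _ K1).
  have : 0 <= #|C|%:R * TQ by rewrite mulr_ge0.
  by lra.
have w1 : 2 * (K * TS) + 2 * #|C|%:R * TQ <= 2 * #|C|%:R * (K * (TS + TQ)).
  have k0 : 0 <= K by apply: le_trans K1.
  have h1 : 1 * (K * TS) <= #|C|%:R * (K * TS) by rewrite ler_wpM2r // mulr_ge0.
  have h2 : #|C|%:R * (1 * TQ) <= #|C|%:R * (K * TQ) by rewrite ler_wpM2l // ler_wpM2r.
  by move: h1 h2; lra.
have Hv2 : v2 <= (6 * (#|C| ^ (3 * #|Q| + 1) * 4 ^ outdeg e Q))%:R * (K * (TS + TQ)).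
  apply: le_trans Hv _.
  apply: (@le_trans _ _ ((#|C| ^ #|Q|)%:R ^+ 2 * (3 * (#|C| ^ #|Q| * 4 ^ outdeg e Q)%:R * (2 * #|C|%:R * (K * (TS + TQ)))))).
    apply: ler_pM; [exact: sqr_ge0| |exact: Gq|].
      by rewrite mulr_ge0 // mulr_ge0.
    by rewrite ler_wpM2l // mulr_ge0.
  rewrite le_eqVlt; apply/orP; left; apply/eqP.
  have -> : (#|C| ^ (3 * #|Q| + 1) = #|C| ^ #|Q| * #|C| ^ #|Q| * #|C| ^ #|Q| * #|C|)%N.
    by rewrite expnD expn1 mulnC [(3 * _)%N]mulnC expnM expnS expnS expn1 mulnC mulnA.
  rewrite !natrM; ring.
have E2 : K * TS <= K * (TS + TQ) by rewrite ler_wpM2l ?(le_trans _ K1) // lerDl.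
by rewrite natrD -mulrA mulrDl mul1r; move: E1 E2 Hv2; lra.
Qed.

End RemovalBound.

(** * The Poincare inequality in a block *)

Section BlockRecursion.
Variables (R : realType) (V C : finType) (e : rel V).
Hypotheses (e_sym : symmetric e) (e_irr : irreflexive e).
Variables (D : nat) (a b beta eps : R).
Hypotheses (DC : (2 * D + 2 <= #|C|)%N) (a0 : 0 < a) (a1 : a <= 1) (aD : 1 <= a * D%:R)
  (beta0 : 0 <= beta) (beta_le : 2 * beta <= a)
  (eps_le : eps <= a * beta) (epsD : D%:R <= eps * (#|C| - D)%:R)
  (b0 : 0 < b) (b1 : b <= 1) (ab : a = b ^+ 2).
Local Notation nbr := (nbr e).
Local Notation mass := (mass e D a).
Local Notation low := (low e D).
Local Notation full := (full e D).
Local Notation block := (block e D a).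
Local Notation badv := (badv e D a).
Local Notation bad := (bad e D a).
Local Notation OmB := (OmB e).
Local Notation conn := (conn e).
Local Notation wts := (wts e).
Local Notation poincare := (@poincare R V C e).
Local Notation cost := (cost C).
Implicit Types (S A B Y Q T : {set V}) (s h : {ffun V -> C}).

Hypothesis sparse : forall K : {set V}, K != set0 -> (forall x, x \in K -> ~~ low x) ->
  exists2 x, x \in K & (#|nbr x :&: K| + 2 <= #|C|)%N.

Definition mu x : R := mass x / a.
(** The square is there because the mass of a removed set [Q] pays twice: for its own vertices and
    for the set [T] that joins it to the next block. *)
Definition dense Y : bool := 1 <= \prod_(x in Y) (b * mu x ^+ 2).

Variable M : nat.
Hypothesis dense_small : forall Y, conn Y -> dense Y -> (wts Y <= M)%N.

Lemma mu_ge1 x : 1 <= mu x.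
Proof. by rewrite /mu ler_pdivlMr // mul1r; apply: mass_ge. Qed.

Lemma mu_ge_mass x : mass x <= mu x.
Proof. by rewrite /mu ler_pdivlMr // ler_piMr // ltW // mass_gt0. Qed.

Definition phi Q := \prod_(x in Q) (mass x / b).

Lemma phi_gt0 Q : 0 < phi Q.
Proof. by apply: prodr_gt0 => x _; rewrite divr_gt0 // mass_gt0. Qed.

Lemma phiE Q : phi Q = (\prod_(x in Q) mass x) / b ^+ #|Q|.
Proof. by rewrite /phi big_split /= prodr_const exprVn. Qed.

Lemma prod_setID (F : V -> R) A B :
  \prod_(x in A) F x = \prod_(x in A :&: B) F x * \prod_(x in A :\: B) F x.
Proof.
rewrite (bigID (mem B)) /=; congr (_ * _); apply: eq_bigl => x; rewrite !inE //.
by rewrite andbC.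
Qed.

Lemma prod_setU (F : V -> R) A B : [disjoint A & B] ->
  \prod_(x in A :|: B) F x = \prod_(x in A) F x * \prod_(x in B) F x.
Proof. by move=> AB; rewrite -bigU //; apply: eq_bigl => x; rewrite !inE. Qed.

Lemma disjU A B S : [disjoint A & S] -> [disjoint B & S] -> [disjoint A :|: B & S].
Proof. by rewrite !disjoints_subset subUset => -> ->. Qed.

Definition maximal B z Q := [/\ conn Q, Q \subset B, z \in Q &
  forall Q', conn Q' -> Q' \subset B -> z \in Q' -> phi Q' <= phi Q].

Lemma maximal_exists B z : z \in B -> exists Q, maximal B z Q.
Proof.
move=> zB; pose P Q := [&& conn Q, Q \subset B & z \in Q].
have P0 : P [set z] by rewrite /P conn1 sub1set zB set11.
exists [arg max_(Q > [set z] | P Q) phi Q]%O.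
case: arg_maxP => // Q /and3P[h1 h2 h3] H; split => // Q' c1 c2 c3.
by apply: H; rewrite /P c1 c2 c3.
Qed.

Lemma maximal_low B z Q : maximal B z Q ->
  forall x y, x \in Q -> y \in B :\: Q -> e x y -> low y.
Proof.
move=> [cQ QB zQ mQ] x y xQ; rewrite inE => /andP[yQ yB] exy.
apply: contraT => hy; have := mQ (y |: Q).
rewrite /phi big_setU1 //= -/(phi Q) => H; suff : mass y / b * phi Q <= phi Q.
  rewrite ger_pMl ?phi_gt0 // ler_pdivrMr // mul1r leNgt => /negP[].
  rewrite /mass (negbTE hy); apply: le_lt_trans b1 _; rewrite (ltr_nat R 1).
  move: hy; rewrite /low -ltnNge; apply: leq_ltn_trans.
  by rewrite lt0n; apply: contraTneq aD => ->; rewrite mulr0 -ltNge ltr01.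
apply: H.
- rewrite setUC; apply: (connU e_sym cQ (conn1 e y) xQ (set11 y)); by rewrite exy orbT.
- by rewrite subUset sub1set yB.
- by rewrite inE zQ orbT.
Qed.

(** [z] lies in a bad set, whose [phi] is at least 1 because [b <= 1]; by maximality so is [phi Q],
    and [a = b ^+ 2] rewrites it in terms of [mu]. *)
Lemma maximal_heavy B z Q : maximal B z Q -> z \in badv B ->
  1 <= b ^+ #|Q| * \prod_(x in Q) mu x.
Proof.
move=> [cQ QB zQ mQ] /badvP[Y [/andP[cY Y1] YB zY]].
have h := mQ Y cY YB zY.
have bp n : 0 < b ^+ n by apply: exprn_gt0.
have p1 : 1 <= phi Q.
  apply: le_trans h; rewrite phiE ler_pdivlMr // mul1r.
  by apply: le_trans (ltW Y1); apply: exprn_ile1 => //; apply: ltW.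
have aE : a ^+ #|Q| = b ^+ #|Q| * b ^+ #|Q|.
  by rewrite {1}ab -exprM mul2n -addnn exprD.
rewrite /mu big_split /= prodr_const exprVn aE.
apply: le_trans p1 _; rewrite phiE.
have e1 : b ^+ #|Q| != 0 by rewrite gt_eqF.
rewrite le_eqVlt; apply/orP; left; apply/eqP; field.
exact: e1.
Qed.

(** By maximality [phi (Y :\: Q) <= 1], so [Y :\: Q] has mass at most [b ^+ #|Y :\: Q|]. As [Y] is
    bad, its part in [Q] must make up for this. *)
Lemma maximal_bad B z Q Y T : maximal B z Q -> bad Y -> Y \subset B -> Y :&: Q != set0 ->
  T \subset Y :\: Q -> 1 <= b ^+ #|T| * \prod_(x in Q) mu x.
Proof.
move=> [cQ QB zQ mQ] /andP[cY Y1] YB /set0Pn[w] + TY; rewrite inE => /andP[wY wQ].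
have cQY : conn (Q :|: Y) by apply: (connU e_sym cQ cY wQ wY); rewrite eqxx.
have := mQ (Q :|: Y) cQY.
rewrite subUset QB YB inE zQ => /(_ isT isT) H.
have bp n : 0 < b ^+ n by apply: exprn_gt0.
have h1 : \prod_(x in Y :\: Q) mass x <= b ^+ #|Y :\: Q|.
  have : phi (Y :\: Q) <= 1.
    rewrite -(ler_pM2l (phi_gt0 Q)) mulr1 -prod_setU; last first.
      by rewrite -setI_eq0; apply/eqP/setP => x; rewrite !inE; case: (x \in Q).
    suff <- : Q :|: Y = Q :|: (Y :\: Q) by [].
    by apply/setP => x; rewrite !inE; case: (x \in Q).
  by rewrite phiE ler_pdivrMr // mul1r.
have h2 : \prod_(x in Y :&: Q) mass x <= \prod_(x in Q) mu x.
  rewrite (prod_setID mu Q Y) setIC -[leLHS]mulr1; apply: ler_pM => //.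
  - by apply: prodr_ge0 => x _; rewrite ltW // mass_gt0.
  - by apply: ler_prod => x _; rewrite mu_ge_mass ltW // mass_gt0.
  - elim/big_ind: _ => // [x y x1 y1|x _]; last exact: mu_ge1.
    by exact: mulr_ege1.
rewrite (prod_setID _ Y Q) in Y1.
have h3 : b ^+ #|Y :\: Q| <= b ^+ #|T|.
  by apply: ler_wiXn2l => //; [apply: ltW|apply: subset_leq_card].
have m0 A : 0 <= \prod_(x in A) mass x by apply: prodr_ge0 => x _; rewrite ltW // mass_gt0.
apply: le_trans (ltW Y1) _; rewrite mulrC; apply: ler_pM => //.
exact: le_trans h1 h3.
Qed.

Lemma dense_QT B z Q T : maximal B z Q -> z \in badv B -> [disjoint Q & T] ->
  1 <= b ^+ #|T| * \prod_(x in Q) mu x -> dense (Q :|: T).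
Proof.
move=> mQ zB QT hT; have hQ := maximal_heavy mQ zB.
rewrite /dense prod_setU //.
have hE : \prod_(x in Q) (b * mu x ^+ 2) = b ^+ #|Q| * \prod_(x in Q) mu x * \prod_(x in Q) mu x.
  by rewrite big_split /= prodr_const prodrXl expr2 mulrA.
have hT2 : b ^+ #|T| <= \prod_(x in T) (b * mu x ^+ 2).
  rewrite -prodr_const; apply: ler_prod => x _; rewrite ltW //=.
  by rewrite ler_peMr ?(ltW b0) // exprn_ege1 // mu_ge1.
have p0 : 0 <= \prod_(x in Q) mu x by apply: prodr_ge0 => x _; apply: le_trans (mu_ge1 x).
rewrite hE; apply: (@le_trans _ _ (b ^+ #|Q| * \prod_(x in Q) mu x * (b ^+ #|T| * \prod_(x in Q) mu x))).
  by exact: mulr_ege1.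
rewrite -[leRHS]mulrA ler_wpM2l //; first by apply: le_trans hQ.
by rewrite mulrC ler_wpM2l.
Qed.

(* A vertex of [B] next to the block of [x] that is not bad any more in [B :\: Q]
   lies in a bad set meeting [Q]; [T] is taken inside that set. *)
Lemma connector B z Q x : conn B -> (forall y, y \in B -> y \in badv B) ->
  maximal B z Q -> x \in badv (B :\: Q) ->
  exists T z2, [/\ T \subset B :\: Q, [disjoint T & block (B :\: Q) x],
    z2 \in block (B :\: Q) x, conn (z2 |: (Q :|: T)) &
    1 <= b ^+ #|T| * \prod_(x in Q) mu x].
Proof.
move=> cB allbad mQ xU; have [cQ QB zQ _] := mQ.
set S := B :\: Q; set B2 := block S x.
have xS : x \in S := subsetP (badv_sub e D a S) _ xU.
have B2S : B2 \subset S by apply: block_sub.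
have xB2 : x \in B2 by apply: block_refl.
have B2U y : y \in B2 -> y \in badv S.
  by move=> /(block_cases)[->|[]].
have [_ cutB] := connP _ _ cB.
have [w [y [wB2 yB yB2 ewy]]] : exists w y, [/\ w \in B2, y \in B, y \notin B2 & e w y].
  apply: cutB; first by apply: subset_trans B2S (subsetDl _ _).
    by apply/set0Pn; exists x.
  apply: contraTneq zQ => B2B; have zB := subsetP QB z.
  by apply/negP => zQ; have := subsetP B2S z; rewrite B2B zB // inE zQ => /(_ isT).
have [Y [YB YQ yQY T1]] : exists Y, [/\ Y \subset B, conn (Q :|: Y), y \in Q :|: Y &
    forall T, T \subset Y :\: Q -> 1 <= b ^+ #|T| * \prod_(x in Q) mu x].
  have [yQ|yQ] := boolP (y \in Q).
    exists set0; rewrite sub0set setU0; split => // T; rewrite set0D subset0 => /eqP->.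
    rewrite cards0 mul1r; elim/big_ind: _ => // [u v u1 v1|u _]; last exact: mu_ge1.
    by exact: mulr_ege1.
  have yS : y \in S by rewrite inE yQ.
  have yU : y \notin badv S.
    apply: contra yB2 => yU; apply: (block_step wB2).
    by rewrite /bade /= yU B2U.
  have /badvP[Y [bY YB yY]] := allbad y yB.
  have YQ : Y :&: Q != set0.
    apply: contra yU => /eqP YQ0; apply/badvP; exists Y; split => //.
    by rewrite subsetD YB -setI_eq0 YQ0 eqxx.
  exists Y; split => //; last by move=> T TY; apply: (maximal_bad mQ bY YB YQ TY).
    case/set0Pn: YQ => v; rewrite inE => /andP[vY vQ].
    by case/andP: bY => cY _; apply: (connU e_sym cQ cY vQ vY); rewrite eqxx.
  by rewrite inE yY orbT.
(* The part of [Q :|: Y] outside the next block. The component of [Q] in it reaches that block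
   without entering it: an edge leaving the component elsewhere would enlarge it. *)
pose D0 := Q :|: (Y :\: B2).
pose P (C0 : {set V}) := [&& conn C0, Q \subset C0 & C0 \subset D0].
have PQ : P Q by rewrite /P cQ subxx subsetUl.
have [C0 /maxsetP[/and3P[cC QC CD] maxC] _] := maxset_exists PQ.
have QB2 v : v \in Q -> v \notin B2.
  by move=> vQ; apply/negP => /(subsetP B2S); rewrite inE vQ.
have [c [z2 [cC0 z2B2 ecz]]] : exists c z2, [/\ c \in C0, z2 \in B2 & e c z2].
  have cX : conn ((Q :|: Y) :|: [set w]).
    apply: (connU e_sym YQ (conn1 e w) yQY (set11 w)); by rewrite e_sym ewy orbT.
  have [_ cutX] := connP _ _ cX.
  have wC0 : w \notin C0.
    apply/negP => /(subsetP CD); rewrite in_setU in_setD wB2 orbF => /QB2.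
    by rewrite wB2.
  have [] := cutX C0.
  - apply/subsetP => v /(subsetP CD); rewrite 3!in_setU in_setD.
    by move=> /orP[->//|/andP[_ ->]]; rewrite orbT.
  - by apply: conn_neq0 cC.
  - by apply: contraNneq wC0 => ->; rewrite !inE eqxx orbT.
  move=> c [v [cC0 vX vC ecv]]; exists c, v; split => //.
  apply: contraT => vB2; case/negP: vC.
  have vD : v \in D0.
    move: vX; rewrite /D0 3!in_setU in_setD in_set1.
    move=> /orP[/orP[->//|vY]|/eqP vw]; first by rewrite vB2 vY orbT.
    by rewrite vw wB2 in vB2.
  have Pv : P (C0 :|: [set v]).
    apply/and3P; split.
    - by apply: (connU e_sym cC (conn1 e v) cC0 (set11 v)); rewrite ecv orbT.
    - by apply: subset_trans QC (subsetUl _ _).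
    - by rewrite subUset CD sub1set.
  by rewrite -(maxC _ Pv (subsetUl _ _)) !inE eqxx orbT.
exists (C0 :\: Q), z2.
have CE : Q :|: (C0 :\: Q) = C0.
  by apply/setP => v; rewrite !inE; have := subsetP QC v; case: (v \in Q) => // ->.
have TYQ : C0 :\: Q \subset Y :\: Q.
  apply/subsetP => v; rewrite !inE => /andP[vQ vC]; rewrite vQ.
  by have := subsetP CD v vC; rewrite in_setU (negbTE vQ) /= in_setD => /andP[].
split => //.
- by apply: subset_trans TYQ _; apply: setSD.
- rewrite -setI_eq0; apply/eqP/setP => v; rewrite in_set0; apply/negP.
  rewrite inE => /andP[]; rewrite inE => /andP[vQ vC] vB2.
  have := subsetP CD v vC; rewrite in_setU (negbTE vQ) /= in_setD => /andP[].
  by rewrite vB2.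
- rewrite CE setUC; apply: (connU e_sym cC (conn1 e z2) cC0 (set11 z2)).
  by rewrite ecz orbT.
- exact: T1.
Qed.

Lemma poincare_le A (K K' : R) : K <= K' -> poincare A K -> poincare A K'.
Proof.
move=> KK PA h f; apply: le_trans (PA h f) _; rewrite ler_wpM2r // sumr_ge0 // => v _.
by apply: avg_ge0 => s _; apply: varf_ge0.
Qed.

Lemma wtsU A B : [disjoint A & B] -> wts (A :|: B) = (wts A + wts B)%N.
Proof. by move=> AB; rewrite /wts -bigU //; apply: eq_bigl => x; rewrite !inE. Qed.

(* [Y] is the union of the sets removed so far and of the connections between
   them; being dense, it satisfies [wts Y <= M]. *)
Lemma poincare_block B Y z : full B -> conn B -> (forall y, y \in B -> y \in badv B) ->
  z \in B -> conn (z |: Y) -> [disjoint Y & B] -> dense Y ->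
  poincare B (((2 * cost) ^ (M - wts Y))%:R).
Proof.
have [n] := ubnP #|B|; elim: n B Y z => // n IH B Y z Bn fB cB allbad zB cY YB dY.
have [Q mQ] := maximal_exists zB; have [cQ QB zQ _] := mQ.
have zU := allbad z zB.
have Q0 : Q != set0 := conn_neq0 cQ.
have lowQ := maximal_low mQ.
have YQ : [disjoint Y & Q] by apply: disjointWr YB.
have cost0 : (0 < cost)%N by rewrite muln_gt0 expn_gt0 (C_gt0 DC).
have dYU T : [disjoint Q & T] -> [disjoint Y & Q :|: T] ->
    1 <= b ^+ #|T| * \prod_(x in Q) mu x -> dense (Y :|: (Q :|: T)).
  move=> QT YQT hT; have h1 := dense_QT mQ zU QT hT.
  by rewrite /dense prod_setU //; apply: mulr_ege1.
(* [Y] is empty at the start, so the invariant makes it connected only together with [z]; as [z]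
   lies in [Q], adding [Q] keeps this link. *)
have cYQ : conn (Y :|: Q).
  have -> : Y :|: Q = (z |: Y) :|: Q.
    by apply/setP => v; rewrite !inE; case: eqP => [->|]; rewrite ?zQ ?orbT.
  by apply: (connU e_sym cY cQ (setU11 _ _) zQ); rewrite eqxx.
(* [Y :|: Q] is connected and dense, so the truncated subtractions in the exponents are genuine. *)
have hM : (wts Y + wts Q <= M)%N.
  rewrite -wtsU //; apply: dense_small => //.
  have := dYU set0; rewrite setU0; apply => //; first by rewrite -setI_eq0 setI0.
  rewrite cards0 mul1r; elim/big_ind: _ => // [u v u1 v1|u _]; last exact: mu_ge1.
  by exact: mulr_ege1.
set S := B :\: Q.
pose K2 : R := ((2 * cost) ^ (M - (wts Y + wts Q)))%:R.
have K2_ge1 : 1 <= K2.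
  by rewrite (ler_nat R 1) expn_gt0 muln_gt0 cost0.
have fS : full S.
  move=> y; rewrite inE => /andP[yQ yB] hy; apply/subsetP => v; rewrite inE => eyv.
  have vB : v \in B by apply: (subsetP (fB y yB hy)); rewrite inE.
  rewrite inE vB andbT; apply: contra hy => vQ; apply: (lowQ v y vQ); last by rewrite e_sym.
  by rewrite inE yQ.
have PS : poincare S (2 * K2).
  apply: (poincare_blocks e_sym e_irr DC a0 a1 aD beta0 beta_le eps_le epsD sparse fS).
    exact: le_trans K2_ge1.
  move=> x xS; have [xU|xU] := boolP (x \in badv S); last first.
    suff -> : block S x = [set x] by apply: poincare1.
    apply/setP => y; rewrite in_set1; apply/idP/eqP => [/block_cases[//|[_]]|->].
      by rewrite (negbTE xU).
    exact: block_refl.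
  have [T [z2 [TS TB2 z2B2 cT hT]]] := connector cB allbad mQ xU.
  set B2 := block S x in TB2 z2B2 *.
  have B2S : B2 \subset S by apply: block_sub.
  have QT : [disjoint Q & T].
    rewrite disjoint_sym; apply: disjointWl TS _.
    by rewrite -setI_eq0; apply/eqP/setP => v; rewrite !inE; case: (v \in Q); rewrite ?andbF.
  have SB : S \subset B by apply: subsetDl.
  have YT : [disjoint Y & T] by apply: disjointWr YB; apply: subset_trans TS SB.
  have YQT : [disjoint Y & Q :|: T] by rewrite disjoint_sym; apply: disjU; rewrite disjoint_sym.
  have := IH B2 (Y :|: (Q :|: T)) z2.
  move=> H; apply: poincare_le (H _ _ _ _ _ _ _ _) => {H}.
  - rewrite /K2 ler_nat; apply: leq_pexp2l; first by rewrite muln_gt0.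
    by apply: leq_sub2l; rewrite !wtsU // addnA leq_addr.
  - move: Bn; rewrite ltnS; apply: leq_trans; apply: proper_card.
    apply: sub_proper_trans B2S _; rewrite properEneq SB andbT.
    by apply: contraTneq zB => <-; rewrite inE zQ.
  - by apply: full_block.
  - by apply: block_conn.
  - move=> y yB2; have yU : y \in badv S by case: (block_cases yB2) => [->|[]].
    case/badvP: yU => Y' [bY' Y'S yY']; apply/badvP; exists Y'; split => //.
    by rewrite /B2 -(block_eq e_sym yB2); apply: bad_block.
  - exact: z2B2.
  - have -> : z2 |: (Y :|: (Q :|: T)) = (Y :|: Q) :|: (z2 |: (Q :|: T)).
      by apply/setP => v; rewrite !inE; do !case: (_ \in _); rewrite ?orbT.
    by apply: (connU e_sym cYQ cT (x := z) (z := z)); rewrite ?inE ?zQ ?orbT ?eqxx.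
  - apply: disjU; first by apply: disjointWr YB; apply: subset_trans B2S SB.
    apply: disjU => //; apply: disjointWr B2S _.
    by rewrite -setI_eq0; apply/eqP/setP => v; rewrite !inE; case: (v \in Q); rewrite ?andbF.
  - exact: dYU.
have k1 : 1 <= 2 * K2 by lra.
apply: poincare_le (poincare_remove e_sym e_irr DC sparse fB QB Q0 lowQ k1 PS).
rewrite /K2 -natrM -natrM ler_nat.
have -> : (M - wts Y = wts Q + (M - (wts Y + wts Q)))%N by move: hM; clear; lia.
(* The factor 2 from the block dynamics is absorbed by [2 ^ wts Q], since [wts Q] is positive. *)
rewrite expnD mulnA leq_mul2r; apply/orP; right; rewrite expnMn mulnC leq_mul2r; apply/orP; right.
rewrite -[leqLHS]expn1 leq_pexp2l //.
by rewrite wtsE addn_gt0 card_gt0 Q0.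
Qed.

End BlockRecursion.

(** * The Poincare inequality on sparse graphs *)

Section Deterministic.
Variables (R : realType) (V C : finType) (e : rel V).
Hypotheses (e_sym : symmetric e) (e_irr : irreflexive e).
Variables (A M : nat).
Local Notation nbr := (nbr e).
Local Notation conn := (conn e).
Local Notation wts := (wts e).
Implicit Types (Y K : {set V}).

Definition few_edges := forall Y, conn Y -> (A * #|Y| <= wts Y)%N -> (wts Y <= M)%N.
Definition locally_sparse := forall K, K != set0 -> (#|K| <= M)%N ->
  exists2 x, x \in K & (#|nbr x :&: K| <= 3)%N.

Hypotheses (A0 : (0 < A)%N) (AC : (2 ^ (24 * A + 2) <= #|C|)%N)
  (few : few_edges) (sparseM : locally_sparse).

Let D := (2 ^ (8 * A))%N.
(** With this [b], density of [Y] forces [2 ^ (4 A #|Y|) <= 16 ^ wts Y], that is, average weight at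
    least [A]. Then [D] is [1 / a]. *)
Let b : R := 2^-1 ^+ (4 * A).
Let a : R := b ^+ 2.

Lemma b_gt0 : 0 < b. Proof. by rewrite exprn_gt0 // invr_gt0. Qed.
Lemma b_le1 : b <= 1.
Proof. by apply: exprn_ile1; rewrite ?invr_ge0 // invf_le1 // ler1n. Qed.
Lemma a_gt0 : 0 < a. Proof. by rewrite exprn_gt0 // b_gt0. Qed.
Lemma a_le1 : a <= 1.
Proof. by rewrite exprn_ile1 ?b_le1 // ltW // b_gt0. Qed.

Lemma aDE : a * D%:R = 1.
Proof.
have n0 : 2 ^+ (8 * A) != 0 :> R by rewrite expf_eq0 pnatr_eq0 andbF.
by rewrite /a /b -exprM mulnAC /D natrX exprVn mulVf.
Qed.

(** [2 ^ (24 * A + 2)] is [4 D^3]; the term [2 D^3] is what [D <= eps (#|C| - D)] requires when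
    [eps = a^2 / 2]. *)
Lemma DC : (D + 2 * D * D * D <= #|C|)%N.
Proof.
have DE : (2 ^ (24 * A + 2) = D * D * D * 2 ^ 2)%N.
  by rewrite /D -!expnD; congr (2 ^ _)%N; lia.
apply: leq_trans AC; rewrite DE.
have : (0 < D)%N by rewrite expn_gt0.
rewrite (_ : 2 ^ 2 = 4)%N //; move: D => d; clear => d0.
have : (d <= d * d * d)%N by rewrite -mulnA leq_pmulr // muln_gt0 d0.
by lia.
Qed.

Lemma DC2 : (2 * D + 2 <= #|C|)%N.
Proof.
apply: leq_trans DC.
have : (2 <= D)%N by rewrite -[leqLHS]expn1 leq_pexp2l // muln_gt0.
move: D => d; clear => d2.
have : (2 * 2 * 2 <= 2 * d * d)%N by rewrite !leq_mul.
have : (2 * 2 * d <= 2 * d * d)%N by rewrite leq_mul2r orbC leq_mul2l d2.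
have : (2 * d * d * 2 <= 2 * d * d * d)%N by rewrite leq_mul2l d2 orbT.
by lia.
Qed.

Lemma wt_le2 x : ((wt e x)%:R : R) <= 2 ^+ wt e x.
Proof. by rewrite -natrX ler_nat ltnW // ltn_expl. Qed.

(** [mu x] is [wt x] at a low vertex and [wt x * D] at a high one, where [D = 2 ^ (8 * A)] is at
    most [2 ^ wt] because [8 * A < D < wt]. In both cases [mu x <= 4 ^ wt]. *)
Lemma dense_factor x : b * mu e D a x ^+ 2 <= b * 16 ^+ wt e x.
Proof.
rewrite ler_pM2l ?b_gt0 // /mu /mass.
have w2 := wt_le2 x.
have E16 : 16 ^+ wt e x = (2 ^+ wt e x * 2 ^+ wt e x) ^+ 2 :> R.
  rewrite (_ : 16 = (2 * 2) ^+ 2 :> R); last by ring.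
  by rewrite -exprM mulnC exprM exprMn.
have p1 : 1 <= 2 ^+ wt e x :> R by rewrite exprn_ege1 // ler1n.
case: ifPn => hx.
  rewrite mulrC mulKf ?gt_eqF ?a_gt0 // E16 ler_pXn2r ?nnegrE ?mulr_ge0 ?exprn_ge0 //.
  by rewrite -[leLHS]mulr1; apply: ler_pM.
rewrite E16 ler_pXn2r ?nnegrE ?mulr_ge0 ?exprn_ge0 ?invr_ge0 ?(ltW a_gt0) //.
apply: ler_pM; [by []|by rewrite invr_ge0 (ltW a_gt0)|exact: w2|].
have an0 : a != 0 by rewrite gt_eqF // a_gt0.
have -> : a^-1 = D%:R by apply: (mulfI an0); rewrite mulfV // aDE.
rewrite /D natrX; apply: ler_weXn2l; rewrite ?ler1n //.
apply: (@leq_trans D); first by rewrite /D ltnW // ltn_expl.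
by move: hx; rewrite /low -ltnNge => /ltnW.
Qed.

Lemma dense_wts Y : dense e D a b Y -> (A * #|Y| <= wts Y)%N.
Proof.
move=> dY; have : 1 <= \prod_(x in Y) (b * 16 ^+ wt e x).
  apply: le_trans dY _; apply: ler_prod => x _; rewrite dense_factor andbT.
  by rewrite mulr_ge0 ?(ltW b_gt0) // sqr_ge0.
rewrite big_split /= prodr_const -expr_sum -/(wts Y) /b -exprM exprVn mulrC.
rewrite ler_pdivlMr ?exprn_gt0 // mul1r.
rewrite (_ : 16 = 2 ^+ 4 :> R); last by ring.
rewrite -exprM ler_eXn2l ?ltr1n // -mulnA leq_mul2l //.
Qed.

(** A component of [K] is connected with average weight above [D], so it has at most [M] vertices
    and [sparseM] applies to it. Neighbors in [K] of its vertices belong to the same component. *)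
Lemma sparse_high K : K != set0 -> (forall x, x \in K -> ~~ low e D x) ->
  exists2 x, x \in K & (#|nbr x :&: K| + 2 <= #|C|)%N.
Proof.
case/set0Pn => x0 x0K hK.
pose P (Y : {set V}) := [&& conn Y, x0 \in Y & Y \subset K].
have P0 : P [set x0] by rewrite /P conn1 set11 sub1set x0K.
have [Y /maxsetP[/and3P[cY x0Y YK] maxY] _] := maxset_exists P0.
have hA : (A * #|Y| <= wts Y)%N.
  rewrite mulnC -sum_nat_const; apply: leq_sum => x xY.
  have := hK x (subsetP YK _ xY); rewrite /low -ltnNge => /ltnW; apply: leq_trans.
  apply: (@leq_trans (8 * A)); first by rewrite leq_pmull.
  by rewrite ltnW // ltn_expl.
have wM := few cY hA.
have YM : (#|Y| <= M)%N by apply: leq_trans wM; rewrite wtsE leq_addr.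
have [x xY dx] := sparseM (conn_neq0 cY) YM.
exists x; first exact: subsetP YK _ xY.
apply: (@leq_trans 5).
  rewrite (leq_add2r 2 _ 3); apply: leq_trans dx; apply: subset_leq_card.
  apply/subsetP => y; rewrite !inE => /andP[exy yK]; rewrite exy /=.
  have Py : P (Y :|: [set y]).
    rewrite /P !inE x0Y subUset YK sub1set yK !andbT.
    by apply: (connU e_sym cY (conn1 e y) xY (set11 y)); rewrite exy orbT.
  by rewrite -(maxY _ Py (subsetUl _ _)) !inE eqxx orbT.
apply: leq_trans AC; apply: (@leq_trans (2 ^ 3)) => //; apply: leq_pexp2l => //.
by move: A0; clear; lia.
Qed.

Lemma full_setT : full e D [set: V].
Proof. by move=> x _ _; apply: subsetT. Qed.

Lemma colorable (h : {ffun V -> C}) : exists s, s \in OmB e setT h.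
Proof. exact: (OmB_nonempty e_sym e_irr DC2 sparse_high h full_setT). Qed.

(** The outer factor 2 comes from block dynamics on the whole vertex set; in each block the
    recursion starts with nothing removed. *)
Theorem poincare_all : @poincare R V C e setT (2 * ((2 * cost C) ^ M)%:R).
Proof.
have beta0 : 0 <= a / 2 by rewrite divr_ge0 // ltW // a_gt0.
have beta_le : 2 * (a / 2) <= a by rewrite mulrC mulfVK ?pnatr_eq0.
have eps_le : a * (a / 2) <= a * (a / 2) by [].
have epsD : D%:R <= a * (a / 2) * (#|C| - D)%:R.
  have h : (2 * D * D * D <= #|C| - D)%N by rewrite leq_subRL ?DC // (leq_trans _ DC) // leq_addr.
  apply: (@le_trans _ _ (a * (a / 2) * (2 * D * D * D)%:R)); last first.
    by rewrite ler_wpM2l ?ler_nat // mulr_ge0 // ltW // a_gt0.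
  rewrite !natrM (_ : a * _ * _ = (a * D%:R) * (a * D%:R) * D%:R); last by field.
  by rewrite aDE !mul1r.
have aD1 : 1 <= a * D%:R by rewrite aDE.
have fT := full_setT.
apply: (poincare_blocks e_sym e_irr DC2 a_gt0 a_le1 aD1 beta0 beta_le eps_le epsD sparse_high fT) => //.
move=> x _.
have c1 : (0 < 2 * cost C)%N.
  by rewrite /cost !muln_gt0 ?expn_gt0 (C_gt0 DC2).
have [xU|xU] := boolP (x \in badv e D a setT); last first.
  suff -> : block e D a setT x = [set x].
    by apply: poincare1; rewrite (ler_nat R 1) expn_gt0 c1.
  apply/setP => y; rewrite in_set1; apply/idP/eqP => [/block_cases[//|[_]]|->].
    by rewrite (negbTE xU).
  exact: block_refl.
have dsmall Y : conn Y -> dense e D a b Y -> (wts Y <= M)%N.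
  by move=> cY dY; apply: few => //; apply: dense_wts.
have := @poincare_block R V C e e_sym e_irr D a b (a / 2) (a * (a / 2)) DC2 a_gt0 a_le1
  aD1 beta0 beta_le eps_le epsD b_gt0 b_le1 (erefl _) sparse_high M dsmall
  (block e D a setT x) set0 x.
rewrite /wts big_set0 subn0; apply.
- by apply: full_block => //; [exact: a_gt0|exact: a_le1].
- exact: block_conn.
- move=> y yB; have yU : y \in badv e D a setT by case: (block_cases yB) => [->|[]].
  case/badvP: yU => Y [bY YS yY]; apply/badvP; exists Y; split => //.
  by rewrite -(block_eq e_sym yB); apply: bad_block.
- exact: block_refl.
- by rewrite setU0 conn1.
- by rewrite -setI_eq0 set0I.
- by rewrite /dense big_set0.
Qed.

End Deterministic.

(** * From the Poincare inequality to mixing *)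

Section Mixing.
Variables (R : realType) (V C : finType) (G : {set {set V}}).
Hypotheses (GE : G \subset potential_edges V) (V0 : (0 < #|V|)%N).
Variable K : nat.

Definition adj : rel V := [rel v w | [set v; w] \in G].

Hypothesis K0 : (0 < K)%N.
Hypothesis poincareK : @poincare R V C adj setT K%:R.

Lemma adj_sym : symmetric adj.
Proof. by move=> v w; rewrite /adj /= setUC. Qed.

Lemma adj_irr : irreflexive adj.
Proof.
move=> v; apply/negP; rewrite /adj /= => /(subsetP GE).
by rewrite inE setUid cards1.
Qed.

Lemma neighborsE v : neighbors G v = nbr adj v.
Proof. by apply/setP => w; rewrite !inE. Qed.

Local Notation T := {: coloring C G}.

Lemma proper_OmB (h s : {ffun V -> C}) : (s \in OmB adj setT h) = proper_coloring G s.
Proof.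
apply/OmBP/forallP => [[_ H] u|H]; first by apply/forall_inP => v; rewrite inE; apply: H.
split => [x|x y _ exy]; first by rewrite inE.
by have /forall_inP := H x; apply; rewrite inE.
Qed.

Variable h0 : {ffun V -> C}.
Local Notation X := (OmB adj setT h0).
Definition site (v : V) : {ffun V -> C} -> {set {ffun V -> C}} := OmB adj [set v].
Local Notation P := (mix site).

Lemma site_classes v : classes X (site v).
Proof. exact: OmB_classes adj_sym _ _ _ (subsetT _). Qed.

Lemma coloring_mem (x : coloring C G) : val x \in X.
Proof. by rewrite proper_OmB (valP x). Qed.

Lemma card_coloring : #|T| = #|X|.
Proof.
rewrite card_sig; apply: eq_card => s; rewrite proper_OmB; by [].
Qed.

Lemma sum_coloring (F : {ffun V -> C} -> R) : \sum_(x : coloring C G) F (val x) = \sum_(s in X) F s.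
Proof.
rewrite (eq_bigl (mem [pred s | proper_coloring G s])); last by move=> s; rewrite proper_OmB.
by rewrite [RHS]big_sub; apply: eq_bigr.
Qed.

(** Extension to all configurations, so that [mix] applies. The default 0 is never seen, since site
    updates of proper colorings are proper. *)
Definition ext (g : coloring C G -> R) (s : {ffun V -> C}) : R :=
  if insub s is Some x then g x else 0.

Lemma extE g x : ext g (val x) = g x.
Proof. by rewrite /ext valK. Qed.

Lemma site_available (x : coloring C G) v :
  site v (val x) = recolor (val x) v @: available G (val x) v.
Proof.
apply/setP => s; apply/OmBP/imsetP => [[h1 h2]|[c cA ->]].
  exists (s v); last first.
    apply/ffunP => w; rewrite ffunE; case: eqP => [->//|/eqP wv].
    by rewrite h1 // inE.
  rewrite inE neighborsE; apply/imsetP => -[w]; rewrite inE => evw sw.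
  have wv : w \notin [set v].
    by rewrite inE; apply: contraTneq evw => ->; rewrite adj_irr.
  have := h2 v w (set11 v) evw; rewrite (h1 w wv) sw; by rewrite eqxx.
split => [w|w u]; rewrite inE => wv; first by rewrite ffunE (negbTE wv).
move=> ewu; rewrite (eqP wv) in ewu *; rewrite !ffunE eqxx.
have uv : u != v by apply: contraTneq ewu => ->; rewrite adj_irr.
rewrite (negbTE uv); apply: contraTneq cA => ->.
by rewrite inE negbK neighborsE; apply: imset_f; rewrite inE.
Qed.

Lemma gibbs_mix (g : coloring C G -> R) x :
  \sum_y gibbs R x y * g y = P (ext g) (val x).
Proof.
rewrite /mix /gibbs mulr_sumr.
under eq_bigr do rewrite mulr_suml.
rewrite exchange_big /=; apply: eq_bigr => v _.
under eq_bigr do rewrite -mulrA.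
rewrite -mulr_sumr; congr (_ * _).
have E := site_available x v; rewrite /= in E.
rewrite /proj /avg E card_imset; last exact: recolor_inj.
rewrite big_imset /=; last by move=> c d _ _; apply: recolor_inj.
rewrite mulr_suml; under eq_bigr do rewrite mulr_suml.
rewrite exchange_big /=; apply: eq_bigr => c cA.
under eq_bigr do rewrite -mulrA.
rewrite -mulr_sumr mulrC; congr (_ * _).
have sX : recolor (val x) v c \in X.
  have := OmB_sub adj_sym (subsetT [set v]) (coloring_mem x).
  by move/subsetP; apply; rewrite -/(site v) site_available; apply: imset_f.
rewrite proper_OmB in sX.
pose z : coloring C G := exist _ (recolor (val x) v c) sX.
rewrite (bigD1 z) //= eqxx mul1r big1 ?addr0; first by rewrite -(extE g z).
by move=> y; rewrite -val_eqE /= => /negbTE ->; rewrite mul0r.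
Qed.

Lemma mix_eq (f1 f2 : {ffun V -> C} -> R) : {in X, f1 =1 f2} -> {in X, P f1 =1 P f2}.
Proof.
move=> f12 s sX; rewrite /mix; congr (_ * _); apply: eq_bigr => v _.
apply: eq_avg => t tv; apply: f12.
by have [_ H] := site_classes v sX; case: (H t tv).
Qed.

Lemma iter_mix_eq t (f1 f2 : {ffun V -> C} -> R) : {in X, f1 =1 f2} -> {in X, iter t P f1 =1 iter t P f2}.
Proof. by move=> f12; elim: t => //= t IH; apply: mix_eq. Qed.

Lemma transition_mix t (g : coloring C G -> R) x :
  \sum_y transition (@gibbs R V C G) t x y * g y = iter t P (ext g) (val x).
Proof.
elim: t g x => [|t IH] g x /=.
  rewrite (bigD1 x) //= eqxx mul1r big1 ?addr0 ?extE // => y yx.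
  by rewrite eq_sym (negbTE yx) mul0r.
under eq_bigr do rewrite mulr_suml.
rewrite exchange_big /=.
under eq_bigr do under eq_bigr do rewrite -mulrA.
under eq_bigr do rewrite -mulr_sumr.
rewrite IH -iterS iterSr; apply: iter_mix_eq; last exact: coloring_mem.
move=> s sX; rewrite proper_OmB in sX.
pose z : coloring C G := exist _ s sX.
by rewrite -[s]/(val z) extE gibbs_mix.
Qed.

Local Notation rho := (1 - (#|V| * K)%:R^-1 : R).

Lemma rho_ge0 : 0 <= rho.
Proof. by rewrite subr_ge0 invf_le1 ?ler1n ?ltr0n // muln_gt0 V0. Qed.

(** The second moment of [P f] is at most [<< P f, f >>], which is that of [f] minus the Dirichlet
    form; the Poincare inequality bounds the latter from below. *)
Lemma varf_mix (f : {ffun V -> C} -> R) : varf X (P f) <= rho * varf X f.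
Proof.
have [X0|[s0 s0X]] := set_0Vmem X.
  by rewrite /varf /avg X0 !big_set0 !mul0r mulr0.
have Xp := natr_card_gt0 R s0X.
have h1 := @mix_sqr_le R _ V X site site_classes V0 f.
have h2 := @dirichlet_mix R _ V X site site_classes V0 f.
have h3 := poincareK h0 f.
rewrite -(ler_pM2l Xp) !(varfE _ s0X) (avg_mix site_classes V0 f) mulrCA.
rewrite !mulrBr -!(avgM _ s0X).
have n0 : 0 < #|V|%:R :> R by rewrite ltr0n.
have k0 : 0 < K%:R :> R by rewrite ltr0n.
have h4 : (#|V| * K)%:R^-1 * (#|X|%:R * varf X f) <= #|V|%:R^-1 * \sum_v \sum_(s in X) varf (site v s) f.
  rewrite natrM invfM -mulrA ler_pM2l ?invr_gt0 // ler_pdivrMl //.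
  have -> : \sum_v \sum_(s in X) varf (site v s) f = #|X|%:R * \sum_v avg X (fun s => varf (site v s) f).
    by rewrite mulr_sumr; apply: eq_bigr => v _; rewrite (avgM _ s0X).
  rewrite [leRHS]mulrCA ler_pM2l //; apply: le_trans h3 _; rewrite ler_pM2l //.
  by rewrite le_eqVlt; apply/orP; left; apply/eqP; apply: eq_bigl => v; rewrite inE.
rewrite (varfE _ s0X) mulrBr -(avgM _ s0X) h2 in h4.
have e1 : \sum_(s in X) P f s ^+ 2 = \sum_(s in X) P f s * P f s.
  by apply: eq_bigr => s _; rewrite expr2.
have e2 : \sum_(s in X) f s ^+ 2 = \sum_(s in X) f s * f s.
  by apply: eq_bigr => s _; rewrite expr2.
rewrite e1 e2; rewrite e2 in h4.
by move: h1 h4; rewrite mulrBl mul1r; lra.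
Qed.

Lemma varf_iter t (f : {ffun V -> C} -> R) : varf X (iter t P f) <= rho ^+ t * varf X f.
Proof.
elim: t => [|t IH]; first by rewrite mul1r.
rewrite iterS exprS -mulrA; apply: le_trans (varf_mix _) _.
by rewrite ler_wpM2l // rho_ge0.
Qed.

(** The distance is tested against the sign of the difference. At a single point the squared
    deviation from the mean is at most [#|X|] times the variance, which has decayed by
    [rho ^+ t]. *)
Lemma tv_le t x :
  tv_distance (transition (@gibbs R V C G) t x) (@coloring_distribution R V C G) ^+ 2 <=
    4^-1 * #|X|%:R * rho ^+ t.
Proof.
pose d y := transition (@gibbs R V C G) t x y - @coloring_distribution R V C G y.
pose sg y : R := if 0 <= d y then 1 else -1.
have sgE y : `|d y| = d y * sg y.
  rewrite /sg; case: ifPn => dy; first by rewrite ger0_norm // mulr1.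
  by rewrite ltr0_norm ?mulrN1 // ltNge.
have xX := coloring_mem x.
have Xp := natr_card_gt0 R xX.
have e1 : \sum_y `|d y| = iter t P (ext sg) (val x) - avg X (ext sg).
  rewrite -transition_mix.
  have -> : avg X (ext sg) = \sum_y @coloring_distribution R V C G y * sg y.
    rewrite /coloring_distribution -mulr_sumr card_coloring /avg mulrC; congr (_ * _).
    by rewrite -sum_coloring; apply: eq_bigr => y _; rewrite extE.
  by rewrite -sumrB; apply: eq_bigr => y _; rewrite sgE /d mulrBl.
have e2 : (\sum_y `|d y|) ^+ 2 <= #|X|%:R * varf X (iter t P (ext sg)).
  have av : avg X (iter t P (ext sg)) = avg X (ext sg).
    by elim: (t) => //= n IH; rewrite (avg_mix site_classes V0).
  rewrite e1 -av /varf -(avgM _ xX) (bigD1 (val x)) //= lerDl.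
  by apply: sumr_ge0 => s _; apply: sqr_ge0.
have e3 : varf X (ext sg) <= 1.
  rewrite (varfE _ xX) -[leRHS](avg_cst 1 xX) lerBlDr.
  apply: (@le_trans _ _ (avg X (fun=> 1))); last by rewrite lerDl sqr_ge0.
  apply: le_avg => s sX; rewrite proper_OmB in sX.
  pose z : coloring C G := exist _ s sX.
  rewrite -[s]/(val z) extE /sg.
  by case: ifP => _; rewrite ?sqrrN expr1n.
rewrite /tv_distance exprMn -/(d _) -mulrA exprVn (_ : 2 ^+ 2 = 4 :> R); last by ring.
rewrite ler_pM2l ?invr_gt0 //; apply: le_trans e2 _; rewrite ler_pM2l //.
apply: le_trans (varf_iter _ _) _; rewrite ler_piMr // exprn_ge0 // rho_ge0 //.
Qed.

(** Enough steps for [rho] to decay to [exp (- (#|V| #|C| + 2))]: the first term beats the number of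
    colorings, and the 2, with the factor 1/4, leaves the square of [(2 e)^-1]. *)
Definition mix_steps := (#|V| * K * (#|V| * #|C| + 2))%N.

Lemma rho_small : rho ^+ mix_steps <= expR (- (#|V| * #|C| + 2)%:R).
Proof.
have p0 : 0 < (#|V| * K)%:R :> R by rewrite ltr0n muln_gt0 V0.
have h : rho <= expR (- (#|V| * K)%:R^-1) by apply: expR_ge1Dx.
apply: (@le_trans _ _ (expR (- (#|V| * K)%:R^-1) ^+ mix_steps)).
  by rewrite ler_pXn2r ?nnegrE ?rho_ge0 ?expR_ge0 // muln_gt0 muln_gt0 V0 K0 addnS.
rewrite -expRM_natl mulrN /mix_steps natrM [_ * (#|V| * #|C| + 2)%:R]mulrC mulfK //.
by rewrite gt_eqF.
Qed.

Lemma card_colorings_le : (#|X|%:R : R) <= expR (#|V| * #|C|)%:R.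
Proof.
apply: (@le_trans _ _ ((#|C| ^ #|V|)%:R)).
  by rewrite ler_nat -(cardsT V); apply: card_Om_le.
rewrite natrX natrM expRM_natl ler_pXn2r ?nnegrE ?expR_ge0 //.
by apply: le_trans (expR_ge1Dx _); rewrite lerDr.
Qed.

Lemma mixing_time_le :
  (mixing_time (@gibbs R V C G) (@coloring_distribution R V C G) <= (mix_steps%:R)%:E)%E.
Proof.
apply: ge_ereal_inf; exists (mix_steps%:R)%:E => //; exists mix_steps => // x /=.
have tv0 : 0 <= tv_distance (transition (@gibbs R V C G) mix_steps x) (@coloring_distribution R V C G).
  by rewrite /tv_distance mulr_ge0 ?invr_ge0 // sumr_ge0.
have e0 : 0 < expR 1 :> R by apply: expR_gt0.
have e2 : 0 <= (2 * expR 1)^-1 :> R by rewrite invr_ge0 mulr_ge0 // ltW.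
rewrite -(@ler_pXn2r _ 2) ?nnegrE //.
apply: le_trans (tv_le _ _) _.
have h1 := card_colorings_le; have h2 := rho_small.
have X0 : 0 <= #|X|%:R :> R by [].
apply: (@le_trans _ _ (4^-1 * (expR (#|V| * #|C|)%:R * expR (- (#|V| * #|C| + 2)%:R)))).
  rewrite -mulrA ler_pM2l ?invr_gt0 //; apply: ler_pM => //.
  by rewrite exprn_ge0 // rho_ge0.
rewrite -expRD natrD opprD addrA subrr add0r expRN.
rewrite le_eqVlt; apply/orP; left; apply/eqP.
have -> : expR (2%:R) = expR 1 ^+ 2 :> R by rewrite -expRM_natl mulr1.
by field; rewrite gt_eqF.
Qed.

End Mixing.

(** * First moments in G(n, p) *)

Section Gnp.
Variables (R : realType) (n : nat) (p : R).
Hypotheses (p0 : 0 <= p) (p1 : p <= 1).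
Local Notation E := (potential_edges 'I_n).
Implicit Types (G S T : {set {set 'I_n}}) (f : {set {set 'I_n}} -> R).

Definition expect f : R := \sum_(G in powerset E) Gnp_weight p G * f G.

Lemma Gnp_weight_ge0 G : 0 <= Gnp_weight p G.
Proof. by apply: prodr_ge0 => e _; case: ifP; rewrite // subr_ge0. Qed.

Lemma sum_prod_edges (F H : {set 'I_n} -> R) :
  \sum_(G in powerset E) \prod_(e in E) (if e \in G then F e else H e) =
  \prod_(e in E) (F e + H e).
Proof.
(* Off the potential edges the factors 0 and 1 kill every [G] not contained in [E], so the product
   expands over all sets. *)
pose F' e := if e \in E then F e else 0; pose H' e := if e \in E then H e else 1.
rewrite [RHS](_ : _ = \prod_e (F' e + H' e)); last first.
  by rewrite big_mkcond; apply: eq_bigr => e _; rewrite /F' /H'; case: ifP; rewrite ?add0r.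
rewrite bigA_distr [RHS](bigID (mem (powerset E))) /= [X in _ = _ + X]big1 ?addr0.
  apply: eq_bigr => G GE; rewrite big_mkcond; apply: eq_bigr => e _.
  rewrite /F' /H'; case: (boolP (e \in E)) => // eE; case: ifP => // eG.
  by move: GE eE; rewrite powersetE => /subsetP/(_ e eG) ->.
move=> G; rewrite powersetE => /subsetPn[e eG eE].
by rewrite (bigD1 e) //= eG /F' (negbTE eE) mul0r.
Qed.

Lemma expect_1 : expect (fun=> 1) = 1.
Proof.
rewrite /expect; under eq_bigr do rewrite mulr1 /Gnp_weight.
by rewrite (sum_prod_edges (fun=> p) (fun=> 1 - p)) big1 // => e _; ring.
Qed.

Lemma Gnp_markov (A : pred {set {set 'I_n}}) f :
  (forall G, G \subset E -> 0 <= f G) ->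
  (forall G, G \subset E -> A G -> 1 <= f G) -> Gnp_prob p A <= expect f.
Proof.
move=> f0 f1; rewrite /Gnp_prob big_mkcondr; apply: ler_sum => G.
rewrite powersetE => GE; case: ifP => AG.
  by rewrite ler_peMr ?Gnp_weight_ge0 // f1.
by rewrite mulr_ge0 ?Gnp_weight_ge0 // f0.
Qed.

Lemma Gnp_prob_compl (A : pred {set {set 'I_n}}) :
  Gnp_prob p A = 1 - Gnp_prob p (fun G => ~~ A G).
Proof.
have : Gnp_prob p A + Gnp_prob p (fun G => ~~ A G) = 1.
  rewrite -expect_1 /Gnp_prob /expect [RHS](bigID A) /=.
  by congr (_ + _); apply: eq_bigr => G _; rewrite mulr1.
by move=> <-; rewrite addrK.
Qed.

Lemma Gnp_prob_mono (A B : pred {set {set 'I_n}}) :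
  (forall G, G \subset E -> A G -> B G) -> Gnp_prob p A <= Gnp_prob p B.
Proof.
move=> AB; rewrite /Gnp_prob [leLHS]big_mkcondr [leRHS]big_mkcondr; apply: ler_sum => G.
rewrite powersetE => GE; case: ifP => [/(AB _ GE) ->//|_].
by case: ifP => // _; apply: Gnp_weight_ge0.
Qed.

Lemma Gnp_prob_le1 (A : pred {set {set 'I_n}}) : Gnp_prob p A <= 1.
Proof. by rewrite -expect_1; apply: Gnp_markov. Qed.

Lemma expect_sum (I : finType) (P : pred I) (f : I -> {set {set 'I_n}} -> R) :
  expect (fun G => \sum_(i | P i) f i G) = \sum_(i | P i) expect (f i).
Proof. by rewrite /expect exchange_big; apply: eq_bigr => G _; rewrite mulr_sumr. Qed.

Lemma expectZ (k : R) f : expect (fun G => k * f G) = k * expect f.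
Proof. by rewrite /expect mulr_sumr; apply: eq_bigr => G _; rewrite mulrCA. Qed.

(** Independence factorizes the expectation: an edge of [T] must be present and gives [p * lam], any
    other edge of [S] gives [1 - p + p * lam]. The weight [lam] turns lower bounds on edge counts
    into first moments. *)
Lemma expect_tilt S T (lam : R) : 0 <= lam -> T \subset E -> T \subset S ->
  expect (fun G => (T \subset G)%:R * lam ^+ #|G :&: S|) <=
    (p * lam) ^+ #|T| * (1 + p * lam) ^+ #|S :&: E|.
Proof.
move=> l0 TE TS.
pose L e := if e \in S then lam else 1; pose H e : R := if e \in T then 0 else 1.
have L0 e : 0 <= L e by rewrite /L; case: ifP.
have H0 e : 0 <= H e by rewrite /H; case: ifP.
apply: (@le_trans _ _ (\prod_(e in E) (p * L e + (1 - p) * H e))).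
  rewrite -sum_prod_edges; apply: ler_sum => G; rewrite powersetE => GE.
  rewrite (eq_bigr (fun e => (if e \in G then p else 1 - p) * (if e \in G then L e else H e))).
    rewrite big_split /= ler_wpM2l ?Gnp_weight_ge0 //.
    have [TG|_] := boolP (T \subset G); last first.
      by rewrite mul0r; apply: prodr_ge0 => e _; case: ifP.
    rewrite mul1r le_eqVlt; apply/orP; left; apply/eqP.
    rewrite -prodr_const big_mkcond [RHS]big_mkcond; apply: eq_bigr => e _.
    rewrite inE /L /H; have := subsetP GE e; have := subsetP TG e.
    case: (e \in G) => /= [_ /(_ isT) ->//|h _].
    by case: (e \in T) h => [/(_ isT)//|_]; case: ifP.
  by move=> e _; case: ifP.
have pl : 0 <= p * lam by apply: mulr_ge0.
apply: (@le_trans _ _ (\prod_(e in E) ((if e \in T then p * lam else 1) * (if e \in S then 1 + p * lam else 1)))).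
  apply: ler_prod => e eE; apply/andP; split.
    by rewrite addr_ge0 // mulr_ge0 // subr_ge0.
  rewrite /L /H; have := subsetP TS e; case: (e \in T) => [/(_ isT) ->|_].
    by rewrite mulr0 addr0 ler_peMr // lerDl.
  by case: (e \in S); rewrite mulr1 ?mulr1 ?mul1r; move: pl p0; lra.
rewrite big_split /=; apply: ler_pM.
- by apply: prodr_ge0 => e _; case: ifP.
- by apply: prodr_ge0 => e _; case: ifP => // _; lra.
- rewrite -prodr_const big_mkcond [leRHS]big_mkcond le_eqVlt; apply/orP; left; apply/eqP.
  apply: eq_bigr => e _; have := subsetP TE e.
  by case: (e \in T) => [/(_ isT) ->//|_]; case: ifP.
- rewrite -prodr_const big_mkcond [leRHS]big_mkcond le_eqVlt; apply/orP; left; apply/eqP.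
  by apply: eq_bigr => e _; rewrite in_setI andbC; case: (e \in E); case: (e \in S).
Qed.

End Gnp.

(** * Spanning trees coded by traversals *)

Section Programs.
Variables (V : finType).

(* A rooted tree is coded by its depth-first traversal: [Some w] moves to a new
   child [w] of the top of the stack, [None] moves back to the parent. *)
Fixpoint tree_edges (c : seq (option V)) (st : seq V) : seq {set V} :=
  match c, st with
  | Some w :: c', v :: _ => [set v; w] :: tree_edges c' (w :: st)
  | None :: c', _ :: st' => tree_edges c' st'
  | _, _ => [::]
  end.

Definition visits (c : seq (option V)) : seq V := pmap id c.

(** Separates the push and pop pattern from the visited vertices, so that trees with [k] edges can
    be counted as at most [4 ^ k * n ^ k.+1] including the root. *)
Fixpoint decode (b : seq bool) (vs : seq V) : seq (option V) :=
  match b, vs with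
  | true :: b', w :: vs' => Some w :: decode b' vs'
  | false :: b', _ => None :: decode b' vs
  | _, _ => [::]
  end.

Lemma decodeK c : decode (map isSome c) (visits c) = c.
Proof. by elim: c => //= -[w|] c /= ->. Qed.

(** Each edge leads to a vertex outside [vis], the vertices seen so far, so it differs from all
    earlier edges. *)
Lemma tree_edges_uniq c (st vis : seq V) : {subset st <= vis} ->
  uniq (visits c) -> (forall w, w \in visits c -> w \notin vis) ->
  uniq (tree_edges c st) /\
  (forall e : {set V}, e \in tree_edges c st -> ~~ (e \subset vis)).
Proof.
elim: c st vis => [|[w|] c IH] [|v st] vis //= sub.
- move=> /andP[wc uc] nvis.
  have [] := IH [:: w, v & st] (w :: vis).
  + by move=> x; rewrite in_cons => /orP[/eqP->|/sub h]; rewrite inE ?eqxx ?h ?orbT.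
  + exact: uc.
  + move=> x xc; rewrite inE negb_or nvis ?inE ?xc ?orbT // andbT.
    by apply: contraNneq wc => <-.
  move=> h1 h2; rewrite h1 andbT; split.
    apply/negP => /h2 /negP; apply; apply/subsetP => x.
    by rewrite !inE => /orP[/eqP->|/eqP->]; rewrite ?eqxx // sub ?orbT // inE eqxx.
  move=> e; rewrite inE => /orP[/eqP->|/h2].
    apply/negP => /subsetP/(_ w); rewrite !inE eqxx orbT => /(_ isT).
    by apply/negP; apply: nvis; rewrite inE eqxx.
  by apply: contra => /subsetP h; apply/subsetP => x /h; rewrite inE => ->; rewrite orbT.
- move=> uc nvis; apply: IH => // x xs; apply: sub; by rewrite inE xs orbT.
Qed.

Fixpoint insert (x y : V) (c : seq (option V)) : seq (option V) :=
  match c with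
  | Some w :: c' => if w == x then [:: Some w, Some y, None & c']
                    else Some w :: insert x y c'
  | None :: c' => None :: insert x y c'
  | [::] => [::]
  end.

(** The hypothesis on sizes says that the traversal does not stop early on an empty stack, so that
    [x] is really reached. *)
Lemma insertP x y c st : x \in visits c -> size (tree_edges c st) = size (visits c) ->
  [/\ size (insert x y c) = (size c).+2, perm_eq (visits (insert x y c)) (y :: visits c) &
      perm_eq (tree_edges (insert x y c) st) ([set x; y] :: tree_edges c st)].
Proof.
elim: c st => [|[w|] c IH] [|v st] //=.
- rewrite inE; case: (eqVneq w x) => [->|wx] /=.
    by move=> _ _; split => //; apply/permP => a /=; rewrite addnCA.
  rewrite /= => xc [sz]; have [h1 h2 h3] := IH [:: w, v & st] xc sz.
  by split; rewrite /= ?h1 //; apply/permP => a /=; rewrite ?(permP h2 a) ?(permP h3 a) /= addnCA.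
- by move=> xc /esym/size0nil h; rewrite h in xc.
- by move=> xc sz; have [h1 h2 h3] := IH st xc sz; split; rewrite //= h1.
Qed.

(** The length reflects that every vertex except the root is entered once and left once. *)
Definition codes (Y : {set V}) v c (G : {set {set V}}) :=
  [/\ size c = (#|Y|.-1).*2, uniq (v :: visits c), [set:: v :: visits c] = Y,
      size (tree_edges c [:: v]) = size (visits c) &
      {subset tree_edges c [:: v] <= G}].

(** The tree grows by one leaf at a time, along an edge that leaves the current vertex set. *)
Lemma conn_code (G : {set {set V}}) (Y : {set V}) :
  conn (adj G) Y -> exists v c, codes Y v c G.
Proof.
move=> /connP[/set0Pn[v vY] cut]; exists v.
suff H k : (0 < k <= #|Y|)%N -> exists (A : {set V}) (c : seq (option V)), [/\ A \subset Y, #|A| = k & codes A v c G].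
  have [] := H #|Y|; first by rewrite leqnn andbT; apply/card_gt0P; exists v.
  move=> A [c [AY cA hc]]; exists c; suff <- : A = Y by [].
  by apply/eqP; rewrite eqEcard AY cA leqnn.
elim: k => // -[_ _|k IH].
  exists [set v], [::]; split; rewrite ?sub1set ?cards1 //; split => //=.
    by rewrite cards1.
  by apply/setP => x; rewrite !inE.
move=> /andP[_ kY]; have [|A [c [AY cA [sz un vA te sub]]]] := IH.
  by rewrite /= ltnW.
have vinA : v \in A by rewrite -vA !inE eqxx.
have [] := cut A AY.
- by apply/set0Pn; exists v.
- by apply: contraTneq kY => AY'; rewrite -AY' cA ltnn.
move=> x [y [xA yY yA exy]].
have cyA : #|y |: A| = k.+2 by rewrite cardsU1 yA cA.
have [c' [s' p' t']] : exists c', [/\ size c' = (size c).+2,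
    perm_eq (visits c') (y :: visits c) &
    perm_eq (tree_edges c' [:: v]) ([set x; y] :: tree_edges c [:: v])].
  move: xA; rewrite -vA !inE => /orP[/eqP->|xc].
    by exists [:: Some y, None & c]; split => //=.
  by exists (insert x y c); apply: insertP.
exists (y |: A), c'; split => //; first by rewrite subUset sub1set yY.
have yv : y \notin v :: visits c by apply: contra yA => yc; rewrite -vA inE.
split.
- by rewrite s' sz cyA cA.
- move: un yv; rewrite /= inE negb_or => /andP[h1 h2] /andP[h3 h4].
  by rewrite (perm_mem p') inE negb_or eq_sym h3 h1 (perm_uniq p') /= h4 h2.
- apply/setP => z; rewrite -vA !inE (perm_mem p') inE.
  by case: (z == v); case: (z == y).
- by rewrite (perm_size t') (perm_size p') /= te.
- move=> e'; rewrite (perm_mem t') inE => /orP[/eqP->|]; last exact: sub.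
  exact: exy.
Qed.

End Programs.

(** * Edges that meet a set or lie inside it *)

Section EdgeCounts.
Variable V : finType.
Local Notation E := (potential_edges V).
Implicit Types (G S : {set {set V}}) (Y : {set V}).

Lemma degree_sum G S Y (B : V -> {set V}) : G \subset E ->
  (forall x w, x \in Y -> w \in B x -> [set x; w] \in G :&: S) ->
  (\sum_(x in Y) #|B x| <= 2 * #|G :&: S|)%N.
Proof.
move=> GE BS.
apply: (@leq_trans (\sum_(x in Y) \sum_(e in G :&: S) (x \in e))%N).
  apply: leq_sum => x xY.
  have inj : {in B x &, injective (fun w => [set x; w])}.
    move=> w w' wB w'B /setP/(_ w); rewrite !inE eqxx orbT => /esym/orP[/eqP wx|/eqP //].
    have /setIP[/(subsetP GE)] := BS x w xY wB; rewrite inE wx setUid cards1 //.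
  rewrite -(card_in_imset inj) -sum1_card big_mkcond [leqRHS]big_mkcond; apply: leq_sum => e _.
  case: ifP => // /imsetP[w wB ->].
  by rewrite (BS x w xY wB) !inE eqxx.
rewrite exchange_big mulnC -sum_nat_const; apply: leq_sum => e /setIP[/(subsetP GE) eE _].
have {eE} e2 : #|e| = 2%N by move: eE; rewrite inE => /eqP.
rewrite -e2 -sum1_card big_mkcond [leqRHS]big_mkcond; apply: leq_sum => x _.
by case: (x \in Y); case: (x \in e).
Qed.

Definition touching Y : {set {set V}} := [set e : {set V} | e :&: Y != set0].
Definition inside Y : {set {set V}} := [set e : {set V} | e \subset Y].

Lemma card_pairs (Y Z : {set V}) (S : {set {set V}}) :
  (forall e, e \in S -> exists x y, [/\ x \in Y, y \in Z & e = [set x; y]]) ->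
  (#|S| <= #|Y| * #|Z|)%N.
Proof.
move=> H; rewrite -cardsX.
apply: leq_trans (leq_imset_card (fun u : V * V => [set u.1; u.2]) _).
apply: subset_leq_card; apply/subsetP => e /H[x [y [xY yZ ->]]].
by apply/imsetP; exists (x, y) => //; rewrite inE xY.
Qed.

Lemma card_touching Y : (#|touching Y :&: E| <= #|Y| * #|V|)%N.
Proof.
rewrite -cardsT; apply: card_pairs => e; rewrite !inE => /andP[/set0Pn[x]].
rewrite inE => /andP[xe xY] /cards2P[u [v [uv eE]]].
move: xe; rewrite eE !inE => /orP[/eqP xu|/eqP xv].
  by exists x, v; rewrite xu in_setT; split => //; rewrite -xu.
by exists x, u; rewrite xv in_setT; split => //; [rewrite -xv|rewrite setUC].
Qed.

Lemma card_inside Y : (#|inside Y :&: E| <= #|Y| * #|Y|)%N.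
Proof.
apply: card_pairs => e; rewrite !inE => /andP[/subsetP eY /cards2P[u [v [uv eE]]]].
by exists u, v; split => //; apply: eY; rewrite eE !inE eqxx ?orbT.
Qed.

Lemma tree_edges_child (c : seq (option V)) st e :
  e \in tree_edges c st -> exists2 w, w \in visits c & w \in e.
Proof.
elim: c st => [|[w|] c IH] [|v st] //=; last exact: IH.
rewrite inE => /orP[/eqP ->|/IH[u uc ue]].
  by exists w; rewrite !inE eqxx ?orbT.
by exists u; rewrite // inE uc orbT.
Qed.

End EdgeCounts.

(** * Probabilities of the two exceptional events *)

Section Events.
Variables (R : realType) (n A M : nat) (d : R).
Hypotheses (d1 : 1 <= d) (dn : d <= n%:R).
Local Notation p := (d / n%:R).
Local Notation V := 'I_n.
Local Notation E := (potential_edges V).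

Lemma n_gt0 : (0 < n)%N.
Proof. by rewrite -(ltr0n R); apply: lt_le_trans dn; apply: lt_le_trans d1. Qed.

Lemma nR_gt0 : 0 < n%:R :> R. Proof. by rewrite ltr0n n_gt0. Qed.
Lemma p_ge0 : 0 <= p.
Proof. by rewrite divr_ge0 // (le_trans _ d1). Qed.
Lemma p_le1 : p <= 1.
Proof. by rewrite ler_pdivrMr ?nR_gt0 // mul1r. Qed.

Lemma pow_le_expR (x : R) m : 0 <= x -> (1 + x) ^+ m <= expR (m%:R * x).
Proof.
move=> x0; rewrite expRM_natl; case: m => [|m]; first by rewrite !expr0.
by rewrite ler_pXn2r ?nnegrE ?expR_ge0 ?addr_ge0 ?expR_ge1Dx.
Qed.

Definition crowded (G : {set {set V}}) := [exists Y : {set V},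
  [&& conn (adj G) Y, (A * #|Y| <= wts (adj G) Y)%N & (M < wts (adj G) Y)%N]].

Definition tree_of (v : V) k (b : (k.*2).-tuple bool) (vs : k.-tuple V) : {set {set V}} :=
  [set:: tree_edges (decode b vs) [:: v]].
Definition span_of (v : V) k (vs : k.-tuple V) : {set V} := [set:: v :: vs].
Definition is_tree (v : V) k (b : (k.*2).-tuple bool) (vs : k.-tuple V) : bool :=
  [&& uniq (v :: vs), visits (decode b vs) == vs &
      size (tree_edges (decode b vs) [:: v]) == k].

Definition tree_term k v b vs (G : {set {set V}}) : R :=
  (@is_tree v k b vs)%:R * ((@tree_of v k b vs \subset G)%:R *
     16 ^+ #|G :&: touching (@span_of v k vs)|).

(** Tilting by 16 over at most [(k + 1) n] pairs meeting the tree: as [p n = d], the second factor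
    is at most [expR (16 * d) ^+ k.+1]. *)
Lemma expect_tree_term k v b vs :
  expect p (@tree_term k v b vs) <= (p * 16) ^+ k * expR (16 * d) ^+ k.+1.
Proof.
have p0 := p_ge0; have p1 := p_le1.
have rhs0 : 0 <= (p * 16) ^+ k * expR (16 * d) ^+ k.+1.
  by rewrite mulr_ge0 // exprn_ge0 ?expR_ge0 // mulr_ge0.
rewrite /tree_term expectZ.
case: (boolP (is_tree v b vs)) => [/and3P[un /eqP vis /eqP sz]|_]; last by rewrite mul0r.
rewrite mul1r.
set T := tree_of v b vs; set S := touching _.
have [TE|TE] := boolP (T \subset E); last first.
  rewrite /expect big1 // => G; rewrite powersetE => GE.
  suff /negbTE -> : ~~ (T \subset G) by rewrite mul0r mulr0.
  by apply: contra TE => TG; apply: subset_trans TG GE.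
have TS : T \subset S.
  apply/subsetP => e; rewrite inE => /tree_edges_child[w wc we].
  rewrite inE; apply/set0Pn; exists w; rewrite inE we !inE; apply/orP; right.
  by rewrite -vis.
have cT : #|T| = k.
  rewrite cardsE; apply: etrans sz; apply/card_uniqP.
  move: un; rewrite /= => /andP[vvs uvs].
  have [] // := @tree_edges_uniq _ (decode b vs) [:: v] [:: v] (fun x h => h).
    by rewrite vis.
  by move=> w; rewrite vis inE => wvs; apply: contraNneq vvs => <-.
have cS : (#|S :&: E| <= k.+1 * n)%N.
  apply: leq_trans (card_touching _) _; rewrite card_ord leq_mul2r; apply/orP; right.
  rewrite cardsE; apply: leq_trans (card_size _) _; by rewrite /= size_tuple.
have l0 : 0 <= 16 :> R by [].
have := expect_tilt p0 p1 l0 TE TS; rewrite cT; move/le_trans; apply.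
have pl : 0 <= p * 16 by apply: mulr_ge0.
apply: ler_wpM2l; first exact: exprn_ge0.
apply: (@le_trans _ _ ((1 + p * 16) ^+ (k.+1 * n))).
  by apply: ler_weXn2l => //; rewrite lerDl.
apply: le_trans (pow_le_expR _ pl) _.
rewrite -expRM_natl natrM -mulrA le_eqVlt; apply/orP; left; apply/eqP; congr (expR (_ * _)).
by field; rewrite gt_eqF // nR_gt0.
Qed.

(* A crowded set [Y] of size [k + 1] has [2 * #|G :&: touching Y| >= wts Y - (k + 1)],
   so that [16 ^ #|G :&: touching Y|] compensates this coefficient. *)
Definition crowd_coef k : R := 4 ^+ k.+1 * 2^-1 ^+ (A * k.+1 + M).

Lemma crowded_le (G : {set {set V}}) : G \subset E -> crowded G ->
  1 <= \sum_(k < n) crowd_coef k * \sum_v \sum_b \sum_vs @tree_term k v b vs G.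
Proof.
move=> GE /existsP[Y /and3P[cY AY MY]].
have tt0 k v b vs : 0 <= @tree_term k v b vs G.
  by rewrite /tree_term !mulr_ge0.
have [v [c [sz un vE te sub]]] := conn_code cY.
have Y0 : (0 < #|Y|)%N by rewrite card_gt0 (conn_neq0 cY).
have cYs : #|Y| = (size (visits c)).+1 by rewrite -vE cardsE (card_uniqP un).
pose k := size (visits c).
have kn : (k < n)%N by rewrite -[n]card_ord -cYs max_card.
have szc : size c = k.*2 by rewrite sz cYs.
have szb : size (map isSome c) == k.*2 by rewrite size_map szc.
pose b : (k.*2).-tuple bool := Tuple szb.
have szv : size (visits c) == k by [].
pose vs : k.-tuple V := Tuple szv.
have dec : decode b vs = c by apply: decodeK.
have span : span_of v vs = Y by rewrite -vE.
rewrite (bigD1 (Ordinal kn)) //= (bigD1 v) //= (bigD1 b) //= (bigD1 vs) //=.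
have c0 j : 0 <= crowd_coef j.
  by rewrite /crowd_coef mulr_ge0 // exprn_ge0 // invr_ge0.
set x := tree_term _ _ _ G; set r1 := \sum_(i | i != vs) _; set r2 := \sum_(i | i != b) _.
set r3 := \sum_(i | i != v) _; set r4 := \sum_(i | i != _) _.
have r1p : 0 <= r1 by apply: sumr_ge0.
have r2p : 0 <= r2 by apply: sumr_ge0 => i _; apply: sumr_ge0.
have r3p : 0 <= r3 by apply: sumr_ge0 => i _; apply: sumr_ge0 => j _; apply: sumr_ge0.
have r4p : 0 <= r4.
  apply: sumr_ge0 => l _; apply: mulr_ge0 => //; apply: sumr_ge0 => i _.
  by apply: sumr_ge0 => j _; apply: sumr_ge0.
apply: (@le_trans _ _ (crowd_coef k * x)); last first.
  by rewrite -[leLHS]addr0 lerD // ler_wpM2l // -!addrA lerDl !addr_ge0.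
have -> : x = 16 ^+ #|G :&: touching Y|.
  rewrite /x /tree_term span /is_tree dec un eqxx te /= eqxx mul1r.
  rewrite /tree_of dec (_ : _ \subset G) ?mul1r //.
  by apply/subsetP => e; rewrite inE; apply: sub.
have dY : (\sum_(z in Y) #|nbr (adj G) z| <= 2 * #|G :&: touching Y|)%N.
  apply: degree_sum => // z w zY; rewrite inE => ezw; rewrite inE; apply/andP; split; first exact: ezw.
  by rewrite inE; apply/set0Pn; exists z; rewrite !inE eqxx zY.
rewrite wtsE in AY MY.
have o : outdeg (adj G) Y = (\sum_(z in Y) #|nbr (adj G) z|)%N by [].
rewrite o in AY MY.
(* Adds the two lower bounds [A * #|Y|] and [M] on the weight; twice the weight is at most
   [2 * #|Y|] plus four times the number of touching edges. *)
have key : (A * k.+1 + M <= 2 * k.+1 + 4 * #|G :&: touching Y|)%N.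
  rewrite -cYs; move: AY MY dY.
  move: (\sum_(z in Y) _)%N (#|G :&: touching Y|) (A * #|Y|)%N #|Y| => s t u y.
  by clear; lia.
have E16 : 16 ^+ #|G :&: touching Y| = 2 ^+ (4 * #|G :&: touching Y|) :> R.
  by rewrite exprM; congr (_ ^+ _); ring.
have E4 : 4 ^+ k.+1 = 2 ^+ (2 * k.+1) :> R by rewrite exprM; congr (_ ^+ _); ring.
rewrite /crowd_coef E4 E16 exprVn mulrAC -exprD ler_pdivlMr ?exprn_gt0 // mul1r.
by apply: ler_weXn2l; rewrite ?ler1n.
Qed.

(** There are [n * 4 ^ k * n ^ k] choices of tree; [n ^ k] cancels against [p ^ k], leaving at most
    [256 * d * expR (16 * d) / 2 ^ A <= 1/2] per vertex and a geometric series. *)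
Lemma crowded_prob : 512 * d * expR (16 * d) <= 2 ^+ A ->
  Gnp_prob p crowded <= n%:R * 2^-1 ^+ M.
Proof.
move=> hA.
have p0 := p_ge0; have p1 := p_le1.
apply: (@le_trans _ _ (expect p (fun G => \sum_(k < n) crowd_coef k *
    \sum_v \sum_b \sum_vs @tree_term k v b vs G))).
  apply: Gnp_markov => // G GE; last exact: crowded_le.
  apply: sumr_ge0 => k _; rewrite mulr_ge0 //.
    by rewrite /crowd_coef mulr_ge0 // exprn_ge0 // invr_ge0.
  by apply: sumr_ge0 => v _; apply: sumr_ge0 => b _; apply: sumr_ge0 => vs _; rewrite /tree_term !mulr_ge0.
rewrite expect_sum.
have n0 := nR_gt0.
have e0 : 0 < expR (16 * d) by apply: expR_gt0.
apply: (@le_trans _ _ (\sum_(k < n) n%:R * 2^-1 ^+ M * 2^-1 ^+ k.+1)).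
  apply: ler_sum => k _; rewrite expectZ.
  apply: (@le_trans _ _ (crowd_coef k * \sum_(v : V) \sum_(b : (k.*2).-tuple bool)
      \sum_(vs : k.-tuple V) ((p * 16) ^+ k * expR (16 * d) ^+ k.+1))).
    rewrite ler_wpM2l //; first by rewrite /crowd_coef mulr_ge0 // exprn_ge0 // invr_ge0.
    rewrite expect_sum; apply: ler_sum => v _; rewrite expect_sum; apply: ler_sum => b _.
    by rewrite expect_sum; apply: ler_sum => vs _; apply: expect_tree_term.
  rewrite !sumr_cst !card_tuple card_bool card_ord.
  rewrite /crowd_coef exprD [2^-1 ^+ (A * k.+1)]exprM.
  have -> : (2 ^ k.*2)%:R = 4 ^+ k :> R.
    by rewrite natrX -mul2n exprM; congr (_ ^+ _); ring.
  rewrite natrX exprMn expr_div_n.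
  set X := expR (16 * d); set a := 2^-1 ^+ A.
  have nk : n%:R ^+ k != 0 :> R by rewrite expf_eq0 gt_eqF // andbF.
  have -> : 4 ^+ k.+1 * (a ^+ k.+1 * 2^-1 ^+ M) * (n%:R * (4 ^+ k * (n%:R ^+ k * (d ^+ k / n%:R ^+ k * 16 ^+ k * X ^+ k.+1)))) =
     n%:R * 2^-1 ^+ M * ((4 * a * X) ^+ k.+1 * (4 * 16 * d) ^+ k).
    rewrite !exprMn; field; exact: nk.
  rewrite ler_wpM2l ?mulr_ge0 ?exprn_ge0 ?invr_ge0 //.
  have aX : 0 <= 4 * a * X by rewrite !mulr_ge0 ?exprn_ge0 ?invr_ge0 // ltW.
  apply: (@le_trans _ _ ((4 * a * X) ^+ k.+1 * (4 * 16 * d) ^+ k.+1)).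
    rewrite ler_wpM2l ?exprn_ge0 //; apply: ler_weXn2l => //; move: d1; lra.
  rewrite -exprMn; apply: lerXn2r; rewrite ?nnegrE ?invr_ge0 //.
    by rewrite mulr_ge0 //; move: d1; lra.
  rewrite -(@ler_pM2l _ 2) // mulfV ?pnatr_eq0 //.
  rewrite (_ : 2 * _ = (512 * d * X) * a); last by ring.
  rewrite /a exprVn ler_pdivrMr ?exprn_gt0 // mul1r; exact: hA.
rewrite -mulr_sumr -[leRHS]mulr1 ler_wpM2l ?mulr_ge0 ?exprn_ge0 ?invr_ge0 //.
have H m : \sum_(k < m) 2^-1 ^+ k.+1 = 1 - 2^-1 ^+ m :> R.
  elim: m => [|m IH]; first by rewrite big_ord0 expr0 subrr.
  by rewrite big_ord_recr /= IH exprS; field.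
by rewrite H gerBl exprn_ge0 // invr_ge0.
Qed.

Definition dense_spot (G : {set {set V}}) := [exists K : {set V},
  [&& K != set0, (#|K| <= M)%N & [forall x in K, (4 <= #|nbr (adj G) x :&: K|)%N]]].

(** A set of [k + 1] vertices with inner degrees at least 4 contains [2 (k + 1)] edges. Against
    [n ^ (k + 1)] choices this leaves [((k + 1) ^ 4 / n) ^ (k + 1)], at most [M ^ 4 / n]. *)
Lemma dense_spot_prob : (M ^ 4 <= n)%N ->
  Gnp_prob p dense_spot <= expR d * (M ^ 5)%:R / n%:R.
Proof.
move=> Mn; have p0 := p_ge0; have p1 := p_le1; have n0 := nR_gt0.
(* Chosen so that [p * lam k * k.+1 ^ 2 = d]: the tilt costs only a factor [expR d]. *)
pose lam k : R := n%:R / (k.+1 ^ 2)%:R.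
have lam1 (k : 'I_M) : 1 <= lam k.
  rewrite ler_pdivlMr ?ltr0n ?expn_gt0 // mul1r ler_nat; apply: leq_trans Mn.
  apply: (@leq_trans (M ^ 2)); first by rewrite leq_exp2r.
  by apply: leq_pexp2l => //; apply: leq_trans (ltn_ord k).
have lam0 (k : 'I_M) : 0 < lam k by apply: lt_le_trans (lam1 k).
pose term k (t : k.+1.-tuple V) (G : {set {set V}}) : R :=
  (lam k)^-1 ^+ (2 * k.+1) * ((set0 \subset G)%:R * lam k ^+ #|G :&: inside [set:: t]|).
have term0 (k : 'I_M) t G : 0 <= @term k t G.
  by rewrite /term mulr_ge0 // ?mulr_ge0 // exprn_ge0 ?invr_ge0 // ltW.
apply: (@le_trans _ _ (expect p (fun G => \sum_(k < M) \sum_t @term k t G))).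
  apply: Gnp_markov => // G GE.
    by apply: sumr_ge0 => k _; apply: sumr_ge0.
  move=> /existsP[K /and3P[K0 KM /forall_inP hK]].
  have [k kE] : exists k, #|K| = k.+1.
    by exists #|K|.-1; rewrite prednK // card_gt0.
  have kM : (k < M)%N by rewrite -kE.
  have szK : size (enum K) == k.+1 by rewrite -cardE kE.
  pose t : k.+1.-tuple V := Tuple szK.
  rewrite (bigD1 (Ordinal kM)) //= (bigD1 t) //=.
  set x := term _ _ _; set r1 := \sum_(i | i != t) _; set r2 := \sum_(i | _) _.
  have r1p : 0 <= r1 by apply: sumr_ge0 => i _; apply: (term0 (Ordinal kM)).
  have r2p : 0 <= r2 by apply: sumr_ge0 => i _; apply: sumr_ge0.
  have tK : [set:: t] = K by apply/setP => y; rewrite inE mem_enum.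
  suff x1 : 1 <= x by apply: le_trans x1 _; rewrite -addrA lerDl addr_ge0.
  rewrite /x /term tK sub0set mul1r exprVn mulrC.
  have l0 : 0 < lam k by apply: (lam0 (Ordinal kM)).
  rewrite ler_pdivlMr ?exprn_gt0 // mul1r; apply: ler_weXn2l; first exact: (lam1 (Ordinal kM)).
  have dK : (\sum_(z in K) #|nbr (adj G) z :&: K| <= 2 * #|G :&: inside K|)%N.
    apply: degree_sum => // z w zK; rewrite !inE => /andP[ezw wK]; apply/andP; split; first exact: ezw.
    by rewrite subUset !sub1set zK.
  have h4 : (4 * k.+1 <= \sum_(z in K) #|nbr (adj G) z :&: K|)%N.
    by rewrite -kE mulnC -sum_nat_const; apply: leq_sum.
  by have := leq_trans h4 dK; rewrite -[4%N]/(2 * 2)%N -mulnA leq_pmul2l.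
rewrite expect_sum.
apply: (@le_trans _ _ (\sum_(k < M) expR d * ((M ^ 4)%:R / n%:R))); last first.
  rewrite sumr_const card_ord -[_ *+ M]mulr_natl expnS natrM.
  by rewrite le_eqVlt; apply/orP; left; apply/eqP; ring.
apply: ler_sum => k _; rewrite expect_sum.
apply: (@le_trans _ _ (\sum_(t : k.+1.-tuple V) (lam k)^-1 ^+ (2 * k.+1) * expR d)).
  apply: ler_sum => t _; rewrite /term expectZ ler_wpM2l ?exprn_ge0 ?invr_ge0 ?(ltW (lam0 k)) //.
  have := @expect_tilt R n p p0 p1 (inside [set:: t]) set0 (lam k) (ltW (lam0 k)) (sub0set _) (sub0set _).
  move/le_trans; apply; rewrite cards0 expr0 mul1r.
  have pl : 0 <= p * lam k by rewrite mulr_ge0 // ltW.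
  apply: (@le_trans _ _ ((1 + p * lam k) ^+ (k.+1 ^ 2))).
    apply: ler_weXn2l; first by rewrite lerDl.
    apply: leq_trans (card_inside _) _.
    have : (#|[set:: t]| <= k.+1)%N by rewrite cardsE (leq_trans (card_size _)) // size_tuple.
    by move=> h; rewrite expnS expn1; apply: leq_mul.
  apply: le_trans (pow_le_expR _ pl) _.
  rewrite le_eqVlt; apply/orP; left; apply/eqP; congr expR; rewrite /lam.
  have zz : (k.+1 ^ 2)%:R != 0 :> R by rewrite pnatr_eq0 expn_eq0.
  by move: zz; move: ((k.+1 ^ 2)%:R : R) => z z0; field; rewrite z0 gt_eqF.
rewrite sumr_cst card_tuple card_ord mulrA mulrC ler_pM2l ?expR_gt0 //.
have x0 : 0 <= (k.+1 ^ 4)%:R / n%:R :> R by rewrite divr_ge0.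
have -> : (n ^ k.+1)%:R * (lam k)^-1 ^+ (2 * k.+1) = ((k.+1 ^ 4)%:R / n%:R) ^+ k.+1 :> R.
  rewrite natrX exprM -exprMn; congr (_ ^+ _); rewrite /lam invf_div expr_div_n.
  rewrite !natrX; field; by rewrite gt_eqF.
have kM : (k.+1 ^ 4 <= M ^ 4)%N by rewrite leq_exp2r.
have x1 : (k.+1 ^ 4)%:R / n%:R <= 1 :> R.
  by rewrite ler_pdivrMr // mul1r ler_nat (leq_trans kM).
apply: (@le_trans _ _ ((k.+1 ^ 4)%:R / n%:R)).
  by rewrite exprS ler_piMr // exprn_ile1.
by rewrite ler_pM2r ?invr_gt0 // ler_nat.
Qed.

End Events.

(** * The mixing time on G(n, d/n) *)

Section Final.
Variables (R : realType) (d : R).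
Hypothesis d1 : 1 <= d.

Lemma Gnp_prob_union n (p : R) (A B : pred {set {set 'I_n}}) : 0 <= p -> p <= 1 ->
  Gnp_prob p (fun G => A G || B G) <= Gnp_prob p A + Gnp_prob p B.
Proof.
move=> p0 p1; rewrite /Gnp_prob !big_mkcondr -big_split; apply: ler_sum => G _ /=.
have w := Gnp_weight_ge0 p0 p1 G.
by case: (A G); case: (B G); rewrite /= ?addr0 ?add0r // lerDl.
Qed.

(** The factor 2 yields [n ^ 2 <= 2 ^ M], hence a bound [1 / n] for [n * 2 ^- M]. *)
Definition log_bound n := (2 * (trunc_log 2 n).+1)%N.

(** The sixth power of the logarithm is what makes [M ^ 5 / n] of order [1 / log n]. *)
Lemma pow6_bound L : (L.+1 ^ 6 <= 6 ^ 6 * 2 ^ L)%N.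
Proof.
have h : (L.+1 <= 6 * 2 ^ (L %/ 6))%N.
  apply: (@leq_trans (6 * (L %/ 6).+1)); last by rewrite leq_mul2l ltn_expl.
  by rewrite {1}(divn_eq L 6) -addnS mulnC mulnS addnC leq_add2r ltn_mod.
apply: (@leq_trans ((6 * 2 ^ (L %/ 6)) ^ 6)); first by rewrite leq_exp2r.
by rewrite expnMn -expnM leq_mul2l leq_pexp2l ?orbT // leq_trunc_div.
Qed.

Lemma log_bound_pow n : (0 < n)%N ->
  ((log_bound n) ^ 5 * (trunc_log 2 n).+1 <= 32 * 6 ^ 6 * n)%N.
Proof.
move=> n0; rewrite /log_bound expnMn -mulnA -expnSr (_ : 2 ^ 5 = 32)%N // -mulnA leq_mul2l /=.
apply: leq_trans (pow6_bound _) _; rewrite leq_mul2l /=; exact: trunc_logP.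
Qed.

Lemma sqr_le_pow_log_bound n : (n * n <= 2 ^ log_bound n)%N.
Proof.
rewrite /log_bound mulnC expnM expnS expn1; apply: leq_mul; apply: ltnW; exact: trunc_log_ltn.
Qed.

Section Graph.
Variables (A q n : nat).
Hypotheses (A0 : (0 < A)%N) (Aq : (2 ^ (24 * A + 2) <= q)%N)
  (hA : 512 * d * expR (16 * d) <= 2 ^+ A) (n0 : (0 < n)%N) (dn : d <= n%:R).
Local Notation M := (log_bound n).

Definition poly_deg := (2 * (2 * cost 'I_q) + 2)%N.
Definition poly_coef := (2 ^ (2 * (2 * cost 'I_q) + 1) * (q + 2))%N.

Lemma q_gt0 : (0 < q)%N.
Proof. by apply: leq_trans Aq; rewrite expn_gt0. Qed.

(** With [l = 2 * cost], the inequality [l <= 2 ^ l] turns [l ^ M] into a power of [2 ^ M], and [M]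
    is logarithmic; so [l ^ M] is at most [(2 n) ^ (2 l)]. *)
Lemma steps_bound : (n * (2 * (2 * cost 'I_q) ^ M) * (n * q + 2) <= poly_coef * n ^ poly_deg)%N.
Proof.
set l := (2 * cost 'I_q)%N.
have h1 : (l ^ M <= (2 * n) ^ (2 * l))%N.
  apply: (@leq_trans ((2 ^ l) ^ M)); first by rewrite leq_exp2r // ltnW // ltn_expl.
  have -> : ((2 ^ l) ^ M = (2 ^ (trunc_log 2 n).+1) ^ (2 * l))%N.
    by rewrite -!expnM; congr (2 ^ _)%N; rewrite /log_bound; ring.
  rewrite leq_exp2r; last by rewrite muln_gt0 /l muln_gt0 /cost muln_gt0 expn_gt0 card_ord q_gt0.
  by rewrite expnS leq_mul2l trunc_logP.
have h2 : (n * q + 2 <= n * (q + 2))%N.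
  by rewrite mulnDr leq_add2l leq_pmull.
apply: (@leq_trans (n * (2 * (2 * n) ^ (2 * l)) * (n * (q + 2)))).
  by apply: leq_mul => //; rewrite leq_mul2l leq_mul2l h1 orbT orbT.
rewrite /poly_coef /poly_deg -/l expnMn addn1 [(2 * l + 2)%N]addn2 !expnSr.
move: (2 ^ (2 * l))%N (n ^ (2 * l))%N => x y.
by apply: eq_leq; ring.
Qed.

Lemma good_mixes (G : {set {set 'I_n}}) : G \subset potential_edges 'I_n ->
  ~~ (crowded A M G || dense_spot M G) ->
  gibbs_mixes_within 'I_q G (poly_coef%:R * n%:R `^ poly_deg%:R : R).
Proof.
move=> GE; rewrite negb_or => /andP[ncr nde].
have few : few_edges (adj G) A M.
  move=> Y cY AY; rewrite leqNgt; apply: contra ncr => MY.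
  by apply/existsP; exists Y; rewrite cY AY.
have sp : locally_sparse (adj G) M.
  move=> K K0 KM; apply/exists_inP; apply: contraR nde; rewrite negb_exists_in => /forall_inP h.
  apply/existsP; exists K; rewrite K0 KM /=; apply/forall_inP => x xK.
  by rewrite ltnNge h.
have esym := adj_sym G; have eirr := adj_irr GE.
have Cq : (2 ^ (24 * A + 2) <= #|'I_q|)%N by rewrite card_ord.
have poincareK := @poincare_all R 'I_n 'I_q (adj G) esym eirr A M A0 Cq few sp.
have q0 := q_gt0.
pose h0 : {ffun 'I_n -> 'I_q} := [ffun=> Ordinal q0].
have [s sX] := @colorable 'I_n 'I_q (adj G) esym eirr A M A0 Cq few sp h0.
have V0 : (0 < #|'I_n|)%N by rewrite card_ord.
pose K := (2 * (2 * cost 'I_q) ^ M)%N.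
have K0 : (0 < K)%N.
  by rewrite muln_gt0 expn_gt0 muln_gt0 /cost muln_gt0 expn_gt0 card_ord q0.
rewrite -natrM in poincareK.
apply/andP; split.
  by rewrite (card_coloring G h0); apply/card_gt0P; exists s.
apply: le_trans (mixing_time_le GE V0 K0 poincareK h0) _.
rewrite lee_fin powR_mulrn // -natrX -natrM ler_nat.
by rewrite /mix_steps !card_ord; apply: steps_bound.
Qed.

Lemma good_prob :
  1 - (1 + expR d * (32 * 6 ^+ 6)) / (trunc_log 2 n).+1%:R <=
  Gnp_prob (d / n%:R)
    (fun G : {set {set 'I_n}} => gibbs_mixes_within 'I_q G (poly_coef%:R * n%:R `^ poly_deg%:R : R)).
Proof.
have p0 := p_ge0 n d1; have p1 := p_le1 d1 dn.
have nR : 0 < n%:R :> R by rewrite ltr0n.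
have LR : 0 < (trunc_log 2 n).+1%:R :> R by rewrite ltr0n.
have h1 : Gnp_prob (d / n%:R) (@crowded n A M) <= 1 / (trunc_log 2 n).+1%:R.
  apply: le_trans (crowded_prob M d1 dn hA) _.
  rewrite exprVn ler_pdivrMr ?exprn_gt0 // mul1r ler_pdivlMl //.
  rewrite -natrX -natrM ler_nat; apply: leq_trans (sqr_le_pow_log_bound n); rewrite leq_mul2r.
  apply/orP; right; apply: leq_trans (trunc_logP (isT : 1 < 2)%N n0); exact: ltn_expl.
have h2 : Gnp_prob (d / n%:R) (@dense_spot n M) <= expR d * (32 * 6 ^+ 6) / (trunc_log 2 n).+1%:R.
  apply: (@le_trans _ _ (expR d * (M ^ 5)%:R / n%:R)); last first.
    rewrite -!mulrA ler_pM2l ?expR_gt0 // ler_pdivrMr //.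
    rewrite [leRHS](_ : _ = 32 * 6 ^+ 6 * n%:R / (trunc_log 2 n).+1%:R); last by ring.
    rewrite ler_pdivlMr //.
    have h : (32 * 6 ^ 6 * n)%:R = 32 * 6 ^+ 6 * n%:R :> R.
      by rewrite natrM [(32 * _)%:R]natrM [(6 ^ 6)%:R]natrX.
    by rewrite -h -natrM ler_nat; apply: log_bound_pow.
  (* If [M ^ 4] exceeds [n], then so does [M ^ 5], and the claimed bound is at least 1. *)
  have [Mn|Mn] := leqP (M ^ 4) n; first exact: dense_spot_prob.
  apply: le_trans (Gnp_prob_le1 p0 p1 _) _.
  rewrite ler_pdivlMr // mul1r; apply: (@le_trans _ _ (M ^ 5)%:R).
    by rewrite ler_nat; apply: leq_trans (ltnW Mn) _; rewrite leq_pexp2l.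
  by rewrite ler_peMl // (le_trans _ (expR_ge1Dx d)) // lerDl (le_trans _ d1).
rewrite Gnp_prob_compl lerB //.
apply: (@le_trans _ _ (Gnp_prob (d / n%:R) (fun G => crowded A M G || dense_spot M G))).
  by apply: Gnp_prob_mono => // G GE; apply: contraR => /(good_mixes GE).
apply: le_trans (Gnp_prob_union _ _ p0 p1) _; rewrite mulrDl.
by apply: lerD.
Qed.

End Graph.
End Final.

Local Open Scope classical_set_scope.

Theorem theorem1 (R : realType) (d : R) (hd : 1 <= d) :
  exists q0 : nat, forall q : nat, (q0 <= q)%N ->
    exists C K : R,
      Gnp_prob (d / n%:R)
        (fun G : {set {set 'I_n}} =>
           gibbs_mixes_within 'I_q G (K * n%:R `^ C))
        @[n --> \oo] --> (1 : R).
Proof.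
have [A A0 hA] : exists2 A, (0 < A)%N & 512 * d * expR (16 * d) <= 2 ^+ A.
  exists (Num.truncn (512 * d * expR (16 * d))).+1 => //.
  apply: ltW; apply: lt_trans (truncnS_gt _) _.
  by rewrite -natrX ltr_nat ltn_expl.
exists (2 ^ (24 * A + 2))%N => q Aq.
exists (poly_deg q)%:R, (poly_coef q)%:R.
pose c : R := 1 + expR d * (32 * 6 ^+ 6).
have c0 : 0 <= c by rewrite addr_ge0 // mulr_ge0 ?expR_ge0.
apply/cvgrPdist_le => eps eps0.
pose L := Num.truncn (c / eps).
(* The first threshold makes [trunc_log 2 n] at least [L]; the second makes [d / n] a
   probability. *)
exists (maxn (2 ^ L) (Num.truncn d).+1) => // n /=.
rewrite geq_max => /andP[nL nd].
have n0 : (0 < n)%N by apply: leq_trans nL; rewrite expn_gt0.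
have dn : d <= n%:R.
  by apply: le_trans (ltW (truncnS_gt d)) _; rewrite ler_nat.
have p0 := p_ge0 n hd; have p1 := p_le1 hd dn.
have low := good_prob hd A0 Aq hA n0 dn.
rewrite ger0_norm ?subr_ge0 ?Gnp_prob_le1 // lerBlDr -lerBlDl.
apply: le_trans low; rewrite lerB // ler_pdivrMr ?ltr0n // [leRHS]mulrC -ler_pdivrMr //.
apply: le_trans (ltW (truncnS_gt _)) _; rewrite ler_nat ltnS.
by apply: trunc_log_max.
Qed.
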